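(* Let $\beta>0$. (i) If $f\in L^p(\mathbb{R})$ for some $1<p\le2$, then $\widehat{\mathcal{C}_\beta f}=\mathcal{C}_\beta^*\hat f$ (almost everywhere). (ii) If $f\in L^p(\mathbb{R})$ for some $1\le p\le2$, then $\widehat{\mathcal{C}_\beta^*f}=\mathcal{C}_\beta\hat f$ (almost everywhere).
   Context: The Fourier transform of $f\in L^1(\mathbb{R})$ is $\hat f(t)=\int_{-\infty}^\infty e^{-ixt}f(x)\,dx$; for $f\in L^p(\mathbb{R})$ with $1<p\le2$, $\hat f\in L^{p'}(\mathbb{R})$ ($\frac1p+\frac1{p'}=1$) is the $L^{p'}$-limit of $\int_{-R}^Re^{-ixt}f(x)\,dx$ as $R\to\infty$. The generalized Cesàro operator on $\mathbb{R}$ is $\mathcal{C}_\beta f(t)=\frac{\beta}{|t|^\beta}\int_t^0(s-t)^{\beta-1}f(s)\,ds$ for $t<0$, $\mathcal{C}_\beta f(t)=\frac{\beta}{t^\beta}\int_0^t(t-s)^{\beta-1}f(s)\,ds$ for $t>0$ (and $\mathcal{C}_\beta f(0)=f(0)$), i.e. $\mathcal{C}_\beta f(t)=\beta\int_0^1(1-r)^{\beta-1}f(tr)\,dr$. The generalized dual Cesàro operator is $\mathcal{C}_\beta^*f(t)=\beta\int_{-\infty}^t\frac{(t-s)^{\beta-1}}{|s|^\beta}f(s)\,ds$ for $t<0$, $\mathcal{C}_\beta^*f(t)=\beta\int_t^\infty\frac{(s-t)^{\beta-1}}{s^\beta}f(s)\,ds$ for $t>0$ (and $\mathcal{C}_\beta^*f(0)=0$).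 *)

(* Defs.v *)
From HB Require Import structures.
From mathcomp Require Import all_boot all_order all_algebra.
From mathcomp Require Import all_classical all_reals all_analysis.
From mathcomp Require Import complex.
Set Implicit Arguments. Unset Strict Implicit. Unset Printing Implicit Defensive.
Import Order.TTheory GRing.Theory Num.Theory.
Local Open Scope classical_set_scope.
Local Open Scope ring_scope.
Local Open Scope complex_scope.

Section FourierCesaro.
Variable R : realType.
Local Notation mu := (@lebesgue_measure R).

Definition cnorm (z : R[i]) : R := Num.sqrt (complex.Re z ^+ 2 + complex.Im z ^+ 2).

Definition expi (th : R) : R[i] := Complex (cos th) (sin th).

Definition cintegral (D : set R) (f : R -> R[i]) : R[i] :=
  Complex (Rintegral mu D (fun x => complex.Re (f x)))
          (Rintegral mu D (fun x => complex.Im (f x))).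

Definition cmeasurable (f : R -> R[i]) : Prop :=
  measurable_fun setT (fun x => complex.Re (f x)) /\
  measurable_fun setT (fun x => complex.Im (f x)).

Definition in_Lp (p : R) (f : R -> R[i]) : Prop :=
  cmeasurable f /\ (Lnorm mu p%:E (fun x => (cnorm (f x))%:E) < +oo)%E.

Definition conj_exp (p : R) : R := p / (p - 1).

Definition fourier_trunc (f : R -> R[i]) (r t : R) : R[i] :=
  cintegral [set x | - r <= x <= r] (fun x => expi (- (x * t)) * f x).

Definition fourier_L1 (f : R -> R[i]) (t : R) : R[i] :=
  cintegral setT (fun x => expi (- (x * t)) * f x).

(* is_fourier p f g : f \in L^p(R) (1 <= p <= 2) and g is (a representative of)
   its Fourier transform: for p = 1, g t = int e^{-ixt} f(x) dx for every t;
   for 1 < p <= 2, g \in L^{p'} and g is the L^{p'}-limit as r -> oo of the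
   truncated integrals int_{-r}^{r} e^{-ixt} f(x) dx. *)
Definition is_fourier (p : R) (f g : R -> R[i]) : Prop :=
  in_Lp p f /\
  if p == 1 then (forall t, g t = fourier_L1 f t)
  else in_Lp (conj_exp p) g /\
       (fun r => Lnorm mu (conj_exp p)%:E
                   (fun t => (cnorm (fourier_trunc f r t - g t))%:E))
         @ +oo --> 0%E.

Definition Ces (beta : R) (f : R -> R[i]) (t : R) : R[i] :=
  (beta%:C * cintegral [set r | 0 <= r <= 1]
      (fun r => ((1 - r) `^ (beta - 1))%:C * f (t * r)))%R.

Definition Cesdual (beta : R) (f : R -> R[i]) (t : R) : R[i] :=
  if t < 0 then
    (beta%:C * cintegral [set s | s <= t]
        (fun s => ((t - s) `^ (beta - 1) / (`|s| `^ beta))%:C * f s))%R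
  else if 0 < t then
    (beta%:C * cintegral [set s | t <= s]
        (fun s => ((s - t) `^ (beta - 1) / (s `^ beta))%:C * f s))%R
  else 0.

End FourierCesaro.

(* Main.v *)
Require Import Defs.
From HB Require Import structures.
From mathcomp Require Import all_boot all_order all_algebra.
From mathcomp Require Import all_classical all_reals all_analysis.
From mathcomp Require Import complex.
From mathcomp Require Import measurable_realfun ring lra.
Import Order.TTheory GRing.Theory Num.Theory.
Import numFieldNormedType.Exports.
Local Open Scope classical_set_scope.
Local Open Scope ring_scope.
Local Open Scope complex_scope.
Set Implicit Arguments. Unset Strict Implicit. Unset Printing Implicit Defensive.

(** Both operators are averages of dilations,
    H f(x) = int V(u) f(x th(u)) du, with th <= 1 for the Cesaro operator and
    th >= 1 for its dual, and Fubini gives, for the truncated transforms F_r,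
      F_r(H f)(t) = int (V/th)(u) F_{r th(u)} f (t / th(u)) du.
    If g is the Fourier transform of f, then F_r(H f) - H' g is the average of
    the dilated differences (F_{r th} f - g)(t / th), where H' is the operator
    with weight V/th and dilation 1/th; a weighted Jensen inequality bounds its
    L^{p'} norm by an average of the norms of F_{r th} f - g.  When th >= 1
    these are all small for large r, which proves (ii).

    For (i), th(u) = u may be so small that r u stays bounded.  The Hausdorff-Young
    inequality would bound the corresponding norms, but it is not needed:
    with u <= kappa, exchanging the integrals leaves the kernel
      int_{|y|/r}^{kappa} (1-u)^(beta-1) e^{-iyt/u} du/u,
    which integration by parts bounds, uniformly in r, by a multiple of
    e(y t / kappa), where e(z) = |z|^(-delta) for |z| < 1 and 1/|z| otherwise.
    The transform with kernel e(y t) maps L^p to L^{p'} for 1 < p <= 2, so the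
    part u <= kappa is O(kappa) in the p'-th power of the norm. *)

(** * Change of variables and integral inequalities *)

Section dilation.
Variable R : realType.
Local Notation mu := (@lebesgue_measure R).

(** Jensen is used with the density V(u) c(u) du, where c(u) is the growth of the norm under the
    dilation; it takes the place of Minkowski's integral inequality, and its cost is the finiteness
    of int V c, here always a beta integral. Acting on f this integral is that of (1-u)^(beta-1)
    u^(-1/p) for the Cesaro operator, whence p > 1 in (i), and that of (1-u)^(beta-1) u^(1/p-1) for
    the dual, which admits p = 1 in (ii). In (i), for u <= kappa the difference of F_{ru} f and g
    need not be small, so its two terms are estimated apart: g by the small mass of the weight near
    0, F_{ru} f through the kernel. An absolute bound of that kernel produces log(1/|z|) for |z| <
    1; the power |z|^(-delta) dominates it and keeps every majorant a pair of powers. Since the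
    majorant depends on y t / kappa only, a dilation in t yields the factor kappa. The order of
    choice is kappa first, then r with r kappa >= r_0. Integrals are total, with value 0 on
    non-integrable functions, so exchanges and splittings are made at almost every point, where the
    average of absolute values is finite. *)

Lemma measurable_invr : measurable_fun setT (fun x : R => x^-1).
Proof.
(* The identity also holds at 0, where the inverse is 0 by convention, and reduces the claim to a
   power of a nonnegative number. *)
rewrite (_ : (fun x => _) = (fun x => x * (x ^+ 2) `^ (-1))); last first.
  apply/funext => x; rewrite powR_inv1 ?sqr_ge0//.
  have [->|x0] := eqVneq x 0; first by rewrite invr0 mul0r.
  by rewrite expr2 invfM mulrA divff// mul1r.
apply: measurable_funM => //.
apply: (measurableT_comp (measurable_powR (-1))).
exact: measurable_funX.
Qed.

(** A negative slope produces an interval closed on the other side, of the same length. Half-open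
    intervals are enough because they determine Lebesgue measure. *)
Lemma preimage_affine_ocitv (a e : R) (X : set R) : a != 0 -> ocitv X ->
  (mu ((fun x => (x * a + e)%R) @^-1` X) = (`|a|^-1)%:E * mu X)%E.
Proof.
move=> a0 [[c d]] _ <-.
have [ap|an|] := ltgtP a 0; last by move/eqP; rewrite (negbTE a0).
- have -> : (fun x => x * a + e) @^-1` [set` `]c, d]] = `[(d - e) / a, (c - e) / a[%classic.
    apply/seteqP; split => x /=; rewrite !in_itv/= ler_ndivrMr// ltr_ndivlMr// ltrBlDr lerBrDr => /andP[-> ->]//.
  rewrite !lebesgue_measure_itv/= !lte_fin ltr_nM2r ?invr_lt0// ltrD2r.
  case: ifPn => _; last by rewrite mule0.
  rewrite -EFinD -EFinM -mulrBl ltr0_norm// invrN mulNr -mulrN opprB mulrC.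
  by congr (_ * _)%:E; ring.
- have -> : (fun x => x * a + e) @^-1` [set` `]c, d]] = `](c - e) / a, (d - e) / a]%classic.
    apply/seteqP; split => x /=; rewrite !in_itv/= ltr_pdivrMr// ler_pdivlMr// ltrBlDr lerBrDr => /andP[-> ->]//.
  rewrite !lebesgue_measure_itv/= !lte_fin ltr_pM2r ?invr_gt0// ltrD2r.
  case: ifPn => _; last by rewrite mule0.
  rewrite -EFinD -EFinM -mulrBl gtr0_norm// mulrC.
  by congr (_ * _)%:E; ring.
Qed.

Lemma ge0_integral_affine (a e : R) (f : R -> \bar R) : a != 0 ->
  measurable_fun setT f -> (forall x, 0 <= f x)%E ->
  (\int[mu]_x f (x * a + e)%R = (`|a|^-1)%:E * \int[mu]_x f x)%E.
Proof.
move=> a0 mf f0.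
have ma : measurable_fun setT (fun x : measurableTypeR R => (x * a + e : measurableTypeR R)).
  by apply: measurable_funD => //; apply: measurable_funM.
pose F := fun x : measurableTypeR R => (x * a + e : measurableTypeR R).
have an : 0 <= `|a| by [].
have bn : 0 <= `|a|^-1 by rewrite invr_ge0.
have E A : measurable A -> pushforward mu F A = mscale (NngNum bn) mu A.
  move=> mA; rewrite /mscale/=.
  (* [|a|] times the pushforward agrees with Lebesgue measure on half-open intervals, so uniqueness
     identifies the two measures. *)
  rewrite (@lebesgue_measure_unique R (mscale (NngNum an) (pushforward mu F)) _ A mA)//.
    by rewrite /mscale/= muleA -EFinM mulVf ?normr_eq0// mul1e.
  move=> X oX; transitivity (`|a|%:E * mu ((fun x => (x * a + e)%R) @^-1` X))%E; last by [].
  by rewrite preimage_affine_ocitv// muleA -EFinM divff ?normr_eq0// mul1e.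
have := @ge0_integral_pushforward _ _ _ _ R _ ma mu setT f measurableT mf.
rewrite preimage_setT /= => <-; last by move=> x _; exact: f0.
rewrite (eq_measure_integral (mscale (NngNum bn) mu)); last first.
  by move=> A mA _; exact: E.
by rewrite ge0_integral_mscale.
Qed.

Lemma ge0_integral_dilate (a : R) (f : R -> \bar R) : a != 0 ->
  measurable_fun setT f -> (forall x, 0 <= f x)%E ->
  (\int[mu]_x f (x * a)%R = (`|a|^-1)%:E * \int[mu]_x f x)%E.
Proof.
move=> a0 mf f0; rewrite -(ge0_integral_affine 0 a0 mf f0).
by apply: eq_integral => x _; rewrite addr0.
Qed.

(* The density of the Haar measure of the multiplicative group of positive reals. *)
Definition kmul (x : R) : R := if 0 < x then x^-1 else 0.

Lemma kmul_ge0 x : 0 <= kmul x.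
Proof. by rewrite /kmul; case: ifPn => // /ltW; rewrite invr_ge0. Qed.

Lemma measurable_kmul : measurable_fun setT kmul.
Proof.
rewrite /kmul; apply: measurable_fun_ifT => //=.
  by apply: measurable_fun_ltr.
exact: measurable_invr.
Qed.

Lemma integral_kmul_dilate (a : R) (f : R -> \bar R) : 0 < a ->
  measurable_fun setT f -> (forall x, 0 <= f x)%E ->
  (\int[mu]_x ((kmul x)%:E * f (x * a)%R) = \int[mu]_x ((kmul x)%:E * f x))%E.
Proof.
move=> a0 mf f0.
have mk : measurable_fun setT (fun x => (kmul x)%:E * f x)%E.
  apply: emeasurable_funM => //; apply/measurable_EFinP; exact: measurable_kmul.
have k0 x : (0 <= (kmul x)%:E * f x)%E by rewrite mule_ge0// lee_fin kmul_ge0.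
under eq_integral => x _.
  rewrite (_ : (kmul x)%:E = a%:E * (kmul (x * a))%:E)%E; last first.
    rewrite -EFinM /kmul pmulr_lgt0//; case: ifPn => [x0|]; last by rewrite mulr0.
    by rewrite invfM mulrCA divff ?mulr1// gt_eqF.
  rewrite -muleA.
  over.
rewrite ge0_integralZl//=.
- rewrite (@ge0_integral_dilate a (fun x => (kmul x)%:E * f x)%E)// ?gt_eqF//.
  by rewrite muleA -EFinM gtr0_norm// divff ?gt_eqF// mul1e.
- by apply: (measurableT_comp mk); apply: measurable_funM.
- by rewrite lee_fin ltW.
Qed.

(** Inversion invariance follows from dilation invariance alone. With A the integral against dx/x, g
    the indicator of [1,2] and c = A(g), Tonelli and dilations give A(f) c = A_u A_x (g(u) f(x/u)) =
    A_x A_u (g(u x) f(1/u)) = A(f(1/x)) c. Since 1/2 <= c <= 1, c can be divided out. *)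
Lemma integral_kmul_inv (f : R -> \bar R) :
  measurable_fun setT f -> (forall x, 0 <= f x)%E ->
  (\int[mu]_x ((kmul x)%:E * f (x^-1)%R) = \int[mu]_x ((kmul x)%:E * f x))%E.
Proof.
move=> mf f0.
pose g (x : R) : \bar R := (\1_`[1, 2] x)%:E.
have mg : measurable_fun setT g.
  by apply/measurable_EFinP; exact: measurable_indic.
have g0 x : (0 <= g x)%E by rewrite lee_fin.
pose c := (\int[mu]_x ((kmul x)%:E * g x))%E.
have mkE : measurable_fun setT (EFin \o kmul).
  by apply/measurable_EFinP; exact: measurable_kmul.
have k0 x : (0 <= (kmul x)%:E)%E by rewrite lee_fin kmul_ge0.
have ci : mu `[1, 2]%classic = 1%:E.
  by rewrite lebesgue_measure_itv/= lte_fin ltr1n -EFinD; congr EFin; lra.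
have c_fin : (c <= 1%:E)%E.
  rewrite /c -ci -(setIT `[1, 2]%classic) -integral_indic//.
  apply: ge0_le_integral => //=.
  - by move=> x _; rewrite mule_ge0.
  - by apply: emeasurable_funM.
  - move=> x _; rewrite /g -EFinM lee_fin indicE.
    have [|] := boolP (x \in `[1, 2]%classic); last by rewrite mulr0.
    rewrite inE /= in_itv/= => /andP[x1 x2]; rewrite mulr1 /kmul (lt_le_trans ltr01 x1).
    by rewrite invf_le1// (lt_le_trans ltr01 x1).
have c_gt : (2^-1%:E <= c)%E.
  have -> : 2^-1%:E = (\int[mu]_x ((2^-1 : R)%:E * g x))%E.
    rewrite ge0_integralZl// ?lee_fin// /g integral_indic// setIT.
    by transitivity ((2^-1)%:E * mu `[1%R, 2%R]%classic)%E => //; rewrite ci mule1.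
  apply: ge0_le_integral => //=.
  - by move=> x _; rewrite mule_ge0// lee_fin.
  - by apply: measurable_funeM.
  - by apply: emeasurable_funM.
  - move=> x _; rewrite /g -!EFinM lee_fin indicE.
    have [|] := boolP (x \in `[1, 2]%classic); last by rewrite !mulr0.
    rewrite inE /= in_itv/= => /andP[x1 x2]; rewrite !mulr1 /kmul (lt_le_trans ltr01 x1).
    by rewrite lef_pV2 ?posrE// (lt_le_trans ltr01 x1).
have mfi : measurable_fun setT (fun x : R => f x^-1).
  by apply: (measurableT_comp mf); exact: measurable_invr.
pose A h := (\int[mu]_x ((kmul x)%:E * h x))%E.
have key : (A f * c = A (fun x => f (x^-1)%R) * c)%E.
  transitivity (\int[mu]_u ((kmul u)%:E * g u * A f))%E.
    rewrite ge0_integralZr//=.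
    + by rewrite muleC.
    + by apply: emeasurable_funM.
    + by move=> x _; rewrite mule_ge0.
    + by apply: integral_ge0 => x _; rewrite mule_ge0.
  transitivity (\int[mu]_u \int[mu]_x ((kmul u)%:E * g u * ((kmul x)%:E * f (x / u)%R)))%E.
    apply: eq_integral => u _.
    have [u0|u0] := ltP 0 u; last first.
      by rewrite /kmul ltNge u0/= !mul0e integral0_eq// => x _; rewrite !mul0e.
    rewrite /A -(@integral_kmul_dilate u^-1 f) ?invr_gt0//.
    rewrite ge0_integralZl//=.
    + apply: emeasurable_funM => //; apply: (measurableT_comp mf); exact: measurable_funM.
    + by move=> x _; rewrite mule_ge0.
    + by rewrite mule_ge0.
  rewrite (@fubini_tonelli _ _ _ _ R mu mu (fun z => (kmul z.1)%:E * g z.1 * ((kmul z.2)%:E * f (z.2 / z.1)%R))%E)//=; last 2 first.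
    + apply: emeasurable_funM; apply: emeasurable_funM.
      - by apply: (measurableT_comp mkE).
      - by apply: (measurableT_comp mg).
      - by apply: (measurableT_comp mkE).
      - apply: (measurableT_comp mf); apply: measurable_funM => //; apply: (measurableT_comp measurable_invr) => //.
    + by move=> x; rewrite !mule_ge0.
  transitivity (\int[mu]_x \int[mu]_u ((kmul x)%:E * ((kmul u)%:E * (g (u * x)%R * f (u^-1)%R))))%E.
    apply: eq_integral => x _.
    have [x0|x0] := ltP 0 x; last first.
      by rewrite /kmul [X in if X then _ else _]ltNge x0/= !integral0_eq// => u _; rewrite !(mul0e,mule0).
    rewrite ge0_integralZl//=; last 2 first.
      - apply: emeasurable_funM => //; apply: emeasurable_funM => //.
        by apply: (measurableT_comp mg); exact: measurable_funM.
      - by move=> u _; rewrite !mule_ge0.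
    under eq_integral.
      move=> u _; rewrite (_ : _ * _ = (kmul x)%:E * ((kmul u)%:E * (g u * f (x / u)%R)))%E; last first.
        by rewrite -!muleA; rewrite [in LHS](muleCA (g u)) [in LHS](muleCA (kmul u)%:E).
      over.
    rewrite ge0_integralZl//=; last 2 first.
      - apply: emeasurable_funM => //; apply: emeasurable_funM => //.
        by apply: (measurableT_comp mf); apply: measurable_funM => //; exact: measurable_invr.
      - by move=> u _; rewrite !mule_ge0.
    congr (_ * _)%E.
    rewrite -(@integral_kmul_dilate x (fun u => g u * f (x / u)%R)%E)//.
    - apply: eq_integral => u _; congr (_ * (_ * f _))%E.
      by rewrite invfM mulrCA divff ?mulr1// gt_eqF.
    - apply: emeasurable_funM => //.
      by apply: (measurableT_comp mf); apply: measurable_funM => //; exact: measurable_invr.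
    - by move=> u; rewrite mule_ge0.
  rewrite (@fubini_tonelli _ _ _ _ R mu mu (fun z => (kmul z.1)%:E * ((kmul z.2)%:E * (g (z.2 * z.1)%R * f (z.2^-1)%R)))%E)//=; last 2 first.
    + apply: emeasurable_funM; last apply: emeasurable_funM; last apply: emeasurable_funM.
      - by apply: (measurableT_comp mkE).
      - by apply: (measurableT_comp mkE).
      - by apply: (measurableT_comp mg); apply: measurable_funM.
      - apply: (measurableT_comp mf); apply: (measurableT_comp measurable_invr) => //.
    + by move=> x; rewrite !mule_ge0.
  rewrite /A -ge0_integralZr//=; last 3 first.
    + by apply: emeasurable_funM.
    + by move=> x _; rewrite mule_ge0.
    + by apply: integral_ge0 => x _; rewrite mule_ge0.
  apply: eq_integral => u _.
  have [u0|u0] := ltP 0 u; last first.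
    by rewrite /kmul [X in if X then _ else _]ltNge u0/= !mul0e integral0_eq// => x _; rewrite !(mul0e,mule0).
  under eq_integral.
    move=> x _; rewrite (_ : _ * _ = (kmul u)%:E * f (u^-1)%R * ((kmul x)%:E * (g (x * u)%R)))%E; last first.
      by rewrite [in RHS]muleCA; congr (_ * _)%E; rewrite -muleA (muleC (f _)) mulrC.
    over.
  rewrite ge0_integralZl//=.
  - by rewrite integral_kmul_dilate.
  - apply: emeasurable_funM => //.
    by apply: (measurableT_comp mg); apply: measurable_funM.
  - by move=> x _; rewrite mule_ge0.
  - by rewrite mule_ge0.
have c_f : c \is a fin_num.
  rewrite ge0_fin_numE; first exact: (le_lt_trans c_fin (ltry _)).
  by apply: (le_trans _ c_gt); rewrite lee_fin.
have c_n0 : c != 0%E by rewrite gt_eqF// (lt_le_trans _ c_gt)// lte_fin.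
have : (A f * c / c = A (fun x => f (x^-1)%R) * c / c)%E by rewrite key.
by rewrite -!muleA divee// !mule1.
Qed.

End dilation.

(** * Power and beta integrals, weighted Jensen inequality, averages in L^q *)

Section integral_inequalities.
Variable R : realType.
Local Notation mu := (@lebesgue_measure R).

Lemma integral_powR_y (a : R) : 0 < a ->
  (\int[mu]_x (if (1 <= x)%R then x `^ (- 1 - a) else 0)%:E < +oo)%E.
Proof.
move=> a0.
pose F (x : R) : R := - a^-1 * x `^ (- a).
have dF (x : R) : 0 < x -> is_derive x 1 F (x `^ (- 1 - a)).
  move=> x0.
  have xin : x \in `]0, +oo[ by rewrite in_itv/= x0.
  have d1 : is_derive x 1 (fun y => y `^ (- a)) (- a * x `^ (- a - 1)).
    apply: DeriveDef; first exact: derivable_powR.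
    by rewrite -derive1E powR_derive1.
  rewrite /F; apply: is_derive_eq.
  rewrite /GRing.scale/= !mulrA mulrNN mulVf ?gt_eqF// mul1r; congr (_ `^ _); ring.
have cF (x : R) : 0 < x -> {for x, continuous F}.
  move=> x0; apply: differentiable_continuous; apply/derivable1_diffP.
  by have [] := dF _ x0.
have H := @ge0_continuous_FTC2y R (fun x => x `^ (- 1 - a)) F 1 0.
have E : (\int[mu]_x (if (1 <= x)%R then x `^ (- 1 - a) else 0)%:E =
   \int[mu]_(x in `[1%R, +oo[) (x `^ (- 1 - a))%:E)%E.
  rewrite [RHS]integral_mkcond; apply: eq_integral => x _; rewrite patchE mem_setE in_itv/= andbT.
  by case: ifPn.
rewrite E H.
- exact: ltry.
- by move=> x _; exact: powR_ge0.
- apply: continuous_in_subspaceT => x; rewrite inE/= in_itv/= andbT => x1.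
  have x0 : 0 < x by exact: lt_le_trans x1.
  apply: differentiable_continuous; apply/derivable1_diffP.
  by apply: derivable_powR; rewrite in_itv/= x0.
- rewrite -(mulr0 (- a^-1)); apply: cvgM; first exact: cvg_cst.
  apply/cvgr0Pnorm_lt => e e0; near=> x.
  have x0 : 0 < x by near: x; exact: nbhs_pinfty_gt.
  rewrite ger0_norm ?powR_ge0// powRN invf_plt ?posrE ?powR_gt0//.
  have -> : e^-1 = (e^-1 `^ a^-1) `^ a.
    by rewrite -powRrM mulVf ?gt_eqF// powRr1// invr_ge0 ltW.
  rewrite gt0_ltr_powR// ?nnegrE ?powR_ge0// ?(ltW x0)//.
- by move=> x x1; have [] := dF _ (lt_trans ltr01 x1).
- exact: cvg_at_right_filter (cF _ ltr01).
- move=> x; rewrite in_itv/= andbT => x1; rewrite derive1E.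
  by have [_ ->] := dF _ (lt_trans ltr01 x1).
Unshelve. all: by end_near. Qed.

(** The inversion x -> 1/x of the measure dx/x carries the singularity at 0 to the tail at infinity,
    already treated. *)
Lemma integral_powR_01 (a : R) : 0 < a ->
  (\int[mu]_x (if (0 < x < 1)%R then x `^ (a - 1) else 0)%:E < +oo)%E.
Proof.
move=> a0.
pose phi (x : R) := (if (0 < x < 1)%R then x `^ a else 0)%:E.
have mphi : measurable_fun setT phi.
  apply/measurable_EFinP; apply: measurable_fun_ifT => //=.
    by apply: measurable_and; apply: measurable_fun_ltr.
rewrite (_ : \int[mu]_x _ = \int[mu]_x ((kmul x)%:E * phi x))%E; last first.
  apply: eq_integral => x _; rewrite /phi /kmul -EFinM; congr EFin.
  case: ifPn => [/andP[x0 x1]|]; last by rewrite mulr0.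
  rewrite x0 powRB; last by rewrite (gt_eqF x0) implybT.
  by rewrite powRr1 ?ltW// mulrC.
rewrite -integral_kmul_inv//; last first.
  by move=> x; rewrite lee_fin; case: ifPn => // _; exact: powR_ge0.
apply: le_lt_trans (integral_powR_y a0).
apply: ge0_le_integral => //=.
- move=> x _; rewrite mule_ge0 ?lee_fin ?kmul_ge0//.
  by case: ifPn => // _; exact: powR_ge0.
- apply: emeasurable_funM; first by apply/measurable_EFinP; exact: measurable_kmul.
  by apply: (measurableT_comp mphi); exact: measurable_invr.
- apply/measurable_EFinP; apply: measurable_fun_ifT => //=.
    by apply: measurable_fun_ler.
- move=> x _; rewrite /phi /kmul -EFinM lee_fin invr_gt0.
  have [x0|x0] := ltP 0 x; last by rewrite mul0r; case: ifPn => // _; exact: powR_ge0.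
  rewrite invf_lt1//; case: ifPn => [/= x1|_]; last by rewrite mulr0; case: ifPn => // _; exact: powR_ge0.
  rewrite (ltW x1) -(powR_inv1 (ltW x0)) -powRrM -powRD ?mulN1r//.
  by rewrite (gt_eqF x0) implybT.
Qed.

(** The power is at most 1 if g >= 0 and at most 2^(-g) if g < 0; the sum of the two bounds avoids a
    case distinction on the sign of g in later constants. *)
Lemma powR_half_bound (g x : R) : 2^-1 <= x <= 1 -> x `^ g <= 1 + 2^-1 `^ g.
Proof.
move=> /andP[x0 x1].
have x_gt0 : 0 < x by apply: lt_le_trans x0.
have [g0|g0] := leP 0 g.
  rewrite (@le_trans _ _ 1) ?lerDl ?powR_ge0//.
  have e1 : 1 `^ g = 1 :> R by rewrite powR1.
  by rewrite -[leRHS]e1 ge0_ler_powR ?nnegrE// ltW.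
rewrite (@le_trans _ _ (2^-1 `^ g)) ?lerDr//.
have E z : z `^ g = (z `^ (- g))^-1 :> R by rewrite -powRN opprK.
rewrite !E lef_pV2 ?posrE ?powR_gt0//.
by rewrite ge0_ler_powR ?nnegrE ?oppr_ge0 ?(ltW g0)// ltW.
Qed.

(** On each side of 1/2 one factor stays bounded and the other has an integrable singularity. The
    argument 1 - x is written as [x * -1 + 1] to fit the affine change of variables. *)
Lemma integral_beta_lty (a b : R) : 0 < a -> 0 < b ->
  (\int[mu]_x (if (0 < x < 1)%R then x `^ (a - 1) * (1 - x) `^ (b - 1) else 0)%:E < +oo)%E.
Proof.
move=> a0 b0.
pose phi (a x : R) := if (0 < x < 1)%R then x `^ (a - 1) else 0.
have mphi c : measurable_fun setT (phi c).
  apply: measurable_fun_ifT => //=.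
    by apply: measurable_and; apply: measurable_fun_ltr.
have p0 c x : 0 <= phi c x by rewrite /phi; case: ifPn => // _; exact: powR_ge0.
pose C (c : R) := 1 + 2^-1 `^ (c - 1).
have C0 c : 0 <= C c by rewrite addr_ge0// powR_ge0.
have m1 : measurable_fun setT (fun x : R => phi b (x * -1 + 1)).
  by apply: (measurableT_comp (mphi b)); apply: measurable_funD => //; apply: measurable_funM.
have le : (\int[mu]_x (if (0 < x < 1)%R then x `^ (a - 1) * (1 - x) `^ (b - 1) else 0)%:E <=
   \int[mu]_x ((C b)%:E * (phi a x)%:E + (C a)%:E * (phi b (x * -1 + 1)%R)%:E))%E.
  apply: ge0_le_integral => //=.
  - by move=> x _; rewrite lee_fin; case: ifPn => // _; rewrite mulr_ge0 ?powR_ge0.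
  - apply/measurable_EFinP; apply: measurable_fun_ifT => //=.
      by apply: measurable_and; apply: measurable_fun_ltr.
    apply: measurable_funM => //.
    apply: (measurableT_comp (measurable_powR _)); exact: measurable_funB.
  - apply: emeasurable_funD; apply: measurable_funeM; apply/measurable_EFinP; [exact: mphi|exact: m1].
  - move=> x _; rewrite -!EFinM -EFinD lee_fin.
    case: ifPn => [/andP[x0 x1]|_]; last by rewrite addr_ge0 ?mulr_ge0.
    have [xh|xh] := leP x 2^-1.
      rewrite (@le_trans _ _ (C b * phi a x)) ?lerDl ?mulr_ge0//.
      rewrite /phi x0 x1/= mulrC ler_wpM2r ?powR_ge0// powR_half_bound//; apply/andP; lra.
    rewrite (@le_trans _ _ (C a * phi b (x * -1 + 1))) ?lerDr ?mulr_ge0//.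
    rewrite /phi (_ : x * -1 + 1 = 1 - x); last by ring.
    rewrite (_ : 0 < 1 - x < 1) ?ler_wpM2r ?powR_ge0//; last by apply/andP; split; lra.
    by rewrite powR_half_bound//; apply/andP; lra.
apply: le_lt_trans le _.
rewrite ge0_integralD//=; last 4 first.
- by move=> x _; rewrite mule_ge0 ?lee_fin.
- by apply: measurable_funeM; apply/measurable_EFinP; exact: mphi.
- by move=> x _; rewrite mule_ge0 ?lee_fin.
- by apply: measurable_funeM; apply/measurable_EFinP; exact: m1.
rewrite !ge0_integralZl//=; try (by rewrite lee_fin); last 4 first.
- by apply/measurable_EFinP; exact: m1.
- by move=> x _; rewrite lee_fin.
- by apply/measurable_EFinP; exact: mphi.
- by move=> x _; rewrite lee_fin.
rewrite (@ge0_integral_affine R (-1) 1 (fun x => (phi b x)%:E))//; last 2 first.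
- by apply/measurable_EFinP; exact: mphi.
- by move=> x; rewrite lee_fin.
rewrite lte_add_pinfty//; rewrite ?muleA -?EFinM lte_mul_pinfty ?lee_fin ?mulr_ge0//; exact: integral_powR_01.
Qed.

Lemma le_poweR (x y : \bar R) (r : R) : 0 <= r -> (0 <= x)%E -> (x <= y)%E ->
  (x `^ r <= y `^ r)%E.
Proof.
move=> r0 x0 xy; apply: gt0_ler_poweR => //; rewrite in_itv/= leey andbT//.
exact: le_trans xy.
Qed.

Section jensen.
Context d (T : measurableType d) (nu : {measure set T -> \bar R}).

(** Hoelder applied to W F = W^(1/p) (W^(1/q) F), with p conjugate to q. The case q = 1, where p
    would be infinite, is an equality. *)
Lemma ge0_jensen (q : R) (W F : T -> R) : 1 <= q ->
  measurable_fun setT W -> measurable_fun setT F ->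
  (forall x, 0 <= W x) -> (forall x, 0 <= F x) ->
  ((\int[nu]_x (W x * F x)%:E) `^ q <=
   (\int[nu]_x (W x)%:E) `^ (q - 1) * \int[nu]_x (W x * F x `^ q)%:E)%E.
Proof.
rewrite le_eqVlt => /predU1P[<- mW mF W0 F0|q1 mW mF W0 F0].
  rewrite subrr poweRe0 mul1e poweRe1; last first.
    by apply: integral_ge0 => x _; rewrite lee_fin mulr_ge0.
  by under [leRHS]eq_integral => x _ do rewrite powRr1//.
have q0 : 0 < q by rewrite (lt_trans _ q1).
have q10 : 0 < q - 1 by rewrite subr_gt0.
pose p := q / (q - 1).
have p0 : 0 < p by rewrite divr_gt0.
have pq : p^-1 + q^-1 = 1 by rewrite /p; field; rewrite !gt_eqF.
pose f1 x := W x `^ p^-1; pose f2 x := W x `^ q^-1 * F x.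
have H := @hoelder _ _ _ nu f1 f2 p q.
have -> : (\int[nu]_x (W x * F x)%:E = 'N[nu]_1[EFin \o (f1 \* f2)%R])%E.
  rewrite Lnorm1; apply: eq_integral => x _ /=; rewrite /f1 /f2.
  rewrite ger0_norm ?mulr_ge0 ?powR_ge0// mulrA -powRD ?pq ?powRr1// oner_eq0//.
apply: (@le_trans _ _ (('N[nu]_p%:E[EFin \o f1] * 'N[nu]_q%:E[EFin \o f2]) `^ q)%E).
  apply: le_poweR; rewrite ?(ltW q0) ?Lnorm_ge0//.
  apply: H => //.
    exact: (measurableT_comp (measurable_powR _)).
  by apply: measurable_funM => //; exact: (measurableT_comp (measurable_powR _)).
rewrite poweRM ?Lnorm_ge0// poweR_Lnorm ?gt_eqF//.
rewrite le_eqVlt; apply/orP; left; apply/eqP; congr (_ * _)%E.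
- rewrite [in LHS]unlock -poweRrM; congr (_ `^ _)%E; last by rewrite /p; field; rewrite !gt_eqF.
  apply: eq_integral => x _ /=; rewrite /f1.
  by rewrite ger0_norm ?powR_ge0// -powRrM mulVf ?gt_eqF// powRr1.
- apply: eq_integral => x _ /=; rewrite /f2.
  rewrite ger0_norm ?mulr_ge0 ?powR_ge0// powRM ?powR_ge0//.
  by rewrite -powRrM mulVf ?gt_eqF// powRr1.
Qed.
End jensen.

Lemma measurable_ge0_integral_param d (T : measurableType d) (F : T * R -> \bar R) :
  measurable_fun setT F -> (forall z, 0 <= F z)%E ->
  measurable_fun setT (fun x : T => \int[mu]_y F (x, y))%E.
Proof.
move=> mF F0; exact: (@measurable_fun_fubini_tonelli_F _ _ T (measurableTypeR R) R mu F mF F0).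
Qed.

Lemma measurable_ge0_integral_paramr (F : R * R -> \bar R) :
  measurable_fun setT F -> (forall z, 0 <= F z)%E ->
  measurable_fun setT (fun y : R => \int[mu]_x F (x, y))%E.
Proof.
move=> mF F0.
exact: (@measurable_fun_fubini_tonelli_G _ _ (measurableTypeR R) (measurableTypeR R) R mu F mF F0).
Qed.

Lemma lebesgue_tonelli (F : R * R -> \bar R) :
  measurable_fun setT F -> (forall z, 0 <= F z)%E ->
  (\int[mu]_x \int[mu]_y F (x, y) = \int[mu]_y \int[mu]_x F (x, y))%E.
Proof.
move=> mF F0.
exact: (@fubini_tonelli _ _ (measurableTypeR R) (measurableTypeR R) R mu mu F mF F0).
Qed.

(* Jensen for the measure V c du applied to Phi / c; c u is the growth of the norm of Phi (u, _). *)
Lemma schur_integral (q : R) (V c : R -> R) (Phi : R * R -> R) (M : \bar R) :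
  1 <= q -> measurable_fun setT V -> measurable_fun setT c ->
  measurable_fun setT Phi ->
  (forall u, 0 <= V u) -> (forall u, 0 < c u) -> (forall z, 0 <= Phi z) ->
  (0 <= M)%E ->
  (forall u, V u != 0%R -> \int[mu]_t (Phi (u, t) `^ q)%:E <= M * (c u `^ q)%:E)%E ->
  (\int[mu]_u (V u * c u)%:E < +oo)%E ->
  (\int[mu]_t ((\int[mu]_u (V u * Phi (u, t))%:E) `^ q) <=
   (\int[mu]_u (V u * c u)%:E) `^ q * M)%E.
Proof.
move=> q1 mV mc mPhi V0 c0 Phi0 M0 PhiM Kfin.
set K := (\int[mu]_u (V u * c u)%:E)%E.
have q0 : 0 < q by apply: lt_le_trans q1.
have Vc0 u : 0 <= V u * c u by rewrite mulr_ge0// ltW.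
have K0 : (0 <= K)%E by apply: integral_ge0 => u _; rewrite lee_fin.
have mfst : measurable_fun setT (fst : R * R -> R) by exact: measurable_fst.
have mV1 : measurable_fun setT (fun z : R * R => V z.1) by exact: measurableT_comp.
have mc1 : measurable_fun setT (fun z : R * R => c z.1) by exact: measurableT_comp.
have mPhiq : measurable_fun setT (fun z => Phi z `^ q).
  exact: (measurableT_comp (measurable_powR _)).
(* The Jensen integrand V c (Phi / c)^q, simplified. *)
pose G (z : R * R) : R := V z.1 * c z.1 `^ (1 - q) * Phi z `^ q.
have G0 z : 0 <= G z by rewrite !mulr_ge0 ?powR_ge0.
have mG : measurable_fun setT G.
  apply: measurable_funM => //; apply: measurable_funM => //.
  exact: (measurableT_comp (measurable_powR _)).
have step t : ((\int[mu]_u (V u * Phi (u, t))%:E) `^ q <=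
     K `^ (q - 1) * \int[mu]_u (G (u, t))%:E)%E.
  have -> : (\int[mu]_u (V u * Phi (u, t))%:E = \int[mu]_u ((V u * c u) * (Phi (u, t) / c u))%:E)%E.
    apply: eq_integral => u _; congr EFin.
    by rewrite -mulrA (mulrCA (c u)) divff ?mulr1// gt_eqF.
  have mPt : measurable_fun setT (fun u => Phi (u, t)).
    by apply: (measurableT_comp mPhi); exact: measurable_pair2.
  apply: le_trans (ge0_jensen mu q1 _ _ Vc0 _) _.
  - exact: measurable_funM.
  - by apply: measurable_funM => //; exact: (measurableT_comp (@measurable_invr R)).
  - by move=> u; rewrite divr_ge0// ltW.
  rewrite le_eqVlt; apply/orP; left; apply/eqP; congr (_ * _)%E.
  apply: eq_integral => u _; congr EFin; rewrite /G/=.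
  rewrite powRM ?invr_ge0 ?(ltW (c0 _))// -(powR_inv1 (ltW (c0 u))) -powRrM mulN1r.
  rewrite (mulrC (Phi _ `^ q)) mulrA -(mulrA (V u)); congr (_ * _ * _).
  by rewrite -{1}(powRr1 (ltW (c0 u))) -powRD// (gt_eqF (c0 u)) implybT.
have mGE : measurable_fun setT (EFin \o G) by apply/measurable_EFinP.
have mint : measurable_fun setT (fun t => \int[mu]_u (G (u, t))%:E)%E.
  by apply: (@measurable_ge0_integral_paramr (EFin \o G)) => // z; rewrite lee_fin.
apply: (@le_trans _ _ (\int[mu]_t (K `^ (q - 1) * \int[mu]_u (G (u, t))%:E))%E).
  apply: ge0_le_integral => //=.
  - by move=> t _; exact: poweR_ge0.
  - apply: (measurableT_comp (measurable_poweR q)).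
    apply: (@measurable_ge0_integral_paramr (fun z => (V z.1 * Phi z)%:E)%E) => //.
      by apply/measurable_EFinP; exact: measurable_funM.
    by move=> z; rewrite lee_fin mulr_ge0.
  - exact: measurable_funeM.
rewrite ge0_integralZl//=; last 2 first.
- by move=> t _; apply: integral_ge0 => u _; rewrite lee_fin.
- exact: poweR_ge0.
rewrite -(@lebesgue_tonelli (EFin \o G))//=.
have : (\int[mu]_u \int[mu]_t (G (u, t))%:E <= \int[mu]_u ((V u * c u)%:E * M))%E.
  apply: ge0_le_integral => //=.
  - by move=> u _; apply: integral_ge0 => t _; rewrite lee_fin.
  - by apply: (@measurable_ge0_integral_param _ _ (EFin \o G)) => // z; rewrite lee_fin.
  - apply: emeasurable_funM => //; apply/measurable_EFinP; exact: measurable_funM.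
  (* The bound on Phi is available only where the weight is nonzero; elsewhere both sides are 0. *)
  - move=> u _; have [Vu0|Vu0] := eqVneq (V u) 0.
      rewrite Vu0 mul0r mul0e integral0_eq// => t _.
      by rewrite /G/= Vu0 !mul0r.
    under eq_integral => t _ do rewrite /G/= EFinM.
    rewrite ge0_integralZl//=.
    + apply: (@le_trans _ _ ((V u * c u `^ (1 - q))%:E * (M * (c u `^ q)%:E)))%E.
        by rewrite lee_pmul// ?lee_fin ?mulr_ge0 ?powR_ge0 ?PhiM//; apply: integral_ge0 => t _; rewrite lee_fin powR_ge0.
      rewrite (muleC M) muleA -EFinM -mulrA -powRD ?(gt_eqF (c0 u)) ?implybT//.
      by rewrite subrK powRr1// ltW.
    + apply/measurable_EFinP; apply: (measurableT_comp mPhiq); exact: measurable_pair1.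
    + by move=> t _; rewrite lee_fin powR_ge0.
    + by rewrite lee_fin mulr_ge0 ?powR_ge0.
rewrite ge0_integralZr//=; last 2 first.
- apply/measurable_EFinP; exact: measurable_funM.
- by move=> t _; rewrite lee_fin.
move=> H; apply: (@le_trans _ _ (K `^ (q - 1) * (K * M)))%E.
  by rewrite lee_wpmul2l// poweR_ge0.
rewrite muleA.
rewrite (_ : K `^ (q - 1) * K = K `^ q)%E//.
rewrite -(@fineK _ K) ?ge0_fin_numE// !poweR_EFin -EFinM; congr EFin.
by rewrite mulrC mulr_powRB1// fine_ge0.
Qed.

End integral_inequalities.

(** * Complex-valued integrals *)

Section complex_integral.
Variable R : realType.
Local Notation mu := (@lebesgue_measure R).
Implicit Types (f g : R -> R[i]) (z w : R[i]).

Lemma ae_imp (P Q : R -> Prop) : {ae mu, forall x, P x} ->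
  (forall x, P x -> Q x) -> {ae mu, forall x, Q x}.
Proof. by move=> HP PQ; apply: (@filterS _ _ (@ae_filter_ringOfSetsType _ _ R mu) _ _ PQ HP). Qed.

Lemma ae_and (P Q : R -> Prop) : {ae mu, forall x, P x} -> {ae mu, forall x, Q x} ->
  {ae mu, forall x, P x /\ Q x}.
Proof. by move=> HP HQ; apply: (@filterI _ _ (@ae_filter_ringOfSetsType _ _ R mu) _ _ HP HQ). Qed.

Lemma ge0_le_lintegral (f g : R -> \bar R) :
  measurable_fun setT f -> measurable_fun setT g ->
  (forall x, 0 <= f x)%E -> (forall x, f x <= g x)%E ->
  (\int[mu]_x f x <= \int[mu]_x g x)%E.
Proof. by move=> mf mg f0 fg; apply: ge0_le_integral. Qed.

Lemma cnorm_normc z : (cnorm z)%:C = `|z|.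
Proof. by case: z => a b; rewrite /cnorm normc_def. Qed.

Lemma cnorm_ge0 z : 0 <= cnorm z. Proof. exact: sqrtr_ge0. Qed.

Lemma cnormM z w : cnorm (z * w) = cnorm z * cnorm w.
Proof. by apply: complexI; rewrite rmorphM/= !cnorm_normc normrM. Qed.

Lemma cnormD z w : cnorm (z + w) <= cnorm z + cnorm w.
Proof. by rewrite -lecR rmorphD/= !cnorm_normc ler_normD. Qed.

Lemma cnormN z : cnorm (- z) = cnorm z.
Proof. by apply: complexI; rewrite !cnorm_normc normrN. Qed.

Lemma cnormB z w : cnorm (z - w) <= cnorm z + cnorm w.
Proof. by rewrite -(cnormN w) cnormD. Qed.

Lemma cnormR (a : R) : cnorm a%:C = `|a|.
Proof. by rewrite /cnorm/= expr0n/= addr0 sqrtr_sqr. Qed.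

Lemma cnorm_expi (t : R) : cnorm (expi t) = 1.
Proof. by rewrite /cnorm/expi/= cos2Dsin2 sqrtr1. Qed.

Lemma Re_le_cnorm z : `|complex.Re z| <= cnorm z.
Proof. by rewrite /cnorm -sqrtr_sqr ler_wsqrtr// lerDl sqr_ge0. Qed.

Lemma Im_le_cnorm z : `|complex.Im z| <= cnorm z.
Proof. by rewrite /cnorm -sqrtr_sqr ler_wsqrtr// lerDr sqr_ge0. Qed.

Lemma cnorm_le_ReIm z : cnorm z <= `|complex.Re z| + `|complex.Im z|.
Proof.
case: z => a b; rewrite /cnorm/= -[leRHS]ger0_norm ?addr_ge0// -sqrtr_sqr ler_wsqrtr//.
by rewrite sqrrD !real_normK ?num_real// -addrA lerD2l lerDr mulrn_wge0// mulr_ge0.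
Qed.

Definition cmfun d (T : measurableType d) (F : T -> R[i]) :=
  measurable_fun setT (fun x => complex.Re (F x)) /\
  measurable_fun setT (fun x => complex.Im (F x)).

Section cmfun.
Context d (T : measurableType d).
Implicit Types F G : T -> R[i].

Lemma cmfunM F G : cmfun F -> cmfun G -> cmfun (fun x => F x * G x).
Proof.
move=> [mF1 mF2] [mG1 mG2].
have E x : F x * G x = Complex (complex.Re (F x) * complex.Re (G x) - complex.Im (F x) * complex.Im (G x))
   (complex.Re (F x) * complex.Im (G x) + complex.Im (F x) * complex.Re (G x)).
  by case: (F x) (G x) => a b [c e].
split; under eq_fun do rewrite E/=.
- by apply: measurable_funB; apply: measurable_funM.
- by apply: measurable_funD; apply: measurable_funM.
Qed.

Lemma cmfunB F G : cmfun F -> cmfun G -> cmfun (fun x => F x - G x).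
Proof.
move=> [mF1 mF2] [mG1 mG2].
have E x : F x - G x = Complex (complex.Re (F x) - complex.Re (G x)) (complex.Im (F x) - complex.Im (G x)).
  by case: (F x) (G x) => a b [c e].
by split; under eq_fun do rewrite E/=; apply: measurable_funB.
Qed.

Lemma cmfun_real (F : T -> R) : measurable_fun setT F -> cmfun (fun x => (F x)%:C).
Proof. by move=> mF; split => //=. Qed.

Lemma cmfun_expi (F : T -> R) : measurable_fun setT F -> cmfun (fun x => expi (F x)).
Proof.
move=> mF; split => /=.
- apply: (measurableT_comp _ mF); apply: continuous_measurable_fun; exact: continuous_cos.
- apply: (measurableT_comp _ mF); apply: continuous_measurable_fun; exact: continuous_sin.
Qed.

Lemma measurable_cnorm F : cmfun F -> measurable_fun setT (fun x => cnorm (F x)).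
Proof.
move=> [m1 m2]; rewrite /cnorm.
apply: (measurableT_comp (measurable_realfun.continuous_measurable_fun (@sqrt_continuous R))).
by apply: measurable_funD; exact: measurable_funX.
Qed.

Lemma measurable_cnormE F : cmfun F -> measurable_fun setT (fun x => (cnorm (F x))%:E).
Proof. by move=> mF; apply/measurable_EFinP; exact: measurable_cnorm. Qed.

End cmfun.

Lemma cmfun_comp d (T : measurableType d) d' (T' : measurableType d') (h : T' -> T) (F : T -> R[i]) :
  measurable_fun setT h -> cmfun F -> cmfun (fun x => F (h x)).
Proof. by move=> mh [m1 m2]; split; [exact: (measurableT_comp m1)|exact: (measurableT_comp m2)]. Qed.

(** One of the positive and negative parts has infinite integral, so the extended integral is
    infinite, also for oo - oo, and [fine] sends it to 0. This convention makes real scaling and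
    dilation valid for all measurable functions. *)
Lemma Rintegral_nonintegrable (f : R -> R) : measurable_fun setT f ->
  ~ mu.-integrable setT (EFin \o f) -> Rintegral mu setT f = 0.
Proof.
move=> mf nf; rewrite -[LHS]/(fine (\int[mu]_x (EFin \o f) x))%E integralE.
have mE : measurable_fun setT (EFin \o f) by apply/measurable_EFinP.
have : (\int[mu]_x `|(EFin \o f) x|)%E = +oo%E.
  apply/eqP; rewrite -leye_eq leNgt; apply/negP => H; apply: nf.
  exact/integrableP.
have -> : (\int[mu]_x `|(EFin \o f) x| =
    \int[mu]_x ((EFin \o f)^\+ x + (EFin \o f)^\- x))%E.
  by apply: eq_integral => x _; rewrite -[RHS]/(((EFin \o f)^\+ \+ (EFin \o f)^\-)%E x) -fune_abse.
rewrite ge0_integralD//; last 2 first.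
- exact: measurable_funepos.
- exact: measurable_funeneg.
move: (\int[_]_x (_)^\+%E x)%E (\int[_]_x (_)^\-%E x)%E => A B.
by case: A => [a||]; case: B => [b||].
Qed.

Lemma RintegralZ_total (c : R) (f : R -> R) : measurable_fun setT f ->
  Rintegral mu setT (fun x => c * f x) = c * Rintegral mu setT f.
Proof.
move=> mf; have [->|c0] := eqVneq c 0.
  by under eq_Rintegral do rewrite mul0r; rewrite Rintegral_cst// !mul0r.
have [If|nIf] := pselect (mu.-integrable setT (EFin \o f)); first exact: RintegralZl.
rewrite !Rintegral_nonintegrable ?mulr0//; first exact: measurable_funM.
move=> H; apply: nIf.
have := integrableZl measurableT c^-1 H; apply: eq_integrable => // x _ /=.
by rewrite -EFinM mulrA mulVf// mul1r.
Qed.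

(** A dilation preserves non-integrability, and then both sides are 0; otherwise the positive and
    negative parts are dilated separately. *)
Lemma Rintegral_dilate (a : R) (f : R -> R) : a != 0 -> measurable_fun setT f ->
  Rintegral mu setT (fun x => f (x * a)) = `|a|^-1 * Rintegral mu setT f.
Proof.
move=> a0 mf.
have mfa : measurable_fun setT (fun x : R => f (x * a)).
  by apply: (measurableT_comp mf); exact: measurable_funM.
have mE : measurable_fun setT (EFin \o f) by apply/measurable_EFinP.
have mEa : measurable_fun setT (EFin \o (fun x : R => f (x * a)%R)) by apply/measurable_EFinP.
have an : (`|a|^-1)%:E \is a fin_num by [].
have H : (\int[mu]_x `|(EFin \o (fun x : R => f (x * a)%R)) x| = (`|a|^-1)%:E * \int[mu]_x `|(EFin \o f) x|)%E.
  by rewrite -(@ge0_integral_dilate R a (fun x => `|(EFin \o f) x|)%E)//; exact: measurableT_comp.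
have [If|nIf] := pselect (mu.-integrable setT (EFin \o f)); last first.
  rewrite !Rintegral_nonintegrable ?mulr0//.
  move=> /integrableP[_]; rewrite H => H2; apply: nIf; apply/integrableP; split => //.
  move: H2; case: (\int[mu]_x `|(EFin \o f) x|)%E => [r _||//]; first exact: ltry.
  by rewrite gt0_muley// lte_fin invr_gt0 normr_gt0.
rewrite /Rintegral -[X in X * _]/(fine (`|a|^-1)%:E) -fineM//; last exact: integrable_fin_num.
rewrite -[X in fine X = _]/(\int[mu]_x (EFin \o (fun x : R => f (x * a)%R)) x)%E.
rewrite -[X in (_ * X)%E]/(\int[mu]_x (EFin \o f) x)%E.
congr fine; rewrite integralE [in RHS]integralE muleBr//; last first.
  by apply: fin_num_adde_defr; apply: integrable_pos_fin_num.
congr (_ - _)%E.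
- transitivity (\int[mu]_x (EFin \o f)^\+ (x * a)%R)%E.
    by apply: eq_integral => x _; rewrite !funeposE.
  by rewrite (ge0_integral_dilate a0 (measurable_funepos mE)).
- transitivity (\int[mu]_x (EFin \o f)^\- (x * a)%R)%E.
    by apply: eq_integral => x _; rewrite !funenegE.
  by rewrite (ge0_integral_dilate a0 (measurable_funeneg mE)).
Qed.

(** The integrals of the positive and negative parts are measurable in the parameter by Tonelli, and
    so are their extended difference and its image under [fine], whether or not the sections are
    integrable. *)
Lemma measurable_Rintegral_param d (T : measurableType d) (F : T * R -> R) :
  measurable_fun setT F ->
  measurable_fun setT (fun x : T => Rintegral mu setT (fun y => F (x, y))).
Proof.
move=> mF; rewrite /Rintegral.
apply: (measurableT_comp (fine_measurable measurableT)) => //.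
under eq_fun do rewrite integralE.
have mE : measurable_fun setT (EFin \o F) by apply/measurable_EFinP.
apply: emeasurable_funB.
- have H : measurable_fun setT (fun x : T => \int[mu]_y (EFin \o F)^\+ (x, y))%E.
    by apply: measurable_ge0_integral_param => //; exact: (measurable_funepos mE).
  apply: eq_measurable_fun H => x _; apply: eq_integral => y _.
  by rewrite !funeposE.
- have H : measurable_fun setT (fun x : T => \int[mu]_y (EFin \o F)^\- (x, y))%E.
    by apply: measurable_ge0_integral_param => //; exact: (measurable_funeneg mE).
  apply: eq_measurable_fun H => x _; apply: eq_integral => y _.
  by rewrite !funenegE.
Qed.

Lemma Rintegral_fubini (F : R * R -> R) : measurable_fun setT F ->
  (\int[mu]_x \int[mu]_y `|(F (x, y))%:E| < +oo)%E ->
  Rintegral mu setT (fun x => Rintegral mu setT (fun y => F (x, y))) =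
  Rintegral mu setT (fun y => Rintegral mu setT (fun x => F (x, y))).
Proof.
move=> mF iF.
have mE : measurable_fun setT (EFin \o F) by apply/measurable_EFinP.
have IF : (mu \x mu)%E.-integrable setT (EFin \o F).
  by apply/(@integrable12ltyP _ _ (measurableTypeR R) (measurableTypeR R) R mu mu (EFin \o F) mE).
have := @Fubini _ _ (measurableTypeR R) (measurableTypeR R) R mu mu (EFin \o F) IF.
have mFs : measurable_fun setT (fun z : R * R => F (z.2, z.1)).
  by apply: (measurableT_comp mF); exact: measurable_swap.
move=> /= FE; rewrite /Rintegral; congr fine.
(* Inner integrals are finite for almost every parameter only, so the passage between real and
   extended values is an almost everywhere equality. *)
transitivity (\int[mu]_x \int[mu]_y (F (x, y))%:E)%E; last rewrite FE.
- apply: ae_eq_integral => //.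
  + by apply/measurable_EFinP; exact: measurable_Rintegral_param.
  + exact: (@measurable_fubini_F _ _ (measurableTypeR R) (measurableTypeR R) R mu mu (EFin \o F) IF).
  + have := @ae_integrable1 _ _ (measurableTypeR R) (measurableTypeR R) R mu mu (EFin \o F) IF.
    apply: filterS => x /= Ix _; rewrite fineK//; exact: integrable_fin_num.
- apply/esym; apply: ae_eq_integral => //.
  + by apply/measurable_EFinP; exact: (@measurable_Rintegral_param _ (measurableTypeR R) (fun z : R * R => F (z.2, z.1))).
  + exact: (@measurable_fubini_G _ _ (measurableTypeR R) (measurableTypeR R) R mu mu (EFin \o F) IF).
  + have := @ae_integrable2 _ _ (measurableTypeR R) (measurableTypeR R) R mu mu (EFin \o F) IF.
    apply: filterS => x /= Ix _; rewrite fineK//; exact: integrable_fin_num.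
Qed.

Lemma cint_mkcond (D : set R) f :
  cintegral D f = cintegral setT (fun x => (\1_D x)%:C * f x).
Proof.
rewrite /cintegral; congr Complex; rewrite Rintegral_mkcond; apply: eq_Rintegral => x _;
  rewrite patchE indicE; case: (f x) => a b /=; case: ifPn => _ /=; by rewrite ?(mul1r,mul0r,subr0,addr0).
Qed.

(* The constant 2 comes from bounding real and imaginary parts separately. *)
Lemma le_cnorm_cint f : cmfun f ->
  ((cnorm (cintegral setT f))%:E <= 2%:E * \int[mu]_x (cnorm (f x))%:E)%E.
Proof.
move=> mf; have [m1 m2] := mf.
have A (h : R -> R) : measurable_fun setT h -> (forall x, `|h x| <= cnorm (f x)) ->
   (`|Rintegral mu setT h|%:E <= \int[mu]_x (cnorm (f x))%:E)%E.
  move=> mh hf.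
  have [Ih|nIh] := pselect (mu.-integrable setT (EFin \o h)); last first.
    rewrite Rintegral_nonintegrable// normr0; apply: integral_ge0 => x _.
    by rewrite lee_fin cnorm_ge0.
  rewrite EFin_normr_Rintegral//; apply: le_trans (le_abse_integral _ _ _) _ => //.
    by apply/measurable_EFinP.
  apply: ge0_le_integral => //=.
  - by apply/measurable_EFinP; exact: measurableT_comp.
  - exact: measurable_cnormE.
  - by move=> x _; rewrite lee_fin.
apply: le_trans (_ : ((`|Rintegral mu setT (fun x => complex.Re (f x))| + `|Rintegral mu setT (fun x => complex.Im (f x))|)%:E <= _)%E).
  by rewrite lee_fin (le_trans (cnorm_le_ReIm _)).
rewrite EFinD (_ : 2%:E = 1%:E + 1%:E)%E; last by rewrite -EFinD.
rewrite ge0_muleDl ?lee_fin// mul1e leeD//; apply: A => // x.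
- exact: Re_le_cnorm.
- exact: Im_le_cnorm.
Qed.

Definition cL1 f := (\int[mu]_x (cnorm (f x))%:E < +oo)%E.

Lemma cL1_Re f : cmfun f -> cL1 f -> mu.-integrable setT (EFin \o (fun x => complex.Re (f x))).
Proof.
move=> mf If; have [m1 _] := mf; apply/integrableP; split; first exact/measurable_EFinP.
apply: le_lt_trans If; apply: ge0_le_integral => //=.
- by apply/measurable_EFinP; exact: measurableT_comp.
- exact: measurable_cnormE.
- by move=> x _; rewrite lee_fin Re_le_cnorm.
Qed.

Lemma cL1_Im f : cmfun f -> cL1 f -> mu.-integrable setT (EFin \o (fun x => complex.Im (f x))).
Proof.
move=> mf If; have [_ m1] := mf; apply/integrableP; split; first exact/measurable_EFinP.
apply: le_lt_trans If; apply: ge0_le_integral => //=.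
- by apply/measurable_EFinP; exact: measurableT_comp.
- exact: measurable_cnormE.
- by move=> x _; rewrite lee_fin Im_le_cnorm.
Qed.

Lemma integrable_EFinZl (c : R) (h : R -> R) : mu.-integrable setT (EFin \o h) ->
  mu.-integrable setT (EFin \o (fun x => c * h x)).
Proof. by move=> Ih; exact: (integrableZl measurableT c Ih). Qed.

Lemma cintZ z f : cmfun f -> cL1 f ->
  cintegral setT (fun x => z * f x) = z * cintegral setT f.
Proof.
move=> mf If; have IR := cL1_Re mf If; have II := cL1_Im mf If.
case: z => a b; rewrite /cintegral.
have E x : Complex a b * f x = Complex (a * complex.Re (f x) - b * complex.Im (f x))
   (a * complex.Im (f x) + b * complex.Re (f x)) by case: (f x).
rewrite (_ : Complex a b * Complex _ _ = Complex (a * Rintegral mu setT (fun x => complex.Re (f x)) - b * Rintegral mu setT (fun x => complex.Im (f x)))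
   (a * Rintegral mu setT (fun x => complex.Im (f x)) + b * Rintegral mu setT (fun x => complex.Re (f x)))) //.
congr Complex; under eq_Rintegral do rewrite E/=.
- by rewrite RintegralB// ?RintegralZl//; exact: integrable_EFinZl.
- by rewrite RintegralD// ?RintegralZl//; exact: integrable_EFinZl.
Qed.

(** A real factor scales each component separately, and that scaling is total; a complex factor
    mixes the components and calls for integrability. *)
Lemma cintZr (c : R) f : cmfun f ->
  cintegral setT (fun x => c%:C * f x) = c%:C * cintegral setT f.
Proof.
move=> [m1 m2]; rewrite /cintegral.
have E x : c%:C * f x = Complex (c * complex.Re (f x)) (c * complex.Im (f x)).
  by case: (f x) => a b; congr Complex => /=; rewrite mul0r ?subr0 ?addr0.
rewrite (_ : c%:C * Complex _ _ = Complex (c * Rintegral mu setT (fun x => complex.Re (f x)))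
   (c * Rintegral mu setT (fun x => complex.Im (f x)))); last first.
  by congr Complex => /=; rewrite mul0r ?subr0 ?addr0.
by congr Complex; under eq_Rintegral do rewrite E/=; rewrite RintegralZ_total.
Qed.

Lemma cintB f g : cmfun f -> cmfun g -> cL1 f -> cL1 g ->
  cintegral setT (fun x => f x - g x) = cintegral setT f - cintegral setT g.
Proof.
move=> mf mg If Ig.
have E x : f x - g x = Complex (complex.Re (f x) - complex.Re (g x)) (complex.Im (f x) - complex.Im (g x)).
  by case: (f x) (g x) => a b [c e].
rewrite /cintegral (_ : Complex _ _ - Complex _ _ = Complex (Rintegral mu setT (fun x => complex.Re (f x)) - Rintegral mu setT (fun x => complex.Re (g x)))
   (Rintegral mu setT (fun x => complex.Im (f x)) - Rintegral mu setT (fun x => complex.Im (g x))))//.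
congr Complex; under eq_Rintegral do rewrite E/=; rewrite RintegralB//; by [exact: cL1_Re|exact: cL1_Im].
Qed.

Lemma cint_ae f g : cmfun f -> cmfun g -> {ae mu, forall x, f x = g x} ->
  cintegral setT f = cintegral setT g.
Proof.
move=> [f1 f2] [g1 g2] fg.
have A (h k : R -> R) : measurable_fun setT h -> measurable_fun setT k ->
    {ae mu, forall x, h x = k x} -> Rintegral mu setT h = Rintegral mu setT k.
  move=> mh mk hk; rewrite /Rintegral; congr fine; apply: ae_eq_integral => //.
  - exact/measurable_EFinP.
  - exact/measurable_EFinP.
  - by apply: (@ae_imp (fun x => h x = k x) (fun x => setT x -> (h x)%:E = (k x)%:E)) => // x ->.
rewrite /cintegral; congr Complex; apply: A => //.
- by apply: (ae_imp fg) => x ->.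
- by apply: (ae_imp fg) => x ->.
Qed.

Lemma cint_dilate (a : R) f : a != 0 -> cmfun f ->
  cintegral setT (fun x => f (x * a)) = (`|a|^-1)%:C * cintegral setT f.
Proof.
move=> a0 [m1 m2]; rewrite /cintegral.
rewrite (@Rintegral_dilate a (fun x => complex.Re (f x)))// (@Rintegral_dilate a (fun x => complex.Im (f x)))//.
by congr Complex => /=; rewrite mul0r ?subr0 ?addr0.
Qed.

Lemma cmfun_cint d (T : measurableType d) (F : T * R -> R[i]) : cmfun F ->
  cmfun (fun x : T => cintegral setT (fun y => F (x, y))).
Proof. move=> [m1 m2]; split => /=.
- exact: (@measurable_Rintegral_param _ _ (fun z : T * R => complex.Re (F z))).
- exact: (@measurable_Rintegral_param _ _ (fun z : T * R => complex.Im (F z))).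
 Qed.

Lemma cint_fubini (F : R * R -> R[i]) : cmfun F ->
  (\int[mu]_x \int[mu]_y (cnorm (F (x, y)))%:E < +oo)%E ->
  cintegral setT (fun x => cintegral setT (fun y => F (x, y))) =
  cintegral setT (fun y => cintegral setT (fun x => F (x, y))).
Proof.
move=> mF iF; have [m1 m2] := mF; rewrite /cintegral/=.
have mcn := measurable_cnormE mF.
have A (h : R * R -> R) : measurable_fun setT h -> (forall x, `|h x| <= cnorm (F x)) ->
   (\int[mu]_x \int[mu]_y `|(h (x, y))%:E| < +oo)%E.
  move=> mh hF; apply: le_lt_trans iF; apply: ge0_le_lintegral.
  - apply: (@measurable_ge0_integral_param R _ _ (fun z : R * R => `|(h z)%:E|)%E) => //.
    by apply/measurable_EFinP; exact: measurableT_comp.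
  - apply: (@measurable_ge0_integral_param R _ _ (fun z : R * R => (cnorm (F z))%:E)%E) => //.
    by move=> z; rewrite lee_fin cnorm_ge0.
  - by move=> x; apply: integral_ge0.
  - move=> x; apply: ge0_le_lintegral => //.
    + apply/measurable_EFinP; apply: (@measurableT_comp _ _ _ _ _ _ (fun y : R => `|y|)) => //.
      by apply: (measurableT_comp mh); exact: measurable_pair1.
    + by apply: (measurableT_comp mcn); exact: measurable_pair1.
    + by move=> y; rewrite lee_fin.
congr Complex.
- apply: (@Rintegral_fubini (fun z : R * R => complex.Re (F z))) => //.
  by apply: (A (fun z : R * R => complex.Re (F z))) => // x; exact: Re_le_cnorm.
- apply: (@Rintegral_fubini (fun z : R * R => complex.Im (F z))) => //.
  by apply: (A (fun z : R * R => complex.Im (F z))) => // x; exact: Im_le_cnorm.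
Qed.

End complex_integral.

(** * Fourier transform of averages of dilations *)

Section hausdorff_operator.
Variable R : realType.
Local Notation mu := (@lebesgue_measure R).
Implicit Types (f g : R -> R[i]) (z w : R[i]).

(** The q-th power of the norm: it is an integral, hence fit for Tonelli and domination, and roots
    enter only in the comparison with [Lnorm]. *)
Definition Lpow (q : R) f := (\int[mu]_x (cnorm (f x) `^ q)%:E)%E.

Lemma Lpow_ge0 q f : (0 <= Lpow q f)%E.
Proof. by apply: integral_ge0 => x _; rewrite lee_fin powR_ge0. Qed.

Definition symI (r : R) : set R := [set x | - r <= x <= r].

Lemma measurable_symI r : measurable (symI r).
Proof.
rewrite (_ : symI r = `[- r, r]%classic); first exact: measurable_itv.
by apply/seteqP; split => x; rewrite /symI/= in_itv.
Qed.

Lemma symI_scale (r c x : R) : 0 < c -> (x \in symI (r * c)) = (x / c \in symI r).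
Proof.
move=> c0; apply/idP/idP; rewrite !inE /symI/= => /andP[a b]; apply/andP;
  move: a b; rewrite ?ler_pdivlMr ?ler_pdivrMr// ?mulNr//.
Qed.

Lemma fourier_truncE f (r c t : R) : 0 < c -> fourier_trunc f (r * c) t =
  cintegral setT (fun x => (\1_(symI r) (x / c))%:C * (expi (- (x * t)) * f x)).
Proof.
move=> c0; rewrite /fourier_trunc cint_mkcond; congr cintegral; apply/funext => x.
by rewrite !indicE -symI_scale.
Qed.

Lemma measurable_div_fst (h : R -> R) : measurable_fun setT h ->
  measurable_fun setT (fun z : R * R => z.2 / h z.1).
Proof.
move=> mh; apply: measurable_funM => //.
by apply: (measurableT_comp (@measurable_invr R)); exact: measurableT_comp.
Qed.

Section hausdorff.
Variables (V th : R -> R).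
Hypotheses (mV : measurable_fun setT V) (mth : measurable_fun setT th).
Hypotheses (V0 : forall u, 0 <= V u) (th0 : forall u, 0 < th u).

Definition hausdorff f (x : R) : R[i] := cintegral setT (fun u => (V u)%:C * f (x * th u)).

(** Extended-valued majorant of [hausdorff]; the points where it is finite are those where the
    average converges absolutely. *)
Definition ahausdorff f (x : R) : \bar R := (\int[mu]_u (V u * cnorm (f (x * th u)))%:E)%E.

Lemma measurable_mul_th : measurable_fun setT (fun z : R * R => z.1 * th z.2).
Proof. by apply: measurable_funM => //; exact: measurableT_comp. Qed.

Lemma cmfun_hausdorff f : cmfun f -> cmfun (hausdorff f).
Proof.
move=> mf; apply: (@cmfun_cint R _ _ (fun z : R * R => (V z.2)%:C * f (z.1 * th z.2))).
apply: cmfunM; first by apply: cmfun_real; exact: measurableT_comp.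
by apply: (cmfun_comp _ mf); exact: measurable_mul_th.
Qed.

Lemma measurable_ahausdorff f : cmfun f -> measurable_fun setT (ahausdorff f).
Proof.
move=> mf; apply: (@measurable_ge0_integral_param R _ _ (fun z : R * R => (V z.2 * cnorm (f (z.1 * th z.2)))%:E)).
  apply/measurable_EFinP; apply: measurable_funM; first exact: measurableT_comp.
  by apply: (measurableT_comp (measurable_cnorm mf)); exact: measurable_mul_th.
by move=> z; rewrite lee_fin mulr_ge0 ?cnorm_ge0.
Qed.

Lemma ahausdorff_ge0 f x : (0 <= ahausdorff f x)%E.
Proof. by apply: integral_ge0 => u _; rewrite lee_fin mulr_ge0 ?cnorm_ge0. Qed.

Lemma le_hausdorff f x : cmfun f ->
  ((cnorm (hausdorff f x))%:E <= 2%:E * ahausdorff f x)%E.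
Proof.
move=> mf; apply: le_trans (le_cnorm_cint _) _.
  apply: cmfunM; first exact: cmfun_real.
  by apply: (cmfun_comp _ mf); exact: measurable_funM.
rewrite /ahausdorff le_eqVlt; apply/orP; left; apply/eqP; congr (_ * _)%E.
by apply: eq_integral => u _; rewrite cnormM cnormR ger0_norm.
Qed.

(** The dilate f(x th) has L^q norm th^(-1/q) times that of f; this is the growth function passed to
    [schur_integral]. *)
Lemma ahausdorff_Lp (q : R) f : 1 <= q -> cmfun f ->
  (\int[mu]_u (V u * th u `^ (- q^-1))%:E < +oo)%E ->
  (\int[mu]_x (ahausdorff f x `^ q) <=
   (\int[mu]_u (V u * th u `^ (- q^-1))%:E) `^ q * Lpow q f)%E.
Proof.
move=> q1 mf KV; have q0 : 0 < q by exact: lt_le_trans q1.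
apply: (@schur_integral R q V (fun u => th u `^ (- q^-1)) (fun z : R * R => cnorm (f (z.2 * th z.1)))) => //.
- exact: (measurableT_comp (measurable_powR _)).
- apply: (measurableT_comp (measurable_cnorm mf)).
  by apply: measurable_funM => //; exact: measurableT_comp.
- by move=> u; exact: powR_gt0.
- by move=> z; exact: cnorm_ge0.
- exact: Lpow_ge0.
- move=> u _ /=; rewrite -powRrM mulNr mulVf ?gt_eqF// powR_inv1 ?(ltW (th0 u))//.
  rewrite (@ge0_integral_dilate R (th u) (fun x => (cnorm (f x) `^ q)%:E)) ?gt_eqF//.
  + by rewrite gtr0_norm// muleC.
  + apply/measurable_EFinP; apply: (measurableT_comp (measurable_powR _)); exact: measurable_cnorm.
  + by move=> x; rewrite lee_fin powR_ge0.
Qed.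

Lemma ae_ahausdorff_fin (q : R) f : 1 <= q -> cmfun f ->
  (\int[mu]_u (V u * th u `^ (- q^-1))%:E < +oo)%E -> (Lpow q f < +oo)%E ->
  {ae mu, forall x, (ahausdorff f x < +oo)%E}.
Proof.
move=> q1 mf KV Lf; have q0 : 0 < q by exact: lt_le_trans q1.
have mA : measurable_fun setT (fun x => ahausdorff f x `^ q)%E.
  by apply: (measurableT_comp (measurable_poweR q)); exact: measurable_ahausdorff.
have IA : mu.-integrable setT (fun x => ahausdorff f x `^ q)%E.
  apply/integrableP; split => //.
  under eq_integral do rewrite gee0_abs ?poweR_ge0//.
  apply: le_lt_trans (ahausdorff_Lp q1 mf KV) _.
  by rewrite lte_mul_pinfty ?poweR_ge0 ?fin_num_poweR ?ge0_fin_numE//; apply: integral_ge0 => u _; rewrite lee_fin mulr_ge0 ?powR_ge0.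
apply: (ae_imp (integrable_ae measurableT IA)) => x /(_ I).
rewrite fin_numElt => /andP[_]; apply: lty_poweRy; exact: lt0r_neq0.
Qed.

(** A function in L^q is locally integrable since y <= 1 + y^q. This is the absolute convergence
    behind Fubini for the truncated transform. *)
Lemma ahausdorff_loc (q r : R) f : 1 <= q -> cmfun f ->
  (\int[mu]_u (V u * th u `^ (- q^-1))%:E < +oo)%E -> (Lpow q f < +oo)%E ->
  (\int[mu]_x ((\1_(symI r) x)%:E * ahausdorff f x) < +oo)%E.
Proof.
move=> q1 mf KV Lf; have q0 : 0 < q by exact: lt_le_trans q1.
have mA := measurable_ahausdorff mf.
have mAq : measurable_fun setT (fun x => ahausdorff f x `^ q)%E.
  by apply: (measurableT_comp (measurable_poweR q)).
have mI : measurable_fun setT (EFin \o (\1_(symI r) : R -> R)).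
  by apply/measurable_EFinP; apply: measurable_indic; exact: measurable_symI.
apply: (@le_lt_trans _ _ (\int[mu]_x ((\1_(symI r) x)%:E + ahausdorff f x `^ q))%E).
  apply: ge0_le_lintegral.
  - exact: emeasurable_funM.
  - exact: emeasurable_funD.
  - by move=> x; rewrite mule_ge0 ?ahausdorff_ge0// lee_fin.
  - move=> x; rewrite indicE; case: (x \in symI r); last by rewrite mul0e add0e poweR_ge0.
    rewrite mul1e; have := ahausdorff_ge0 f x; case: (ahausdorff f x) => [y||]//; last first.
      by move=> _; rewrite poweRyr ?gt_eqF// addey.
    rewrite poweR_EFin -EFinD !lee_fin => y0.
    have [y1|y1] := leP y 1; first by rewrite (le_trans y1)// lerDl powR_ge0.
    by rewrite (@le_trans _ _ (y `^ q)) ?lerDr// le1r_powR// ltW.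
rewrite ge0_integralD//=; last by move=> x _; exact: poweR_ge0.
rewrite lte_add_pinfty//.
- rewrite integral_indic//; last exact: measurable_symI.
  rewrite setIT (_ : symI r = `[- r, r]%classic).
    by rewrite -[X in (X < _)%E]/(mu `[- r, r]%classic) lebesgue_measure_itv/=; case: ifPn => _; rewrite -?EFinB ltry.
  by apply/seteqP; split => x; rewrite /symI/= in_itv.
- apply: le_lt_trans (ahausdorff_Lp q1 mf KV) _.
  by rewrite lte_mul_pinfty ?poweR_ge0 ?fin_num_poweR ?ge0_fin_numE//; apply: integral_ge0 => u _; rewrite lee_fin mulr_ge0 ?powR_ge0.
Qed.

(* The cutoff chi is the indicator of [-r, r] when p > 1 and the constant 1 when p = 1. *)
Lemma fourier_hausdorff (chi : R -> R) f (t : R) :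
  measurable_fun setT chi -> (forall x, 0 <= chi x) -> cmfun f ->
  {ae mu, forall x, (ahausdorff f x < +oo)%E} ->
  (\int[mu]_x ((chi x)%:E * ahausdorff f x) < +oo)%E ->
  cintegral setT (fun x => (chi x)%:C * (expi (- (x * t)) * hausdorff f x)) =
  cintegral setT (fun u => (V u / th u)%:C *
    cintegral setT (fun y => (chi (y / th u))%:C * (expi (- (y * (t / th u))) * f y))).
Proof.
move=> mchi chi0 mf aef fin.
pose F (z : R * R) : R[i] := (chi z.1)%:C * expi (- (z.1 * t)) * ((V z.2)%:C * f (z.1 * th z.2)).
have mexp : cmfun (fun x : R => expi (- (x * t))).
  by apply: cmfun_expi; apply: measurableT_comp => //; exact: measurable_funM.
have mF : cmfun F.
  apply: cmfunM; apply: cmfunM.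
  - by apply: cmfun_real; exact: measurableT_comp.
  - by apply: (cmfun_comp _ mexp).
  - by apply: cmfun_real; exact: measurableT_comp.
  - by apply: (cmfun_comp _ mf); exact: measurable_mul_th.
have mVf x : cmfun (fun u => (V u)%:C * f (x * th u)).
  apply: cmfunM; first exact: cmfun_real.
  by apply: (cmfun_comp _ mf); exact: measurable_funM.
have nF x u : cnorm (F (x, u)) = chi x * (V u * cnorm (f (x * th u))).
  by rewrite /F/= !cnormM !cnormR cnorm_expi !ger0_norm// mulr1.
transitivity (cintegral setT (fun x => cintegral setT (fun u => F (x, u)))).
  apply: cint_ae.
  - apply: cmfunM; first exact: cmfun_real.
    by apply: cmfunM => //; exact: cmfun_hausdorff.
  - exact: cmfun_cint.
  (* The complex phase enters the inner integral only where the average of |f| is finite. *)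
  - apply: (ae_imp aef) => x xfin; rewrite /F/= cintZ// ?mulrA//.
    rewrite /cL1; apply: le_lt_trans xfin.
    rewrite /ahausdorff le_eqVlt; apply/orP; left; apply/eqP.
    by apply: eq_integral => u _; rewrite cnormM cnormR ger0_norm.
rewrite cint_fubini//; last first.
  apply: le_lt_trans fin; rewrite le_eqVlt; apply/orP; left; apply/eqP.
  apply: eq_integral => x _; under eq_integral do rewrite nF EFinM.
  rewrite ge0_integralZl//= ?lee_fin//.
  - apply/measurable_EFinP; apply: measurable_funM => //.
    by apply: (measurableT_comp (measurable_cnorm mf)); exact: measurable_funM.
  - by move=> u _; rewrite lee_fin mulr_ge0 ?cnorm_ge0.
congr cintegral; apply/funext => u.
pose G (y : R) : R[i] := (chi (y / th u))%:C * (expi (- (y * (t / th u))) * f y).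
have mG : cmfun G.
  apply: cmfunM; first by apply: cmfun_real; apply: (measurableT_comp mchi); exact: measurable_funM.
  apply: cmfunM => //; apply: cmfun_expi; apply: measurableT_comp => //; exact: measurable_funM.
(* Substitution y = x th(u): the phase x t becomes y t / th(u), and the Jacobian 1/th(u) joins the
   weight. *)
transitivity (cintegral setT (fun x => (V u)%:C * G (x * th u))).
  congr cintegral; apply/funext => x; rewrite /F /G/= mulfK ?gt_eqF//.
  rewrite (_ : x * th u * (t / th u) = x * t); first by ring.
  by field; rewrite gt_eqF.
rewrite cintZr; last by apply: (cmfun_comp _ mG); exact: measurable_funM.
by rewrite cint_dilate ?gt_eqF// gtr0_norm// mulrA -rmorphM.
Qed.

End hausdorff.

End hausdorff_operator.

(** * Truncated transforms of an average, and their difference from the candidate limit *)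

Section truncated_fourier.
Variable R : realType.
Local Notation mu := (@lebesgue_measure R).
Implicit Types (f g : R -> R[i]) (z w : R[i]).

Lemma measurable_cnorm_powR d (T : measurableType d) (q : R) (F : T -> R[i]) : cmfun F ->
  measurable_fun setT (fun x => (cnorm (F x) `^ q)%:E).
Proof.
move=> mF; apply/measurable_EFinP; apply: (measurableT_comp (measurable_powR _)).
exact: measurable_cnorm.
Qed.

Lemma Lnorm_Lpow q f : Lnorm mu q%:E (fun x => (cnorm (f x))%:E) = (Lpow q f `^ q^-1)%E.
Proof.
have E : (\int[mu]_x (`|(cnorm (f x))%:E| `^ q) = Lpow q f)%E.
  by apply: eq_integral => x _; rewrite /= ger0_norm ?cnorm_ge0.
by rewrite unlock; rewrite E.
Qed.

Lemma in_LpE p f : 0 < p -> in_Lp p f <-> cmfun f /\ (Lpow p f < +oo)%E.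
Proof.
move=> p0; rewrite /in_Lp Lnorm_Lpow; split => -[mf Lf]; split => //.
- by apply: lty_poweRy Lf; rewrite invr_eq0 gt_eqF.
- exact: poweR_lty.
Qed.

Lemma Lpow_cvg0 (q : R) (F : R -> R -> R[i]) : 0 < q ->
  ((fun r => Lnorm mu q%:E (fun t => (cnorm (F r t))%:E)) @ +oo --> 0%E) <->
  (forall e, 0 < e -> exists2 r0, 0 < r0 & forall r, r0 <= r -> (Lpow q (F r) <= e%:E)%E).
Proof.
move=> q0; under eq_fun do rewrite Lnorm_Lpow; split.
- move=> H e e0.
  have e'0 : (0 < (e `^ q^-1)%:E :> \bar R)%E by rewrite lte_fin powR_gt0.
  have : nbhs (0 : \bar R)%E [set y | (y < (e `^ q^-1)%:E)%E].
    by apply: open_nbhs_nbhs; split => //; exact: open_ereal_lt_ereal.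
  (* A neighbourhood of +oo only provides r > M, with M of any sign; the threshold must be positive
     and is used with r0 <= r. *)
  move=> /H [M [_ HM]]; exists (Num.max 1 (M + 1)); first by rewrite lt_max ltr01.
  move=> r; rewrite ge_max => /andP[r1 rM].
  have /HM /= : M < r by apply: lt_le_trans rM; rewrite ltrDl.
  move=> /ltW/(@le_poweR R _ _ q (ltW q0) (poweR_ge0 _ _)).
  rewrite -poweRrM mulVf ?gt_eqF// poweRe1 ?Lpow_ge0//.
  by rewrite poweR_EFin -powRrM mulVf ?gt_eqF// powRr1// ltW.
- move=> H A nA.
  have [d /= d0 dA] : nbhs (0 : R) (fun y : R => A y%:E) by exact: nA.
  have e0 : 0 < (d / 2) `^ q by rewrite powR_gt0 ?divr_gt0.
  have [r0 r00 Hr] := H _ e0.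
  exists r0; split; first exact: num_real.
  move=> r /ltW /Hr /(@le_poweR R _ _ q^-1 _ (Lpow_ge0 _ _)).
  rewrite invr_ge0 => /(_ (ltW q0)).
  rewrite poweR_EFin -powRrM divff ?gt_eqF// powRr1; last by rewrite divr_ge0// ltW.
  move=> L.
  have := poweR_ge0 (Lpow q (F r)) q^-1.
  move: L => /=; case: (Lpow q (F r) `^ q^-1)%E => [y||]//.
  rewrite !lee_fin => L y0; apply: dA; rewrite /ball/= sub0r normrN ger0_norm//.
  by apply: le_lt_trans L _; rewrite ltr_pdivrMr// mulr2n mulrDr mulr1 ltrDl.
Qed.

Lemma fourier_trunc1E f (r t : R) : fourier_trunc f r t =
  cintegral setT (fun x => (\1_(symI r) x)%:C * (expi (- (x * t)) * f x)).
Proof. exact: cint_mkcond. Qed.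

Section hausdorff_diff.
Variables (V th : R -> R).
Hypotheses (mV : measurable_fun setT V) (mth : measurable_fun setT th).
Hypotheses (V0 : forall u, 0 <= V u) (th0 : forall u, 0 < th u).
Local Notation Vd := (fun u => V u / th u).
Local Notation thd := (fun u => (th u)^-1).

Lemma measurable_Vd : measurable_fun setT Vd.
Proof. by apply: measurable_funM => //; exact: (measurableT_comp (@measurable_invr R)). Qed.

Lemma measurable_thd : measurable_fun setT thd.
Proof. exact: (measurableT_comp (@measurable_invr R)). Qed.

Lemma cmfun_trunc_dilate (r : R) f : cmfun f ->
  cmfun (fun z : R * R => fourier_trunc f (r * th z.1) (z.2 / th z.1)).
Proof.
move=> mf; under eq_fun do rewrite fourier_truncE//.
apply: (@cmfun_cint R _ _ (fun w : (R * R) * R => (\1_(symI r) (w.2 / th w.1.1))%:C *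
   (expi (- (w.2 * (w.1.2 / th w.1.1))) * f w.2))).
have m1 : measurable_fun setT (fun w : (R * R) * R => (th w.1.1)^-1).
  by apply: (measurableT_comp measurable_thd); exact: measurableT_comp.
apply: cmfunM.
  have mI : measurable_fun setT (\1_(symI r) : R -> R).
    by apply: measurable_indic; exact: measurable_symI.
  by apply: cmfun_real; apply: (measurableT_comp mI); exact: measurable_funM.
apply: cmfunM; last by apply: (cmfun_comp _ mf).
apply: cmfun_expi; apply: measurableT_comp => //; apply: measurable_funM => //.
by apply: measurable_funM => //; exact: measurableT_comp.
Qed.

(** Substitution y = x th(u) followed by Tonelli. The left side is the absolute integral needed to
    exchange u and y; the right side is finite by [ahausdorff_loc]. *)
Lemma integral_dilate_hausdorff (r : R) f : cmfun f ->
  (\int[mu]_u \int[mu]_y (V u / th u * (\1_(symI r) (y / th u) * cnorm (f y)))%:E =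
   \int[mu]_x ((\1_(symI r) x)%:E * ahausdorff V th f x))%E.
Proof.
move=> mf.
have mI : measurable_fun setT (\1_(symI r) : R -> R).
  by apply: measurable_indic; exact: measurable_symI.
pose G (z : R * R) : R := V z.1 * (\1_(symI r) z.2 * cnorm (f (z.2 * th z.1))).
have G0 (z : R * R) : 0 <= G z by rewrite !mulr_ge0 ?cnorm_ge0.
have mG : measurable_fun setT (EFin \o G).
  apply/measurable_EFinP; apply: measurable_funM; first exact: measurableT_comp.
  apply: measurable_funM; first by apply: (measurableT_comp mI).
  apply: (measurableT_comp (measurable_cnorm mf)); apply: measurable_funM => //; exact: measurableT_comp.
transitivity (\int[mu]_u \int[mu]_x (G (u, x))%:E)%E.
  apply: eq_integral => u _.
  pose h (y : R) : R := \1_(symI r) (y / th u) * cnorm (f y).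
  have mh : measurable_fun setT h.
    apply: measurable_funM; last exact: measurable_cnorm.
    by apply: (measurableT_comp mI); exact: measurable_funM.
  have h0 y : 0 <= h y by rewrite mulr_ge0 ?cnorm_ge0.
  under [LHS]eq_integral do rewrite EFinM.
  under [RHS]eq_integral do rewrite EFinM/=.
  rewrite ge0_integralZl//=; last 3 first.
  - exact/measurable_EFinP.
  - by move=> y _; rewrite lee_fin; exact: h0.
  - by rewrite lee_fin divr_ge0// ltW.
  rewrite ge0_integralZl//=; last 3 first.
  - apply/measurable_EFinP; apply: measurable_funM => //.
    by apply: (measurableT_comp (measurable_cnorm mf)); exact: measurable_funM.
  - by move=> y _; rewrite lee_fin mulr_ge0 ?cnorm_ge0.
  - by rewrite lee_fin.
  rewrite EFinM -muleA; congr (_ * _)%E.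
  transitivity (\int[mu]_x (h (x * th u))%:E)%E.
    rewrite (@ge0_integral_dilate R (th u) (EFin \o h)) ?gt_eqF// ?gtr0_norm//.
    exact/measurable_EFinP.
  by apply: eq_integral => x _; rewrite /h mulfK ?gt_eqF.
rewrite (@lebesgue_tonelli R (EFin \o G))//=.
apply: eq_integral => x _; rewrite /ahausdorff -ge0_integralZl//=; last 2 first.
- apply/measurable_EFinP; apply: measurable_funM => //.
  by apply: (measurableT_comp (measurable_cnorm mf)); exact: measurable_funM.
- by move=> u _; rewrite lee_fin mulr_ge0 ?cnorm_ge0.
by apply: eq_integral => u _; rewrite -EFinM /G/= mulrCA.
Qed.

Lemma trunc_dilate_L1 (r t : R) f : cmfun f ->
  (\int[mu]_x ((\1_(symI r) x)%:E * ahausdorff V th f x) < +oo)%E ->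
  cL1 (fun u => (V u / th u)%:C * fourier_trunc f (r * th u) (t / th u)).
Proof.
move=> mf; rewrite -integral_dilate_hausdorff// => fin; rewrite /cL1.
have mI : measurable_fun setT (\1_(symI r) : R -> R).
  by apply: measurable_indic; exact: measurable_symI.
have Vd0 u : 0 <= V u / th u by rewrite divr_ge0// ltW.
pose H (z : R * R) : R := V z.1 / th z.1 * (\1_(symI r) (z.2 / th z.1) * cnorm (f z.2)).
have H0 (z : R * R) : (0 <= (H z)%:E)%E.
  by rewrite lee_fin; apply: mulr_ge0; [exact: Vd0|rewrite mulr_ge0 ?cnorm_ge0].
have mH : measurable_fun setT (EFin \o H).
  apply/measurable_EFinP; apply: measurable_funM; first exact: (measurableT_comp measurable_Vd).
  apply: measurable_funM; last exact: (measurableT_comp (measurable_cnorm mf)).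
  by apply: (measurableT_comp mI); exact: measurable_div_fst.
have mHi := measurable_ge0_integral_param mH H0.
have mT : cmfun (fun u => fourier_trunc f (r * th u) (t / th u)).
  apply: (@cmfun_comp R _ _ _ _ (fun u : R => (u, t)) _ _ (cmfun_trunc_dilate r mf)).
  exact: measurable_pair2.
apply: (@le_lt_trans _ _ (\int[mu]_u (2%:E * \int[mu]_y (H (u, y))%:E))%E).
  apply: ge0_le_lintegral.
  - by apply: measurable_cnormE; apply: cmfunM => //; apply: cmfun_real; exact: measurable_Vd.
  - exact: measurable_funeM.
  - by move=> u; rewrite lee_fin cnorm_ge0.
  - move=> u; rewrite cnormM cnormR ger0_norm// EFinM (fourier_truncE _ _ _ (th0 u)).
    have -> : (\int[mu]_y (H (u, y))%:E = (V u / th u)%:E * \int[mu]_y (\1_(symI r) (y / th u) * cnorm (f y))%:E)%E.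
      under [LHS]eq_integral do rewrite /H/= EFinM.
      rewrite ge0_integralZl//=; last 3 first.
      + apply/measurable_EFinP; apply: measurable_funM; last exact: measurable_cnorm.
        by apply: (measurableT_comp mI); exact: measurable_funM.
      + by move=> y _; rewrite lee_fin mulr_ge0 ?cnorm_ge0.
      + by rewrite lee_fin.
    rewrite muleCA lee_wpmul2l ?lee_fin//.
    apply: le_trans (le_cnorm_cint _) _.
      apply: cmfunM; first by apply: cmfun_real; apply: (measurableT_comp mI); exact: measurable_funM.
      apply: cmfunM => //; apply: cmfun_expi; apply: measurableT_comp => //; exact: measurable_funM.
    rewrite le_eqVlt; apply/orP; left; apply/eqP; congr (_ * _)%E.
    by apply: eq_integral => y _; rewrite !cnormM cnormR cnorm_expi mul1r ger0_norm.
rewrite ge0_integralZl//=; last by move=> u _; apply: integral_ge0 => y _; exact: (H0 (u, y)).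
by rewrite lte_mul_pinfty.
Qed.

Lemma cmfun_diff_dilate (r : R) f g : cmfun f -> cmfun g ->
  cmfun (fun z : R * R => fourier_trunc f (r * th z.1) (z.2 / th z.1) - g (z.2 / th z.1)).
Proof.
move=> mf mg; apply: cmfunB; first exact: cmfun_trunc_dilate.
by apply: (cmfun_comp _ mg); exact: measurable_div_fst.
Qed.

(** Both averages must converge absolutely before they merge into one: the first by local
    integrability of the average of |f|, the second by the assumption at this particular t. *)
Lemma trunc_hausdorff_sub (r t : R) f g : cmfun f -> cmfun g ->
  {ae mu, forall x, (ahausdorff V th f x < +oo)%E} ->
  (\int[mu]_x ((\1_(symI r) x)%:E * ahausdorff V th f x) < +oo)%E ->
  (ahausdorff Vd thd g t < +oo)%E ->
  fourier_trunc (hausdorff V th f) r t - hausdorff Vd thd g t =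
  cintegral setT (fun u => (V u / th u)%:C *
     (fourier_trunc f (r * th u) (t / th u) - g (t / th u))).
Proof.
move=> mf mg aef fin gt.
have mI : measurable_fun setT (\1_(symI r) : R -> R).
  by apply: measurable_indic; exact: measurable_symI.
have Vd0 u : 0 <= V u / th u by rewrite divr_ge0// ltW.
have I0 (x : R) : 0 <= \1_(symI r) x :> R by [].
have E1 : fourier_trunc (hausdorff V th f) r t =
    cintegral setT (fun u => (V u / th u)%:C * fourier_trunc f (r * th u) (t / th u)).
  rewrite fourier_trunc1E (fourier_hausdorff mV mth V0 th0 t mI I0 mf aef fin).
  congr (cintegral setT _); apply/funext => u.
  by rewrite (fourier_truncE _ _ _ (th0 u)).
rewrite E1 /hausdorff -cintB.
- by congr (cintegral setT _); apply/funext => u; rewrite mulrBr.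
- apply: cmfunM; first by apply: cmfun_real; exact: measurable_Vd.
  apply: (@cmfun_comp R _ _ _ _ (fun u : R => (u, t)) _ _ (cmfun_trunc_dilate r mf)).
  exact: measurable_pair2.
- apply: cmfunM; first by apply: cmfun_real; exact: measurable_Vd.
  apply: (cmfun_comp _ mg).
  exact: (measurable_funM (measurable_cst t) measurable_thd).
- exact: trunc_dilate_L1.
- apply: le_lt_trans gt; rewrite le_eqVlt; apply/orP; left; apply/eqP.
  by apply: eq_integral => u _; rewrite cnormM cnormR ger0_norm.
Qed.

Lemma hausdorff_in_Lp (p : R) f : 1 <= p -> cmfun f -> (Lpow p f < +oo)%E ->
  (\int[mu]_u (V u * th u `^ (- p^-1))%:E < +oo)%E ->
  (Lpow p (hausdorff V th f) < +oo)%E.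
Proof.
move=> p1 mf Lf KV; have p0 : 0 < p by exact: lt_le_trans p1.
have mA := measurable_ahausdorff mV mth V0 mf.
have mAq : measurable_fun setT (fun x => ahausdorff V th f x `^ p)%E.
  by apply: (measurableT_comp (measurable_poweR p)).
apply: (@le_lt_trans _ _ (\int[mu]_x ((2 `^ p)%:E * (ahausdorff V th f x `^ p)))%E).
  apply: ge0_le_lintegral.
  - by apply: measurable_cnorm_powR; exact: cmfun_hausdorff.
  - exact: measurable_funeM.
  - by move=> x; rewrite lee_fin powR_ge0.
  - move=> x; rewrite -poweR_EFin -[X in (X * _)%E]poweR_EFin -poweRM ?ahausdorff_ge0//.
    apply: le_poweR; rewrite ?(ltW p0) ?lee_fin ?cnorm_ge0//.
    exact: le_hausdorff.
rewrite ge0_integralZl//=; last by move=> x _; exact: poweR_ge0.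
rewrite lte_mul_pinfty ?lee_fin ?powR_ge0//.
apply: le_lt_trans (ahausdorff_Lp mV mth V0 th0 p1 mf KV) _.
by rewrite lte_mul_pinfty ?poweR_ge0 ?fin_num_poweR ?ge0_fin_numE//; apply: integral_ge0 => u _; rewrite lee_fin mulr_ge0 ?powR_ge0.
Qed.

End hausdorff_diff.

End truncated_fourier.

(** * Passage to the limit in the dual norm *)

Section fourier_hausdorff_limit.
Variable R : realType.
Local Notation mu := (@lebesgue_measure R).
Implicit Types (f g : R -> R[i]) (z w : R[i]).

Lemma Lpow_ae q f g : cmfun f -> cmfun g -> {ae mu, forall x, f x = g x} ->
  Lpow q f = Lpow q g.
Proof.
move=> mf mg fg; apply: ge0_ae_eq_integral => //.
- exact: measurable_cnorm_powR.
- exact: measurable_cnorm_powR.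
- by move=> x _; rewrite lee_fin powR_ge0.
- by move=> x _; rewrite lee_fin powR_ge0.
- apply: (@ae_imp R (fun x => f x = g x) (fun x => setT x -> (cnorm (f x) `^ q)%:E = (cnorm (g x) `^ q)%:E)) => //.
  by move=> x ->.
Qed.

(** Complex form of [schur_integral]; 2^q is the q-th power of the constant of [le_cnorm_cint]. *)
Lemma Lpow_cint_le (q : R) (W c : R -> R) (G : R * R -> R[i]) (M : \bar R) :
  1 <= q -> measurable_fun setT W -> measurable_fun setT c -> cmfun G ->
  (forall u, 0 <= W u) -> (forall u, 0 < c u) -> (0 <= M)%E ->
  (forall u, W u != 0%R -> Lpow q (fun t => G (u, t)) <= M * (c u `^ q)%:E)%E ->
  (\int[mu]_u (W u * c u)%:E < +oo)%E ->
  (Lpow q (fun t => cintegral setT (fun u => (W u)%:C * G (u, t))%R) <=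
   (2 `^ q)%:E * ((\int[mu]_u (W u * c u)%:E) `^ q * M))%E.
Proof.
move=> q1 mW mc mG W0 c0 M0 GM KW; have q0 : 0 < q by exact: lt_le_trans q1.
have mcG := measurable_cnorm mG.
have mS : measurable_fun setT (fun z : R * R => (W z.1 * cnorm (G z))%:E).
  apply/measurable_EFinP; apply: measurable_funM => //; exact: measurableT_comp.
have S0 (z : R * R) : (0 <= (W z.1 * cnorm (G z))%:E)%E by rewrite lee_fin mulr_ge0 ?cnorm_ge0.
have mI := measurable_ge0_integral_paramr mS S0.
have mIq : measurable_fun setT (fun t : R => (\int[mu]_u (W u * cnorm (G (u, t)))%:E) `^ q)%E.
  exact: (measurableT_comp (measurable_poweR q) mI).
apply: (@le_trans _ _ ((2 `^ q)%:E * \int[mu]_t ((\int[mu]_u (W u * cnorm (G (u, t)))%:E) `^ q))%E).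
  rewrite -ge0_integralZl//=; last by move=> x _; exact: poweR_ge0.
  apply: ge0_le_lintegral.
  - apply: measurable_cnorm_powR.
    apply: (@cmfun_cint R _ _ (fun w : R * R => (W w.2)%:C * G (w.2, w.1))).
    apply: cmfunM; first by apply: cmfun_real; exact: measurableT_comp.
    by apply: (cmfun_comp _ mG); exact: measurable_swap.
  - exact: measurable_funeM.
  - by move=> x; rewrite lee_fin powR_ge0.
  - move=> t; rewrite -poweR_EFin -[X in (X * _)%E]poweR_EFin -poweRM//; last first.
      by apply: integral_ge0 => u _; exact: (S0 (u, t)).
    apply: le_poweR; rewrite ?(ltW q0) ?lee_fin ?cnorm_ge0//.
    apply: le_trans (le_cnorm_cint _) _.
      apply: cmfunM; first exact: cmfun_real.
      by apply: (cmfun_comp _ mG); exact: measurable_pair2.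
    rewrite le_eqVlt; apply/orP; left; apply/eqP; congr (_ * _)%E.
    by apply: eq_integral => u _; rewrite cnormM cnormR ger0_norm.
rewrite lee_wpmul2l ?lee_fin ?powR_ge0//.
apply: (@schur_integral R q W c (fun z : R * R => cnorm (G z))) => //.
by move=> z; exact: cnorm_ge0.
Qed.

Lemma Lpow_dilate (q a : R) f : 0 < a -> cmfun f ->
  Lpow q (fun t => f (t / a)) = (a%:E * Lpow q f)%E.
Proof.
move=> a0 mf; rewrite /Lpow.
rewrite (@ge0_integral_dilate R a^-1 (fun x => (cnorm (f x) `^ q)%:E)).
- by rewrite gtr0_norm ?invr_gt0// invrK.
- by rewrite invr_neq0// gt_eqF.
- exact: measurable_cnorm_powR.
- by move=> x; rewrite lee_fin powR_ge0.
Qed.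

Lemma cmfun_trunc (r : R) f : cmfun f -> cmfun (fourier_trunc f r).
Proof.
move=> mf; rewrite (_ : fourier_trunc f r = fun t => cintegral setT (fun x => (\1_(symI r) x)%:C * (expi (- (x * t)) * f x))); last first.
  by apply/funext => t; exact: fourier_trunc1E.
apply: (@cmfun_cint R _ _ (fun w : R * R => (\1_(symI r) w.2)%:C * (expi (- (w.2 * w.1)) * f w.2))).
have mI : measurable_fun setT (\1_(symI r) : R -> R).
  by apply: measurable_indic; exact: measurable_symI.
apply: cmfunM; first by apply: cmfun_real; exact: (measurableT_comp mI).
apply: cmfunM; last by apply: (cmfun_comp _ mf).
by apply: cmfun_expi; apply: measurableT_comp => //; exact: measurable_funM.
Qed.

Lemma conj_exp_gt1 (p : R) : 1 < p -> 1 < conj_exp p.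
Proof. by move=> p1; rewrite /conj_exp ltr_pdivlMr ?subr_gt0// mul1r ltrBlDr ltrDl. Qed.

Section hausdorff_fourier.
Variables (V th : R -> R).
Hypotheses (mV : measurable_fun setT V) (mth : measurable_fun setT th).
Hypotheses (V0 : forall u, 0 <= V u) (th0 : forall u, 0 < th u).
Local Notation Vd := (fun u => V u / th u).
Local Notation thd := (fun u => (th u)^-1).

Let mVd : measurable_fun setT Vd. Proof. exact: measurable_Vd. Qed.
Let mthd : measurable_fun setT thd. Proof. exact: measurable_thd. Qed.
Let Vd0 u : 0 <= V u / th u. Proof. by rewrite divr_ge0// ltW. Qed.
Let thd0 u : 0 < (th u)^-1. Proof. by rewrite invr_gt0. Qed.

Definition diff_dilate f g (r t u : R) : R[i] :=
  fourier_trunc f (r * th u) (t / th u) - g (t / th u).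

(** The two kernel integrals place both averages in their spaces. The last assumption is the
    convergence itself, since the difference of transforms is the average of [diff_dilate] at almost
    every t, which the norm does not see. *)
Lemma is_fourier_hausdorff (p : R) f g : 1 < p -> is_fourier p f g ->
  (\int[mu]_u (V u * th u `^ (- p^-1))%:E < +oo)%E ->
  (\int[mu]_u (V u / th u * (th u)^-1 `^ (- (conj_exp p)^-1))%:E < +oo)%E ->
  (forall e, 0 < e -> exists2 r0, 0 < r0 & forall r, r0 <= r ->
    (Lpow (conj_exp p) (fun t => cintegral setT (fun u => (V u / th u)%:C * diff_dilate f g r t u)%R)
       <= e%:E)%E) ->
  is_fourier p (hausdorff V th f) (hausdorff Vd thd g).
Proof.
move=> p1 [Lpf]; rewrite gt_eqF// => -[Lqg _] KV Kd Hc.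
have p0 : 0 < p by exact: lt_trans p1.
have q1 := conj_exp_gt1 p1; set q := conj_exp p in q1 Kd Hc Lqg *.
have q0 : 0 < q by exact: lt_trans q1.
move/(in_LpE _ p0): Lpf => [mf Lf]; move/(in_LpE _ q0): Lqg => [mg Lg].
have LpH : in_Lp p (hausdorff V th f).
  by apply/(in_LpE _ p0); exact: (conj (cmfun_hausdorff mV mth mf) (hausdorff_in_Lp mV mth V0 th0 (ltW p1) mf Lf KV)).
have LqH : in_Lp q (hausdorff Vd thd g).
  by apply/(in_LpE _ q0); exact: (conj (cmfun_hausdorff mVd mthd mg) (hausdorff_in_Lp mVd mthd Vd0 thd0 (ltW q1) mg Lg Kd)).
apply: (conj LpH); rewrite gt_eqF//; apply: (conj LqH).
apply/(Lpow_cvg0 _ q0) => e e0; have [r0 r00 Hr] := Hc _ e0.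
exists r0; [exact: r00|move=> r rr].
rewrite (@Lpow_ae q _ (fun t => cintegral setT (fun u => (V u / th u)%:C * diff_dilate f g r t u))); first exact: Hr.
- by apply: cmfunB; [apply: cmfun_trunc; exact: cmfun_hausdorff|exact: cmfun_hausdorff].
- apply: (@cmfun_cint R _ _ (fun w : R * R => (V w.2 / th w.2)%:C * diff_dilate f g r w.1 w.2)).
  apply: cmfunM; first by apply: cmfun_real; exact: (measurableT_comp mVd).
  by apply: (cmfun_comp (@measurable_swap _ _ _ _) (cmfun_diff_dilate mth th0 r mf mg)).
- apply: (ae_imp (ae_ahausdorff_fin mVd mthd Vd0 thd0 (ltW q1) mg Kd Lg)) => t gt.
  apply: trunc_hausdorff_sub => //.
  + exact: (ae_ahausdorff_fin mV mth V0 th0 (ltW p1) mf KV Lf).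
  + exact: (@ahausdorff_loc R V th mV mth V0 th0 p r f (ltW p1) mf KV Lf).
Qed.

(** On the support of V one has r th(u) >= r, so a single threshold controls every dilated
    difference. *)
Lemma diff_dilate_cvg0_ge1 (q : R) f g : 1 < q -> cmfun f -> cmfun g ->
  (forall u, V u != 0 -> 1 <= th u) ->
  (\int[mu]_u (V u / th u * (th u)^-1 `^ (- q^-1))%:E < +oo)%E ->
  (forall e, 0 < e -> exists2 r0, 0 < r0 & forall r, r0 <= r ->
    (Lpow q (fun t => fourier_trunc f r t - g t)%R <= e%:E)%E) ->
  (forall e, 0 < e -> exists2 r0, 0 < r0 & forall r, r0 <= r ->
    (Lpow q (fun t => cintegral setT (fun u => (V u / th u)%:C * diff_dilate f g r t u)%R)
       <= e%:E)%E).
Proof.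
move=> q1 mf mg th1 Kd Hc e e0; have q0 : 0 < q by exact: lt_trans q1.
set K := (\int[mu]_u (V u / th u * (th u)^-1 `^ (- q^-1))%:E)%E in Kd.
have K0 : (0 <= K)%E by apply: integral_ge0 => u _; rewrite lee_fin mulr_ge0 ?powR_ge0.
(* The added 1 keeps the divisor positive when the kernel integral is 0. *)
pose k := 2 `^ q * fine K `^ q + 1.
have k0 : 0 < k by rewrite ltr_wpDl// mulr_ge0 ?powR_ge0.
have [r0 r00 Hr] := Hc (e / k) (divr_gt0 e0 k0).
exists r0 => // r rr.
apply: (@le_trans _ _ ((2 `^ q)%:E * (K `^ q * (e / k)%:E))%E).
  apply: (@Lpow_cint_le q Vd (fun u => (th u)^-1 `^ (- q^-1)) (fun w : R * R => diff_dilate f g r w.2 w.1)) => //.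
  - exact: ltW.
  - exact: (measurableT_comp (measurable_powR _) mthd).
  - exact: cmfun_diff_dilate.
  - by move=> u; exact: powR_gt0.
  - by rewrite lee_fin divr_ge0// ltW.
  - move=> u Vu; have Vu0 : V u != 0 by apply: contra_neq Vu => ->; rewrite mul0r.
    have D := @Lpow_dilate q (th u) (fun t => fourier_trunc f (r * th u) t - g t) (th0 u) (cmfunB (cmfun_trunc _ mf) mg).
    rewrite [X in (X <= _)%E]D -powRrM mulNr mulVf ?gt_eqF// powR_inv1 ?invr_ge0 ?(ltW (th0 u))// invrK muleC.
    rewrite lee_wpmul2r ?lee_fin ?(ltW (th0 u))// Hr//.
    rewrite (le_trans rr)// ler_peMr ?th1//; exact: le_trans (ltW r00) rr.
rewrite -(@fineK _ K) ?ge0_fin_numE// poweR_EFin -!EFinM lee_fin mulrA.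
rewrite mulrCA ger_pMr// ler_pdivrMr// mul1r /k lerDl//.
Qed.

End hausdorff_fourier.

Lemma is_fourier_ae (p : R) f f' g : 1 < p -> cmfun f' ->
  {ae mu, forall x, f x = f' x} -> is_fourier p f g -> is_fourier p f' g.
Proof.
move=> p1 mf' ff' [Lpf]; rewrite gt_eqF// => -[Lqg Hc].
have p0 : 0 < p by exact: lt_trans p1.
move/(in_LpE _ p0): Lpf => [mf Lf].
have Lf' : (Lpow p f' < +oo)%E by rewrite -(Lpow_ae p mf mf' ff').
have Lpf' : in_Lp p f' by apply/(in_LpE _ p0); exact: (conj mf' Lf').
apply: (conj Lpf'); rewrite gt_eqF//; apply: (conj Lqg).
suff E r t : fourier_trunc f' r t = fourier_trunc f r t.
  by move: Hc; under eq_fun do under eq_fun do rewrite -E.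
rewrite !fourier_trunc1E; apply: cint_ae; last by apply: (ae_imp ff') => x ->.
all: apply: cmfunM; first by apply: cmfun_real; apply: measurable_indic; exact: measurable_symI.
all: apply: cmfunM => //; apply: cmfun_expi; apply: measurableT_comp => //; exact: measurable_funM.
Qed.

Lemma ae_neq (a : R) : {ae mu, forall x, x != a}.
Proof.
exists [set a]; split => //; first exact: lebesgue_measure_set1.
by move=> x /=; move/negP; rewrite negbK => /eqP.
Qed.

Lemma Rintegral_kmul_inv (h : R -> R) : measurable_fun setT h ->
  Rintegral mu setT (fun x => kmul x * h x^-1) = Rintegral mu setT (fun x => kmul x * h x).
Proof.
move=> mh.
have mE : measurable_fun setT (EFin \o h) by apply/measurable_EFinP.
have P (k : R -> R) : (\int[mu]_x (EFin \o (fun x => kmul x * k x)%R)^\+ x = \int[mu]_x ((kmul x)%:E * (EFin \o k)^\+ x))%E.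
  apply: eq_integral => x _; rewrite !funeposE/= -!EFin_max -EFinM; congr EFin.
  by rewrite maxr_pMr ?kmul_ge0// mulr0.
have N (k : R -> R) : (\int[mu]_x (EFin \o (fun x => kmul x * k x)%R)^\- x = \int[mu]_x ((kmul x)%:E * (EFin \o k)^\- x))%E.
  apply: eq_integral => x _; rewrite !funenegE/= -!EFin_max -EFinM; congr EFin.
  by rewrite maxr_pMr ?kmul_ge0// mulr0 mulrN.
rewrite -[LHS]/(fine (\int[mu]_x (EFin \o (fun x : R => kmul x * h x^-1)%R) x))%E.
rewrite -[RHS]/(fine (\int[mu]_x (EFin \o (fun x : R => kmul x * h x)%R) x))%E.
congr fine; rewrite integralE [RHS]integralE; congr (_ - _)%E.
- rewrite (P h) (P (fun x => h x^-1)) -(integral_kmul_inv (measurable_funepos mE))//.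
  by apply: eq_integral => x _; rewrite !funeposE.
- rewrite (N h) (N (fun x => h x^-1)) -(integral_kmul_inv (measurable_funeneg mE))//.
  by apply: eq_integral => x _; rewrite !funenegE.
Qed.

Lemma cint_kmul_inv f : cmfun f ->
  cintegral setT (fun x => (kmul x)%:C * f x^-1) = cintegral setT (fun x => (kmul x)%:C * f x).
Proof.
move=> [m1 m2]; rewrite /cintegral.
have E (c : R) z : c%:C * z = Complex (c * complex.Re z) (c * complex.Im z).
  by case: z => a b; congr Complex => /=; rewrite mul0r ?subr0 ?addr0.
congr Complex; under eq_Rintegral do rewrite E/=; under [RHS]eq_Rintegral do rewrite E/=.
- exact: (@Rintegral_kmul_inv (fun x => complex.Re (f x))).
- exact: (@Rintegral_kmul_inv (fun x => complex.Im (f x))).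
Qed.

End fourier_hausdorff_limit.

(** * Cesaro operators as averages of dilations *)

Section cesaro_operators.
Variable R : realType.
Local Notation mu := (@lebesgue_measure R).
Implicit Types (f g : R -> R[i]) (z w : R[i]).
Variable beta : R.
Hypothesis b0 : 0 < beta.

Definition cesW (u : R) : R := if 0 < u < 1 then beta * (1 - u) `^ (beta - 1) else 0.
(** The value 1 off ]0,1[, where the weight vanishes, keeps the dilation positive everywhere, as the
    general lemmas assume. *)
Definition cesth (u : R) : R := if 0 < u < 1 then u else 1.

Lemma cesW_ge0 u : 0 <= cesW u.
Proof. by rewrite /cesW; case: ifPn => // _; rewrite mulr_ge0 ?powR_ge0// ltW. Qed.

Lemma cesth_gt0 u : 0 < cesth u.
Proof. by rewrite /cesth; case: ifPn => // /andP[]. Qed.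

Lemma measurable_01 : measurable_fun setT (fun u : R => 0 < u < 1).
Proof. by apply: measurable_and; apply: measurable_fun_ltr. Qed.

Lemma measurable_cesW : measurable_fun setT cesW.
Proof.
apply: measurable_fun_ifT => //; first exact: measurable_01.
apply: measurable_funM => //; apply: (measurableT_comp (measurable_powR _)).
exact: measurable_funB.
Qed.

Lemma measurable_cesth : measurable_fun setT cesth.
Proof. by apply: measurable_fun_ifT => //; exact: measurable_01. Qed.

Lemma integral_cesW_powR (a : R) : 0 < a ->
  (\int[mu]_u (cesW u * cesth u `^ (a - 1))%:E < +oo)%E.
Proof.
move=> a0.
have -> : (\int[mu]_u (cesW u * cesth u `^ (a - 1))%:E = \int[mu]_u
   (beta%:E * (if (0 < u < 1)%R then u `^ (a - 1) * (1 - u) `^ (beta - 1) else 0)%:E))%E.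
  apply: eq_integral => u _; rewrite /cesW /cesth -EFinM; congr EFin.
  by case: ifPn => _; rewrite ?mul0r ?mulr0// -mulrA (mulrC (_ `^ (a - 1))).
rewrite ge0_integralZl//=.
- by rewrite lte_mul_pinfty ?lee_fin ?(ltW b0)//; exact: integral_beta_lty.
- apply/measurable_EFinP; apply: measurable_fun_ifT => //; first exact: measurable_01.
  apply: measurable_funM => //; apply: (measurableT_comp (measurable_powR _)).
  exact: measurable_funB.
- by move=> u _; rewrite lee_fin; case: ifPn => // _; rewrite mulr_ge0 ?powR_ge0.
- by rewrite lee_fin ltW.
Qed.

(** The beta integral with a = 1 - 1/s; a > 0 amounts to s > 1. *)
Lemma integral_ces (s : R) : 1 < s -> (\int[mu]_u (cesW u * cesth u `^ (- s^-1))%:E < +oo)%E.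
Proof.
move=> s1; have -> : - s^-1 = (1 - s^-1) - 1 by ring.
apply: integral_cesW_powR; rewrite subr_gt0 invf_lt1// (lt_trans _ s1)//.
Qed.

(** The beta integral with a = 1/s, which covers s = 1. *)
Lemma integral_cesdual (s : R) : 0 < s ->
  (\int[mu]_u (cesW u / cesth u * (cesth u)^-1 `^ (- s^-1))%:E < +oo)%E.
Proof.
move=> s0; have := @integral_cesW_powR s^-1; rewrite invr_gt0 => /(_ s0).
suff -> : (\int[mu]_u (cesW u / cesth u * (cesth u)^-1 `^ (- s^-1))%:E =
    \int[mu]_u (cesW u * cesth u `^ (s^-1 - 1))%:E)%E by [].
apply: eq_integral => u _; have u0 := cesth_gt0 u; rewrite -mulrA.
rewrite -(powR_inv1 (ltW u0)) -powRrM mulrNN mul1r -powRD; last by rewrite (gt_eqF u0) implybT.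
by rewrite addrC.
Qed.

(** The integrands can differ only at the endpoints 0 and 1, excluded from [cesW]. The identity
    holds at every t, 0 included. *)
Lemma CesE f t : cmfun f -> Ces beta f t = hausdorff cesW cesth f t.
Proof.
move=> mf; rewrite /Ces cint_mkcond -cintZr; last first.
  apply: cmfunM.
    apply: cmfun_real; apply: measurable_indic.
    rewrite (_ : [set r | _] = `[0, 1]%classic); first exact: measurable_itv.
    by apply/seteqP; split => x /=; rewrite in_itv.
  apply: cmfunM; last by apply: (cmfun_comp _ mf); exact: measurable_funM.
  apply: cmfun_real; apply: (measurableT_comp (measurable_powR _)); exact: measurable_funB.
apply: cint_ae.
- apply: cmfunM; first exact: cmfun_real.
  apply: cmfunM.
    apply: cmfun_real; apply: measurable_indic.
    rewrite (_ : [set r | _] = `[0, 1]%classic); first exact: measurable_itv.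
    by apply/seteqP; split => x /=; rewrite in_itv.
  apply: cmfunM; last by apply: (cmfun_comp _ mf); exact: measurable_funM.
  apply: cmfun_real; apply: (measurableT_comp (measurable_powR _)); exact: measurable_funB.
- apply: cmfunM; first by apply: cmfun_real; exact: measurable_cesW.
  by apply: (cmfun_comp _ mf); apply: measurable_funM => //; exact: measurable_cesth.
- apply: (ae_imp (ae_and (ae_neq (0 : R)) (ae_neq 1))) => u [u0 u1].
  rewrite /cesW /cesth indicE.
  have [h|h] := boolP (0 < u < 1).
    rewrite mem_set; last by move/andP: h => [h1 h2]; rewrite /= !ltW.
    by rewrite mul1r mulrA -rmorphM.
  rewrite memNset ?mul0r ?mulr0 //= => /andP[h1 h2]; move/negP: h; apply.
  by rewrite !lt_neqAle h1 h2 eq_sym u0 u1.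
Qed.

(** The substitution s = t x turns both half-lines into x >= 1, and x = 1/u brings the integral to
    ]0,1[. At t = 0 the operator is 0 by convention while the average is a multiple of f(0). *)
Lemma CesdualE f t : cmfun f -> t != 0 ->
  Cesdual beta f t = hausdorff (fun u => cesW u / cesth u) (fun u => (cesth u)^-1) f t.
Proof.
move=> mf t0.
pose D : set R := [set s | if 0 < t then t <= s else s <= t].
have mD : measurable D.
  rewrite (_ : D = if 0 < t then `[t, +oo[%classic else `]-oo, t]%classic).
    by case: ifPn => _; exact: measurable_itv.
  by rewrite /D; case: ifPn => _; apply/seteqP; split => x /=; rewrite in_itv/= ?andbT.
(* Absolute values let one kernel serve both signs of t. *)
pose k (s : R) : R := \1_D s * (`|s - t| `^ (beta - 1) / `|s| `^ beta).
have mk : measurable_fun setT k.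
  apply: measurable_funM; first exact: measurable_indic.
  apply: measurable_funM.
    apply: (measurableT_comp (measurable_powR _)); apply: measurableT_comp => //.
    exact: measurable_funB.
  apply: (measurableT_comp (@measurable_invr R)); apply: (measurableT_comp (measurable_powR _)).
  exact: normr_measurable.
have mkf : cmfun (fun s => (k s)%:C * f s) by apply: cmfunM => //; exact: cmfun_real.
have -> : Cesdual beta f t = beta%:C * cintegral setT (fun s => (k s)%:C * f s).
  rewrite /Cesdual; have [tn|tp|/eqP] := ltgtP t 0; last by rewrite (negbTE t0).
  - rewrite cint_mkcond; congr (_ * cintegral setT _); apply/funext => s.
    rewrite mulrA -rmorphM; congr (_%:C * _); rewrite /k /D (ltNge 0 t) (ltW tn)/= !indicE.
    have [h|h] := boolP (s <= t); last by rewrite !memNset ?mul0r//=; apply/negP.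
    by rewrite !mem_set// distrC [`|t - s|]ger0_norm// subr_ge0.
  - rewrite cint_mkcond; congr (_ * cintegral setT _); apply/funext => s.
    rewrite mulrA -rmorphM; congr (_%:C * _); rewrite /k /D tp !indicE.
    have [h|h] := boolP (t <= s); last by rewrite !memNset ?mul0r//=; apply/negP.
    rewrite !mem_set// [`|s - t|]ger0_norm ?subr_ge0// ger0_norm//.
    exact: le_trans (ltW tp) h.
(* With s = t x the kernel is 1/|t| times (x-1)^(beta-1) x^(-beta). One factor 1/x is left to
   [kmul], so that the inversion x = 1/u applies to the rest. *)
pose h (x : R) : R[i] := (if 1 <= x then (x - 1) `^ (beta - 1) * x `^ (1 - beta) else 0)%:C * f (t * x).
have mh : cmfun h.
  apply: cmfunM; last by apply: (cmfun_comp _ mf); exact: measurable_funM.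
  apply: cmfun_real; apply: measurable_fun_ifT => //; first exact: measurable_fun_ler.
  apply: measurable_funM => //; apply: (measurableT_comp (measurable_powR _)).
  exact: measurable_funB.
have mkE : cmfun (fun x => (@kmul R x)%:C) by apply: cmfun_real; exact: measurable_kmul.
have nt0 : 0 < `|t| by rewrite normr_gt0.
have E1 : cintegral setT (fun s => (k s)%:C * f s) = cintegral setT (fun x => (kmul x)%:C * h x).
  have := cint_dilate t0 mkf.
  have -> : cintegral setT (fun x => (k (x * t))%:C * f (x * t)) =
      cintegral setT (fun x => (`|t|^-1)%:C * ((kmul x)%:C * h x)).
    congr (cintegral setT _); apply/funext => x; rewrite /h (mulrC t x) !mulrA -!rmorphM.
    congr (_%:C * _); rewrite /k indicE.
    have -> : (x * t \in D) = (1 <= x).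
      apply/idP/idP; rewrite inE /D/=.
        case: ifPn => tp; first by rewrite -{1}(mul1r t) ler_pM2r.
        by rewrite -[leRHS]mul1r ler_nM2r// lt_neqAle t0 leNgt.
      case: ifPn => tp x1; first by rewrite -{1}(mul1r t) ler_pM2r.
      by rewrite -[leRHS]mul1r ler_nM2r// lt_neqAle t0 leNgt.
    have [x1|x1] := leP 1 x; last by rewrite mul0r mulr0.
    have x0 : 0 < x by exact: lt_le_trans x1.
    rewrite mul1r (_ : x * t - t = (x - 1) * t); last by ring.
    rewrite !normrM (gtr0_norm x0) (ger0_norm (_ : 0 <= x - 1)) ?subr_ge0//.
    rewrite !powRM ?subr_ge0 ?(ltW x0)// /kmul x0.
    have -> : `|t| `^ (beta - 1) = `|t| `^ beta / `|t|.
      by rewrite powRB ?powRr1// (gt_eqF nt0) implybT.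
    have -> : x `^ (1 - beta) = x / x `^ beta.
      by rewrite powRB ?powRr1 ?(ltW x0)// (gt_eqF x0) implybT.
    have p1 : x `^ beta != 0 by rewrite gt_eqF ?powR_gt0.
    have p2 : `|t| `^ beta != 0 by rewrite gt_eqF ?powR_gt0.
    by field; rewrite p1 p2 !gt_eqF.
  rewrite cintZr; last exact: cmfunM.
  move=> /(congr1 (fun z => `|t|%:C * z)); rewrite !mulrA -!rmorphM divff ?gt_eqF//.
  by rewrite !mul1r => ->.
rewrite E1 -(cint_kmul_inv mh) -cintZr; last first.
  by apply: cmfunM => //; apply: (cmfun_comp _ mh); exact: measurable_invr.
apply: cint_ae.
- apply: cmfunM; first exact: cmfun_real.
  by apply: cmfunM => //; apply: (cmfun_comp _ mh); exact: measurable_invr.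
- apply: cmfunM.
    apply: cmfun_real; exact: (measurable_Vd measurable_cesW measurable_cesth).
  apply: (cmfun_comp _ mf).
  exact: (measurable_funM (measurable_cst t) (measurable_thd measurable_cesth)).
- apply: (ae_imp (ae_neq (1 : R))) => u u1.
  rewrite /h /kmul /cesW /cesth.
  have [hu|hu] := boolP (0 < u < 1); last first.
    rewrite !mul0r; case: ifPn => u0; last by rewrite mul0r mulr0.
    have : 1 <= u by move: hu; rewrite u0/= -leNgt.
    rewrite le_eqVlt eq_sym (negbTE u1)/= => u1'.
    by rewrite invf_ge1// leNgt u1' /= mul0r !mulr0.
  move/andP: hu => [hu0 hu1]; rewrite hu0 invf_ge1// (ltW hu1) !mulrA -!rmorphM.
  congr (_%:C * _).
  have -> : u^-1 - 1 = (1 - u) * u^-1 by field; rewrite gt_eqF.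
  rewrite powRM ?subr_ge0 ?invr_ge0 ?(ltW hu1) ?(ltW hu0)//.
  rewrite -[X in _ * X]mulrA -powRD; last by rewrite invr_eq0 (gt_eqF hu0) implybT.
  rewrite (_ : beta - 1 + (1 - beta) = 0) ?powRr0 ?mulr1; last by ring.
  by rewrite mulrAC.
Qed.

Lemma cmfun_Cesdual f : cmfun f -> cmfun (Cesdual beta f).
Proof.
move=> mf.
have mH := cmfun_hausdorff (measurable_Vd measurable_cesW measurable_cesth) (measurable_thd measurable_cesth) mf.
rewrite (_ : Cesdual beta f = fun t => (if t == 0 then 0 else 1)%:C *
    hausdorff (fun u => cesW u / cesth u) (fun u => (cesth u)^-1) f t).
  apply: cmfunM => //; apply: cmfun_real; apply: measurable_fun_ifT => //.
  exact: measurable_fun_eqr.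
apply/funext => t; case: ifPn => [/eqP ->|t0]; last by rewrite mul1r CesdualE.
by rewrite mul0r /Cesdual ltxx.
Qed.

(** Dividing the dual weight by its dilation and inverting that dilation returns [cesW] and [cesth],
    so the companion operator is the Cesaro average. Dilations 1/u are at least 1 on the support. *)
Lemma fourier_Cesdual_gt1 (p : R) f g : 1 < p -> is_fourier p f g ->
  is_fourier p (Cesdual beta f) (Ces beta g).
Proof.
move=> p1 fg.
have p0 : 0 < p by exact: lt_trans p1.
have q1 := conj_exp_gt1 p1.
have q0 : 0 < conj_exp p by exact: lt_trans q1.
have mW := measurable_cesW; have mth := measurable_cesth.
have mV := measurable_Vd mW mth; have mt := measurable_thd mth.
have [Lpf] := fg; rewrite gt_eqF// => -[Lqg Hc].
have [mf _] := (in_LpE f p0).1 Lpf; have [mg _] := (in_LpE g q0).1 Lqg.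
have V0 u : 0 <= cesW u / cesth u by rewrite divr_ge0 ?cesW_ge0 ?(ltW (cesth_gt0 u)).
have t0 u : 0 < (cesth u)^-1 by rewrite invr_gt0 cesth_gt0.
have eV : (fun u => cesW u / cesth u / (cesth u)^-1) = cesW.
  by apply/funext => u; rewrite invrK mulfVK// gt_eqF ?cesth_gt0.
have et : (fun u => (cesth u)^-1^-1) = cesth by apply/funext => u; rewrite invrK.
have Kd : (\int[mu]_u (cesW u / cesth u / (cesth u)^-1 * (cesth u)^-1^-1 `^ (- (conj_exp p)^-1))%:E < +oo)%E.
  suff -> : (\int[mu]_u (cesW u / cesth u / (cesth u)^-1 * (cesth u)^-1^-1 `^ (- (conj_exp p)^-1))%:E =
      \int[mu]_u (cesW u * cesth u `^ (- (conj_exp p)^-1))%:E)%E by exact: integral_ces.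
  apply: eq_integral => u _.
  by rewrite !invrK mulfVK// gt_eqF ?cesth_gt0.
have H : is_fourier p (hausdorff (fun u => cesW u / cesth u) (fun u => (cesth u)^-1) f)
    (hausdorff cesW cesth g).
  rewrite -[X in hausdorff X _ g]eV -[X in hausdorff _ X g]et.
  apply: (is_fourier_hausdorff mV mt V0 t0 p1 fg (integral_cesdual p0) Kd).
  apply: (diff_dilate_cvg0_ge1 mV mt V0 t0 q1 mf mg _ Kd).
    move=> u; rewrite /cesth /cesW; case: ifPn => [/andP[u0 u1] _|_]; last by rewrite mul0r eqxx.
    by rewrite invf_ge1// ltW.
  exact: (Lpow_cvg0 (fun r t => fourier_trunc f r t - g t) q0).1.
have -> : Ces beta g = hausdorff cesW cesth g by apply/funext => t; exact: CesE.
apply: is_fourier_ae p1 (cmfun_Cesdual mf) _ H.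
by apply: (ae_imp (ae_neq (0 : R))) => t tn0; rewrite CesdualE.
Qed.

(** For p = 1 the transform is an absolutely convergent integral prescribed at every t, so Fubini
    with constant cutoff 1 gives the identity pointwise, with no limit to take. *)
Lemma fourier_Cesdual_1 f g : is_fourier 1 f g ->
  is_fourier 1 (Cesdual beta f) (Ces beta g).
Proof.
move=> [Lpf]; rewrite eqxx => gE.
have mW := measurable_cesW; have mth := measurable_cesth.
have mV := measurable_Vd mW mth; have mt := measurable_thd mth.
have [mf Lf] := (in_LpE f ltr01).1 Lpf.
have V0 u : 0 <= cesW u / cesth u by rewrite divr_ge0 ?cesW_ge0 ?(ltW (cesth_gt0 u)).
have t0 u : 0 < (cesth u)^-1 by rewrite invr_gt0 cesth_gt0.
have mH := cmfun_hausdorff mV mt mf.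
have aeH : {ae mu, forall t, hausdorff (fun u => cesW u / cesth u) (fun u => (cesth u)^-1) f t = Cesdual beta f t}.
  by apply: (ae_imp (ae_neq (0 : R))) => t tn0; rewrite CesdualE.
have K := integral_cesdual (@ltr01 R).
have LC : in_Lp 1 (Cesdual beta f).
  apply/(in_LpE _ ltr01); split; first exact: cmfun_Cesdual.
  rewrite -(Lpow_ae 1 mH (cmfun_Cesdual mf) aeH).
  exact: (hausdorff_in_Lp mV mt V0 t0 (lexx 1) mf Lf K).
apply: (conj LC); rewrite eqxx => t.
have fin : (\int[mu]_x ((cst 1 x)%:E * ahausdorff (fun u => cesW u / cesth u)%R (fun u => (cesth u)^-1)%R f x) < +oo)%E.
  have := ahausdorff_Lp mV mt V0 t0 (lexx 1) mf K.
  under eq_integral do rewrite poweRe1 ?ahausdorff_ge0//.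
  move=> H; under eq_integral do rewrite mul1e.
  apply: le_lt_trans H _; rewrite lte_mul_pinfty ?poweR_ge0 ?fin_num_poweR ?ge0_fin_numE//.
  by apply: integral_ge0 => u _; rewrite lee_fin mulr_ge0 ?powR_ge0.
have aef := ae_ahausdorff_fin mV mt V0 t0 (lexx 1) mf K Lf.
have mexp s : cmfun (fun x : R => expi (- (x * s))).
  by apply: cmfun_expi; apply: measurableT_comp => //; exact: measurable_funM.
have fL1 h s : fourier_L1 h s = cintegral setT (fun x => (cst 1 x)%:C * (expi (- (x * s)) * h x)) :> R[i].
  by rewrite /fourier_L1; congr (cintegral setT _); apply/funext => x; rewrite mul1r.
transitivity (fourier_L1 (hausdorff (fun u => cesW u / cesth u) (fun u => (cesth u)^-1) f) t); last first.
  apply: cint_ae; [exact: cmfunM|apply: cmfunM => //; exact: cmfun_Cesdual|].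
  by apply: (ae_imp aeH) => x ->.
have cst0 (x : R) : 0 <= cst 1 x :> R by [].
rewrite fL1 (fourier_hausdorff mV mt V0 t0 t (measurable_cst (1:R)) cst0 mf aef fin).
rewrite CesE; last first.
  rewrite (_ : g = fun s => cintegral setT (fun x => expi (- (x * s)) * f x)); last by apply/funext.
  apply: (@cmfun_cint R _ _ (fun w : R * R => expi (- (w.2 * w.1)) * f w.2)).
  apply: cmfunM; last by apply: (cmfun_comp _ mf).
  by apply: cmfun_expi; apply: measurableT_comp => //; exact: measurable_funM.
rewrite /hausdorff; congr (cintegral setT _); apply/funext => u.
rewrite invrK mulfVK ?gt_eqF ?cesth_gt0// gE fL1.
by congr (_ * _); congr (cintegral setT _); apply/funext => x; rewrite invrK.
Qed.

End cesaro_operators.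

(** * Small dilations: the oscillatory part *)

Section power_weights.
Variable R : realType.
Local Notation mu := (@lebesgue_measure R).
Implicit Types (f g : R -> R[i]).

(** Two-power weight: exponent a near 0 and b at infinity. The value 0 at the origin makes the
    family stable under nonzero powers and under multiplication by powers of |y|. *)
Definition pw (a b y : R) : R :=
  if 0 < `|y| < 1 then `|y| `^ a else if 1 <= `|y| then `|y| `^ b else 0.

Lemma pw_ge0 a b y : 0 <= pw a b y.
Proof. by rewrite /pw; case: ifPn => _; [exact: powR_ge0|case: ifPn => // _; exact: powR_ge0]. Qed.

Lemma pw0 a b : pw a b 0 = 0.
Proof. by rewrite /pw normr0 ltxx/= ler10. Qed.

Lemma pwN a b y : pw a b (- y) = pw a b y.
Proof. by rewrite /pw normrN. Qed.

Lemma measurable_pw a b : measurable_fun setT (pw a b).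
Proof.
have mn : measurable_fun setT (fun y : R => `|y|) by exact: normr_measurable.
have mp c : measurable_fun setT (fun y : R => `|y| `^ c).
  exact: (measurableT_comp (measurable_powR _)).
apply: measurable_fun_ifT => //.
  by apply: measurable_and; apply: measurable_fun_ltr.
by apply: measurable_fun_ifT => //; apply: measurable_fun_ler.
Qed.

Lemma pw_powR a b c y : c != 0 -> pw a b y `^ c = pw (a * c) (b * c) y.
Proof.
move=> c0; rewrite /pw; case: ifPn => _; first by rewrite powRrM.
by case: ifPn => _; [rewrite powRrM|rewrite powR0].
Qed.

Lemma pw_mul a b c y : pw a b y * `|y| `^ c = pw (a + c) (b + c) y.
Proof.
have [->|y0] := eqVneq y 0; first by rewrite !pw0 mul0r.
have n0 : `|y| != 0 by rewrite normr_eq0.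
by rewrite /pw; case: ifPn => _; [|case: ifPn => _]; rewrite ?mul0r// powRD// n0 implybT.
Qed.

Lemma integral_pw_lty a b : -1 < a -> b < -1 -> (\int[mu]_y (pw a b y)%:E < +oo)%E.
Proof.
move=> a1 b1.
pose phi (x : R) := (if (0 < x < 1)%R then x `^ a else 0)%:E.
pose psi (x : R) := (if (1 <= x)%R then x `^ b else 0)%:E.
have mphi : measurable_fun setT phi.
  apply/measurable_EFinP; apply: measurable_fun_ifT => //.
  by apply: measurable_and; apply: measurable_fun_ltr.
have mpsi : measurable_fun setT psi.
  apply/measurable_EFinP; apply: measurable_fun_ifT => //; exact: measurable_fun_ler.
have phi0 x : (0 <= phi x)%E by rewrite lee_fin; case: ifPn => // _; exact: powR_ge0.
have psi0 x : (0 <= psi x)%E by rewrite lee_fin; case: ifPn => // _; exact: powR_ge0.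
have mN : measurable_fun setT (fun x : R => x * -1) by apply: measurable_funM.
have mphiN : measurable_fun setT (fun x : R => phi (x * -1)) by exact: (measurableT_comp mphi).
have mpsiN : measurable_fun setT (fun x : R => psi (x * -1)) by exact: (measurableT_comp mpsi).
have Iphi : (\int[mu]_x phi x < +oo)%E.
  have := @integral_powR_01 R (a + 1); rewrite addrK; apply; lra.
have Ipsi : (\int[mu]_x psi x < +oo)%E.
  have := @integral_powR_y R (- b - 1); rewrite (_ : -1 - (- b - 1) = b); last by ring.
  by apply; lra.
apply: (@le_lt_trans _ _ (\int[mu]_x ((phi x + phi (x * -1)%R) + (psi x + psi (x * -1)%R)))%E).
  apply: ge0_le_lintegral.
  - by apply/measurable_EFinP; exact: measurable_pw.
  - by apply: emeasurable_funD; apply: emeasurable_funD.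
  - by move=> y; rewrite lee_fin pw_ge0.
  - move=> y; rewrite /pw.
    have [->|y0] := eqVneq y 0.
      by rewrite normr0 ltxx/= ler10 !adde_ge0.
    case: ifPn => [/andP[h1 h2]|_].
      have [yn|yp|] := ltgtP y 0; last by move/eqP; rewrite (negbTE y0).
      + rewrite (@le_trans _ _ (phi (y * -1)))//.
          by rewrite ltr0_norm// in h1 h2 *; rewrite /phi mulrN1 h1 h2.
        by rewrite (@le_trans _ _ (phi y + phi (y * -1)%R)%E)// ?leeDr// ?leeDl// adde_ge0.
      + rewrite (@le_trans _ _ (phi y))//.
          by rewrite gtr0_norm// in h1 h2 *; rewrite /phi h1 h2.
        by rewrite (@le_trans _ _ (phi y + phi (y * -1)%R)%E)// ?leeDr// ?leeDl// adde_ge0.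
    case: ifPn => [h1|_]; last by rewrite !adde_ge0.
    have [yn|yp|] := ltgtP y 0; last by move/eqP; rewrite (negbTE y0).
    + rewrite (@le_trans _ _ (psi (y * -1)))//.
        by rewrite ltr0_norm// in h1 *; rewrite /psi mulrN1 h1.
      by rewrite (@le_trans _ _ (psi y + psi (y * -1)%R)%E)// ?leeDr// ?leeDl// adde_ge0.
    + rewrite (@le_trans _ _ (psi y))//.
        by rewrite gtr0_norm// in h1 *; rewrite /psi h1.
      by rewrite (@le_trans _ _ (psi y + psi (y * -1)%R)%E)// ?leeDr// ?leeDl// adde_ge0.
have n1 : (-1 : R) != 0 by rewrite oppr_eq0 oner_eq0.
rewrite ge0_integralD//=; last 4 first.
- by move=> x _; rewrite adde_ge0.
- exact: emeasurable_funD.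
- by move=> x _; rewrite adde_ge0.
- exact: emeasurable_funD.
rewrite !ge0_integralD//= (ge0_integral_dilate n1 mphi phi0) (ge0_integral_dilate n1 mpsi psi0).
by rewrite normrN normr1 invr1 !mul1e; apply: lte_add_pinfty; apply: lte_add_pinfty; [exact: Iphi|exact: Iphi|exact: Ipsi|exact: Ipsi].
Qed.

Lemma integral_pw_dilate a b t : t != 0 ->
  (\int[mu]_y (pw a b (y * t))%:E = (`|t|^-1)%:E * \int[mu]_y (pw a b y)%:E)%E.
Proof.
move=> t0; apply: (@ge0_integral_dilate R t (fun y => (pw a b y)%:E)) => //.
- by apply/measurable_EFinP; exact: measurable_pw.
- by move=> y; rewrite lee_fin pw_ge0.
Qed.

Section pw_transform.
Variables (p : R) (f : R -> R[i]).
Hypotheses (p1 : 1 < p) (p2 : p <= 2) (mf : cmfun f) (Lf : (Lpow p f < +oo)%E).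
Local Notation q := (conj_exp p).
(** Small enough for all the integrals below when 1 < p <= 2: delta q = p/4 < 1, delta + 1/2 < 1,
    and -delta + (p-1)/2 = (p-1)/4 > 0. *)
Local Notation delta := ((p - 1) / 4).
Local Notation e := (pw (- delta) (-1)).

Definition pwtrans (t : R) : \bar R := (\int[mu]_y (cnorm (f y) * e (y * t))%:E)%E.

Let p0 : 0 < p. Proof. exact: lt_trans p1. Qed.
Let p10 : 0 < p - 1. Proof. by rewrite subr_gt0. Qed.
Let q1 : 1 < q. Proof. exact: conj_exp_gt1. Qed.
Let q0 : 0 < q. Proof. exact: lt_trans q1. Qed.
Let mn : measurable_fun setT (fun y => cnorm (f y)). Proof. exact: measurable_cnorm. Qed.
Let N := fine (Lpow p f).
Let NE : (Lpow p f = N%:E)%E. Proof. by rewrite fineK// ge0_fin_numE// Lpow_ge0. Qed.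
Let N0 : 0 <= N. Proof. by rewrite fine_ge0// Lpow_ge0. Qed.
Let mpwt a b t : measurable_fun setT (fun y : R => pw a b (y * t)).
Proof. by apply: (measurableT_comp (measurable_pw _ _)); exact: measurable_funM. Qed.

Lemma pwtrans_ge0 t : (0 <= pwtrans t)%E.
Proof. by apply: integral_ge0 => y _; rewrite lee_fin mulr_ge0 ?cnorm_ge0 ?pw_ge0. Qed.

Lemma measurable_pwtrans : measurable_fun setT pwtrans.
Proof.
apply: (@measurable_ge0_integral_param R _ _ (fun z : R * R => (cnorm (f z.2) * e (z.2 * z.1))%:E)).
  apply/measurable_EFinP; apply: measurable_funM; first exact: (measurableT_comp mn).
  by apply: (measurableT_comp (measurable_pw _ _)); exact: measurable_funM.
by move=> z; rewrite lee_fin mulr_ge0 ?cnorm_ge0 ?pw_ge0.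
Qed.

(* Together with pwtrans_weighted this splits pwtrans ^ q as
   (pwtrans ^ p) ^ (q / p - 1) * pwtrans ^ p: the first factor is bounded
   pointwise, the second by an integral to which Tonelli applies. *)
Lemma pwtrans_holder : exists2 I1 : R, 0 <= I1 & forall t, t != 0 ->
  (pwtrans t `^ p <= (((I1 / `|t|) `^ (p - 1)) * N)%:E)%E.
Proof.
have I1fin : (\int[mu]_y (pw (- delta * q) (-1 * q) y)%:E < +oo)%E.
  apply: integral_pw_lty; last by rewrite mulN1r ltrN2.
  have E : (p - 1) / 4 * (p / (p - 1)) = p / 4 by field; rewrite gt_eqF.
  by rewrite /conj_exp mulNr ltrN2 E; have P1 := p1; have P2 := p2; lra.
have I10 : (0 <= \int[mu]_y (pw (- delta * q) (-1 * q) y)%:E)%E.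
  by apply: integral_ge0 => y _; rewrite lee_fin pw_ge0.
exists (fine (\int[mu]_y (pw (- delta * q) (-1 * q) y)%:E)); first exact: fine_ge0.
set I1 := fine _; move=> t t0.
have I1E : (\int[mu]_y (pw (- delta * q) (-1 * q) y)%:E = I1%:E)%E by rewrite fineK// ge0_fin_numE.
have e0 y : 0 <= e (y * t) by exact: pw_ge0.
(* The split e = e^q e^(1-q) is chosen so that e disappears from W F^p, as q + (1-q) p = 0; only the
   integral of |f|^p remains. *)
pose W y := e (y * t) `^ q; pose F y := cnorm (f y) * e (y * t) `^ (1 - q).
have -> : (pwtrans t = \int[mu]_y (W y * F y)%:E)%E.
  apply: eq_integral => y _; rewrite /W /F; congr EFin.
  have [h|h] := eqVneq (e (y * t)) 0; first by rewrite h powR0 ?gt_eqF// mul0r mulr0.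
  rewrite mulrCA -powRD; last by rewrite h implybT.
  by rewrite (addrCA q 1) subrr addr0 powRr1.
apply: le_trans (ge0_jensen mu (ltW p1) _ _ _ _) _.
- exact: (measurableT_comp (measurable_powR _) (mpwt _ _ _)).
- by apply: measurable_funM; [exact: mn|exact: (measurableT_comp (measurable_powR _) (mpwt _ _ _))].
- by move=> y; exact: powR_ge0.
- by move=> y; rewrite mulr_ge0 ?cnorm_ge0 ?powR_ge0.
have -> : (\int[mu]_y (W y)%:E = (I1 / `|t|)%:E)%E.
  under eq_integral do rewrite /W pw_powR ?gt_eqF//.
  by rewrite integral_pw_dilate// I1E -EFinM mulrC.
rewrite poweR_EFin EFinM -NE lee_wpmul2l ?lee_fin ?powR_ge0//.
apply: ge0_le_lintegral.
- apply/measurable_EFinP; apply: measurable_funM.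
    exact: (measurableT_comp (measurable_powR _) (mpwt _ _ _)).
  apply: (measurableT_comp (measurable_powR _)).
  by apply: measurable_funM; [exact: mn|exact: (measurableT_comp (measurable_powR _) (mpwt _ _ _))].
- exact: measurable_cnorm_powR.
- by move=> y; rewrite lee_fin mulr_ge0 ?powR_ge0.
- move=> y; rewrite lee_fin /W /F.
  have [h|h] := eqVneq (e (y * t)) 0; first by rewrite h powR0 ?gt_eqF// mul0r powR_ge0.
  rewrite powRM ?cnorm_ge0 ?powR_ge0// mulrCA -powRrM -powRD ?h ?implybT//.
  by rewrite (_ : q + (1 - q) * p = 0) ?powRr0 ?mulr1// /conj_exp; field; rewrite gt_eqF.
Qed.

(** The kernel decays like 1/|z| and is not integrable. Moving |y t|^(1/2) from it to f makes the
    weight integrable, and Jensen leaves |f|^p inside an integral that still depends on t. *)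
Lemma pwtrans_weighted : exists2 I2 : R, 0 <= I2 & forall t, t != 0 ->
  (pwtrans t `^ p <= ((I2 / `|t|) `^ (p - 1))%:E *
    \int[mu]_y (cnorm (f y) `^ p * pw (- delta + (p - 1) / 2) (-1 + (p - 1) / 2) (y * t))%:E)%E.
Proof.
have I2fin : (\int[mu]_y (pw (- delta - 2^-1) (-1 - 2^-1) y)%:E < +oo)%E.
  by apply: integral_pw_lty; have P1 := p1; have P2 := p2; lra.
have I20 : (0 <= \int[mu]_y (pw (- delta - 2^-1) (-1 - 2^-1) y)%:E)%E.
  by apply: integral_ge0 => y _; rewrite lee_fin pw_ge0.
exists (fine (\int[mu]_y (pw (- delta - 2^-1) (-1 - 2^-1) y)%:E)); first exact: fine_ge0.
set I2 := fine _; move=> t t0.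
have I2E : (\int[mu]_y (pw (- delta - 2^-1) (-1 - 2^-1) y)%:E = I2%:E)%E by rewrite fineK// ge0_fin_numE.
have e0 y : 0 <= e (y * t) by exact: pw_ge0.
pose W y := pw (- delta - 2^-1) (-1 - 2^-1) (y * t); pose F y := cnorm (f y) * `|y * t| `^ 2^-1.
have mpow c : measurable_fun setT (fun y : R => `|y * t| `^ c).
  apply: (measurableT_comp (measurable_powR _)); apply: (measurableT_comp (@normr_measurable _ setT)).
  exact: measurable_funM.
have -> : (pwtrans t = \int[mu]_y (W y * F y)%:E)%E.
  apply: eq_integral => y _; rewrite /W /F; congr EFin.
  by rewrite mulrCA pw_mul !subrK.
apply: le_trans (ge0_jensen mu (ltW p1) _ _ _ _) _.
- exact: mpwt.
- exact: (measurable_funM mn (mpow _)).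
- by move=> y; exact: pw_ge0.
- by move=> y; rewrite mulr_ge0 ?cnorm_ge0 ?powR_ge0.
have -> : (\int[mu]_y (W y)%:E = (I2 / `|t|)%:E)%E.
  by rewrite integral_pw_dilate// I2E -EFinM mulrC.
rewrite poweR_EFin le_eqVlt; apply/orP; left; apply/eqP; congr (_ * _)%E.
apply: eq_integral => y _; congr EFin; rewrite /W /F powRM ?cnorm_ge0 ?powR_ge0// mulrCA.
by rewrite -powRrM pw_mul; congr (_ * pw _ _ _); field.
Qed.

(** A Hardy-Littlewood type bound: after the two estimates, t occurs only through the measure dt/|t|
    and through y t, so the t-integral does not depend on y and factors out of the integral of
    |f|^p. *)
Lemma pwtrans_Lq : (\int[mu]_t (pwtrans t `^ q) < +oo)%E.
Proof.
have [I1 I10 H1] := pwtrans_holder; have [I2 I20 H2] := pwtrans_weighted.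
set al := - delta + (p - 1) / 2 in H2; set ga := -1 + (p - 1) / 2 in H2.
pose G (z : R * R) : R := `|z.1|^-1 * (cnorm (f z.2) `^ p * pw al ga (z.2 * z.1)).
have G0 z : 0 <= G z by rewrite !mulr_ge0 ?invr_ge0 ?powR_ge0 ?pw_ge0.
have mG : measurable_fun setT (EFin \o G).
  apply/measurable_EFinP; apply: measurable_funM.
    apply: (measurableT_comp (@measurable_invr R)); exact: (measurableT_comp (@normr_measurable _ setT)).
  apply: measurable_funM.
    by apply: (measurableT_comp (measurable_powR _)); exact: (measurableT_comp mn).
  by apply: (measurableT_comp (measurable_pw _ _)); exact: measurable_funM.
have mpt := measurable_pwtrans.
(* Here q/p = 1/(p-1), so p <= 2 is what makes s >= 0 and the pointwise bound usable to this
   power. *)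
pose s := q / p - 1.
have s0 : 0 <= s.
  by rewrite /s /conj_exp subr_ge0 mulrAC divff ?gt_eqF// mul1r invf_ge1// lerBlDr.
pose C := (I1 `^ (p - 1) * N) `^ s * I2 `^ (p - 1).
have C0 : 0 <= C by rewrite mulr_ge0 ?powR_ge0.
have key t : (pwtrans t `^ q <= C%:E * \int[mu]_y (G (t, y))%:E)%E.
  have [->|t0] := eqVneq t 0.
    rewrite (_ : pwtrans 0 = 0%E) ?poweR0r ?gt_eqF//.
      by rewrite mule_ge0 ?lee_fin//; apply: integral_ge0 => y _; rewrite lee_fin.
    by rewrite /pwtrans integral0_eq// => y _; rewrite mulr0 pw0 mulr0.
  have n0 : 0 < `|t| by rewrite normr_gt0.
  have := H1 _ t0; have := H2 _ t0; set B := (\int[mu]_y _)%E => Hb Ha.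
  have -> : (\int[mu]_y (G (t, y))%:E = (`|t|^-1)%:E * B)%E.
    rewrite /B -ge0_integralZl//=.
    + apply/measurable_EFinP; apply: measurable_funM; last exact: mpwt.
      exact: (measurableT_comp (measurable_powR _) mn).
    + by move=> y _; rewrite lee_fin mulr_ge0 ?powR_ge0 ?pw_ge0.
  have B0 : (0 <= B)%E by apply: integral_ge0 => y _; rewrite lee_fin mulr_ge0 ?powR_ge0 ?pw_ge0.
  have Ap0 : (0 <= pwtrans t `^ p)%E by exact: poweR_ge0.
  have -> : (pwtrans t `^ q = (pwtrans t `^ p) `^ s * (pwtrans t `^ p))%E.
    have : (pwtrans t `^ p < +oo)%E by apply: le_lt_trans Ha _; exact: ltry.
    move=> /(lty_poweRy (lt0r_neq0 p0)).
    have := pwtrans_ge0 t; case: (pwtrans t) => // a a0 _.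
    rewrite !poweR_EFin -EFinM; congr EFin; rewrite lee_fin in a0.
    have qE : q = p * s + p by rewrite /s; field; rewrite gt_eqF.
    rewrite {1}qE powRD ?powRrM//; apply/implyP; rewrite -qE => /eqP q00.
    by move: q0; rewrite q00 ltxx.
  apply: (@le_trans _ _ ((((I1 / `|t|) `^ (p - 1) * N)%:E `^ s) * (((I2 / `|t|) `^ (p - 1))%:E * B)))%E.
    by apply: lee_pmul; rewrite ?poweR_ge0//; exact: le_poweR.
  rewrite poweR_EFin !muleA -!EFinM le_eqVlt; apply/orP; left; apply/eqP; congr (_%:E * _)%E.
  have tn : 0 <= `|t|^-1 by rewrite invr_ge0.
  have -> : (I1 / `|t|) `^ (p - 1) = I1 `^ (p - 1) * `|t|^-1 `^ (p - 1) by rewrite powRM.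
  have -> : (I2 / `|t|) `^ (p - 1) = I2 `^ (p - 1) * `|t|^-1 `^ (p - 1) by rewrite powRM.
  rewrite mulrAC powRM ?powR_ge0 ?mulr_ge0 ?powR_ge0// -powRrM /C.
  rewrite -!mulrA; congr (_ * _); rewrite mulrCA; congr (_ * _).
  rewrite -powRD; last by rewrite invr_eq0 (gt_eqF n0) implybT.
  (* The powers of 1/|t| add up to (p-1) q/p = 1, hence exactly to the invariant density. *)
  rewrite (_ : (p - 1) * s + (p - 1) = 1) ?powRr1//.
  by rewrite /s /conj_exp; field; rewrite !gt_eqF.
have mGi : measurable_fun setT (fun t : R => \int[mu]_y (G (t, y))%:E)%E.
  by apply: (@measurable_ge0_integral_param R _ _ (EFin \o G)) => // z; rewrite lee_fin.
apply: (@le_lt_trans _ _ (\int[mu]_t (C%:E * \int[mu]_y (G (t, y))%:E))%E).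
  apply: ge0_le_lintegral => //.
  - exact: (measurableT_comp (measurable_poweR _)).
  - exact: measurable_funeM.
  - by move=> t; exact: poweR_ge0.
rewrite ge0_integralZl//=; last by move=> t _; apply: integral_ge0 => y _; rewrite lee_fin.
rewrite lte_mul_pinfty ?lee_fin//.
rewrite (@lebesgue_tonelli R (EFin \o G))//=.
have I3fin : (\int[mu]_y (pw (al - 1) (ga - 1) y)%:E < +oo)%E.
  by apply: integral_pw_lty; rewrite /al /ga; have P1 := p1; have P2 := p2; lra.
have I30 : (0 <= \int[mu]_y (pw (al - 1) (ga - 1) y)%:E)%E.
  by apply: integral_ge0 => y _; rewrite lee_fin pw_ge0.
(* Since 1/|t| = |y| / |t y|, the density goes into the weight as exponents [al - 1] and [ga - 1],
   and |y| cancels the Jacobian of the dilation by y. *)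
apply: (@le_lt_trans _ _ (\int[mu]_y ((cnorm (f y) `^ p)%:E * \int[mu]_t (pw (al - 1) (ga - 1) t)%:E))%E).
  apply: ge0_le_lintegral.
  - by apply: (@measurable_ge0_integral_paramr R (EFin \o G)) => // z; rewrite lee_fin.
  - by apply: emeasurable_funM => //; exact: measurable_cnorm_powR.
  - by move=> y; apply: integral_ge0 => t _; rewrite lee_fin.
  - move=> y; have [->|y0] := eqVneq y 0.
      rewrite integral0_eq; first by rewrite mule_ge0// lee_fin powR_ge0.
      by move=> t _; rewrite /G/= mul0r pw0 !mulr0.
    have n0 : 0 < `|y| by rewrite normr_gt0.
    have E t : G (t, y) = cnorm (f y) `^ p * `|y| * pw (al - 1) (ga - 1) (t * y).
      rewrite /G/= mulrCA -mulrA; congr (_ * _); rewrite (mulrC y t).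
      have [->|t0] := eqVneq t 0; first by rewrite mul0r !pw0 !mulr0.
      have -> : pw (al - 1) (ga - 1) (t * y) = pw al ga (t * y) * `|t * y| `^ (-1) by rewrite pw_mul.
      rewrite powR_inv1// normrM invfM.
      have ny : `|y| != 0 by rewrite normr_eq0.
      have nt : `|t| != 0 by rewrite normr_eq0.
      by field; rewrite ny nt.
    under eq_integral do rewrite E EFinM.
    rewrite ge0_integralZl//=.
    + rewrite integral_pw_dilate// muleA -EFinM -mulrA divff ?gt_eqF// mulr1//.
    + by apply/measurable_EFinP; exact: mpwt.
    + by move=> t _; rewrite lee_fin pw_ge0.
    + by rewrite lee_fin mulr_ge0 ?powR_ge0.
rewrite ge0_integralZr//=; last 2 first.
- exact: measurable_cnorm_powR.
- by move=> y _; rewrite lee_fin powR_ge0.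
by rewrite lte_mul_pinfty ?Lpow_ge0 ?ge0_fin_numE ?Lpow_ge0.
Qed.

End pw_transform.

End power_weights.

(** * Integration by parts for the kernel of small dilations *)

Section oscillatory_integrals.
Variable R : realType.
Local Notation mu := (@lebesgue_measure R).

Lemma is_derive_powR (c x : R) : 0 < x ->
  is_derive x 1 (fun y : R => y `^ c) (c * x `^ (c - 1)).
Proof.
move=> x0; have xin : x \in `]0, +oo[ by rewrite in_itv/= x0.
by apply: DeriveDef; [exact: derivable_powR|rewrite -derive1E powR_derive1].
Qed.

Lemma is_derive_for_continuous (h : R -> R) (x d : R) : is_derive x 1 h d -> {for x, continuous h}.
Proof. by move=> [dh _]; apply: differentiable_continuous; apply/derivable1_diffP. Qed.

Lemma within_itv_continuous (h : R -> R) (a b : R) :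
  (forall x, a <= x <= b -> {for x, continuous h}) -> {within `[a, b], continuous h}.
Proof. by move=> ch; apply: continuous_in_subspaceT => x; rewrite inE/= in_itv/=; exact: ch. Qed.

Lemma derivable_itv (h dh : R -> R) (a b : R) : a < b ->
  (forall x, a <= x <= b -> is_derive x 1 h (dh x)) ->
  derivable_oo_LRcontinuous h a b /\ {in `]a, b[, h^`()%classic =1 dh}.
Proof.
move=> ab H; split; first split.
- move=> x; rewrite in_itv/= => /andP[/ltW ax /ltW xb].
  by have [] := H x; rewrite ?ax ?xb.
- apply: cvg_at_right_filter; apply: (@is_derive_for_continuous _ _ (dh a)); apply: H.
  by rewrite lexx ltW.
- apply: cvg_at_left_filter; apply: (@is_derive_for_continuous _ _ (dh b)); apply: H.
  by rewrite lexx ltW.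
- move=> x; rewrite in_itv/= => /andP[/ltW ax /ltW xb]; rewrite derive1E.
  by have := H x; rewrite ax xb => /(_ isT) [_ ->].
Qed.

Lemma itv_continuous_integrable (h : R -> R) (a b : R) :
  (forall x, a <= x <= b -> {for x, continuous h}) ->
  mu.-integrable `[a, b] (EFin \o h).
Proof.
move=> ch; apply: continuous_compact_integrable; first exact: segment_compact.
exact: within_itv_continuous.
Qed.

Lemma le_normr_Rintegral_itv (h k : R -> R) (a b : R) :
  (forall x, a <= x <= b -> {for x, continuous h}) ->
  (forall x, a <= x <= b -> {for x, continuous k}) ->
  (forall x, a <= x <= b -> `|h x| <= k x) ->
  `|Rintegral mu `[a, b] h| <= Rintegral mu `[a, b] k.
Proof.
move=> ch ck hk.
have Ih := itv_continuous_integrable ch; have Ik := itv_continuous_integrable ck.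
apply: le_trans (le_normr_Rintegral _ Ih) _; first exact: measurable_itv.
apply: le_Rintegral => //; first exact: integrable_norm.
Qed.

Lemma normr_Rintegral_itv_le (h : R -> R) (a b M : R) : a <= b ->
  (forall x, a <= x <= b -> {for x, continuous h}) ->
  (forall x, a <= x <= b -> `|h x| <= M) ->
  `|Rintegral mu `[a, b] h| <= M * (b - a).
Proof.
move=> ab ch hM; apply: le_trans (@le_normr_Rintegral_itv h (cst M) a b ch _ hM) _.
  by move=> x _; exact: cst_continuous.
rewrite Rintegral_cst//.
rewrite -[X in fine X]/(mu `[a, b]%classic) lebesgue_measure_itv/= lte_fin.
case: ltP => [_|ba]; first by rewrite -EFinD.
by rewrite (_ : b = a) ?subrr//; apply/le_anti; rewrite ab ba.
Qed.

(* osc_sup c bounds (1 - u) ^ c, and osc_var beta the derivative of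
   u (1 - u) ^ (beta - 1), for 0 <= u <= 1/2. *)
Definition osc_sup (c : R) : R := 1 + 2^-1 `^ c.

Lemma osc_sup_ge0 c : 0 <= osc_sup c.
Proof. by rewrite addr_ge0 ?powR_ge0. Qed.

Definition osc_var (beta : R) : R :=
  osc_sup (beta - 1) + `|beta - 1| * osc_sup (beta - 2).

Lemma osc_var_ge0 beta : 0 <= osc_var beta.
Proof. by rewrite addr_ge0 ?mulr_ge0 ?osc_sup_ge0. Qed.

(** Real or imaginary part of the kernel, T being cos or sin. An antiderivative S and a derivative
    T' enter as hypotheses, so that one argument serves both. *)
Definition osc_ker (beta : R) (T : R -> R) (z u : R) : R :=
  T (z / u) * ((1 - u) `^ (beta - 1) / u).

Section osc.
Variables (beta : R) (S T T' : R -> R).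
Hypothesis dS : forall x : R, is_derive x 1 S (T x).
Hypothesis dT : forall x : R, is_derive x 1 T (T' x).
Hypothesis S1 : forall x, `|S x| <= 1.
Hypothesis T1 : forall x, `|T x| <= 1.
Local Notation k := (osc_ker beta T).
Local Notation C0 := (osc_sup (beta - 1)).
Local Notation C1 := (osc_var beta).

Lemma is_derive_1m_powR (c x : R) : x < 1 ->
  is_derive x 1 (fun y : R => (1 - y) `^ c) (- (c * (1 - x) `^ (c - 1))).
Proof.
move=> x1; have x0 : 0 < 1 - x by rewrite subr_gt0.
have d1 : is_derive x 1 (fun y : R => 1 - y) (-1).
  have e := @is_deriveB R R R (cst 1) id x 1 _ _ (is_derive_cst _ _ _) (is_derive_id _ _).
  by apply: (@is_derive_eq _ _ _ _ _ _ _ _ e); rewrite sub0r.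
have := @is_derive1_comp R (fun y => y `^ c) (fun y : R => 1 - y) x _ _ (is_derive_powR c x0) d1.
by rewrite mulrN1.
Qed.

Lemma is_derive_divr (z x : R) : x != 0 -> is_derive x 1 (fun y : R => z / y) (- z / x ^+ 2).
Proof.
move=> x0; have d1 := @is_deriveV R id x 1 1 x0 (is_derive_id _ _).
have d2 := @is_deriveM R _ (cst z) (fun y : R => y^-1) x 1 _ _ (is_derive_cst _ _ _) d1.
by apply: (@is_derive_eq _ _ _ _ _ _ _ _ d2); rewrite /GRing.scale/= mulr0 addr0 mulr1 mulrN mulNr.
Qed.

Lemma kernel_continuous (z x : R) : 0 < x < 1 -> {for x, continuous (k z)}.
Proof.
move=> /andP[x0 x1]; have nx : x != 0 by rewrite gt_eqF.
have d1 := @is_derive1_comp R T (fun y : R => z / y) x _ _ (dT _) (is_derive_divr z nx).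
have d2 := @is_deriveV R id x 1 1 nx (is_derive_id _ _).
have d3 := is_derive_1m_powR (beta - 1) x1.
have d4 := @is_deriveM R _ _ _ x 1 _ _ d3 d2.
exact: (is_derive_for_continuous (@is_deriveM R _ _ _ x 1 _ _ d1 d4)).
Qed.

(** The kernel is F G' with F(u) = u (1-u)^(beta-1) and G(u) = - S(z/u) / z. As |G| <= 1/|z|, each
    boundary term is at most C0 b / |z| and the integral of F' G at most C1 b / |z|. *)
Lemma osc_ibp (a b z : R) : 0 < a -> a <= b -> b <= 2^-1 -> z != 0 ->
  `|Rintegral mu `[a, b] (k z)| <= (2 * C0 + C1) * (b / `|z|).
Proof.
move=> a0; rewrite le_eqVlt => /predU1P[<- ah|ab bh] z0.
  apply: le_trans (@normr_Rintegral_itv_le (k z) a a `|k z a| (lexx _) _ _) _.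
  - move=> x /andP[ax xa]; apply: kernel_continuous; apply/andP; split; lra.
  - by move=> x xa; rewrite (_ : x = a)//; apply/le_anti; rewrite andbC.
  by rewrite subrr mulr0 mulr_ge0 ?addr_ge0 ?mulr_ge0 ?osc_sup_ge0 ?osc_var_ge0 ?invr_ge0 ?(ltW a0).
have nz : 0 < `|z| by rewrite normr_gt0.
have b0 : 0 < b by exact: lt_trans ab.
pose F (u : R) : R := u * (1 - u) `^ (beta - 1).
pose f (u : R) : R := (1 - u) `^ (beta - 1) - u * ((beta - 1) * (1 - u) `^ (beta - 2)).
pose G (u : R) : R := - z^-1 * S (z / u).
pose g (u : R) : R := T (z / u) * (u^-1 * u^-1).
have rng x : a <= x <= b -> [/\ 0 < x, x < 1, x != 0, 2^-1 <= 1 - x <= 1 & x <= b].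
  move=> /andP[ax xb]; have x0 : 0 < x by exact: lt_le_trans ax.
  by split; rewrite ?gt_eqF//; [lra|apply/andP; split; lra].
have dF x : a <= x <= b -> is_derive x 1 F (f x).
  move=> /rng[x0 x1 nx _ _].
  have := @is_deriveM R _ id (fun u : R => (1 - u) `^ (beta - 1)) x 1 _ _ (is_derive_id _ _) (is_derive_1m_powR (beta - 1) x1).
  move=> d; apply: (@is_derive_eq _ _ _ _ _ _ _ _ d).
  rewrite /GRing.scale/= /f mulr1 mulrN addrC (_ : beta - 1 - 1 = beta - 2)//; ring.
have dG x : a <= x <= b -> is_derive x 1 G (g x).
  move=> /rng[x0 x1 nx _ _].
  have d1 := @is_derive1_comp R S (fun y : R => z / y) x _ _ (dS _) (is_derive_divr z nx).
  have := @is_deriveM R _ (cst (- z^-1)) (S \o (fun y : R => z / y)) x 1 _ _ (is_derive_cst _ _ _) d1.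
  move=> d; apply: (@is_derive_eq _ _ _ _ _ _ _ _ d).
  by rewrite /GRing.scale/= /g mulr0 addr0; field; rewrite nx z0.
have cf x : a <= x <= b -> {for x, continuous f}.
  move=> /rng[x0 x1 nx _ _].
  have d1 := is_derive_1m_powR (beta - 1) x1; have d2 := is_derive_1m_powR (beta - 2) x1.
  have d3 := @is_deriveM R _ (cst (beta - 1)) _ x 1 _ _ (is_derive_cst _ _ _) d2.
  have d4 := @is_deriveM R _ id _ x 1 _ _ (is_derive_id _ _) d3.
  exact: (is_derive_for_continuous (@is_deriveB R _ _ _ _ x 1 _ _ d1 d4)).
have cg x : a <= x <= b -> {for x, continuous g}.
  move=> /rng[x0 x1 nx _ _].
  have d1 := @is_derive1_comp R T (fun y : R => z / y) x _ _ (dT _) (is_derive_divr z nx).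
  have d2 := @is_deriveV R id x 1 1 nx (is_derive_id _ _).
  have d3 := @is_deriveM R _ _ _ x 1 _ _ d2 d2.
  exact: (is_derive_for_continuous (@is_deriveM R _ _ _ x 1 _ _ d1 d3)).
have cG x : a <= x <= b -> {for x, continuous G}.
  by move=> xab; exact: (is_derive_for_continuous (dG x xab)).
have [dF1 dF2] := derivable_itv ab dF; have [dG1 dG2] := derivable_itv ab dG.
have := Rintegration_by_parts ab (within_itv_continuous cf) dF1 dF2 (within_itv_continuous cg) dG1 dG2.
have -> : Rintegral mu `[a, b] (fun x => F x * g x) = Rintegral mu `[a, b] (k z).
  apply: eq_Rintegral => x; rewrite inE/= in_itv/= => /rng[x0 x1 nx _ _].
  by rewrite /F /g /osc_ker; field.
move=> ->.
have zi : `|z^-1| = `|z|^-1 by rewrite normfV.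
have bG x : `|G x| <= `|z|^-1.
  by rewrite /G normrM normrN zi ler_piMr// invr_ge0.
have bP c x : 2^-1 <= 1 - x <= 1 -> `|(1 - x) `^ c| <= osc_sup c.
  by move=> hx; rewrite ger0_norm ?powR_ge0//; exact: powR_half_bound.
have bF x : a <= x <= b -> `|F x| <= C0 * b.
  move=> /rng[x0 x1 nx hx xb]; rewrite /F normrM (gtr0_norm x0) mulrC.
  by apply: ler_pM; [exact: normr_ge0|exact: ltW|exact: bP|exact: xb].
have bf x : a <= x <= b -> `|f x| <= C1.
  move=> /rng[x0 x1 nx hx xb]; rewrite /f (le_trans (ler_normB _ _))// lerD ?bP//.
  rewrite !normrM (gtr0_norm x0) -[leRHS]mul1r; apply: ler_pM; [exact: ltW|by []|exact: ltW|].
  by apply: ler_pM => //; exact: bP.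
have nz0 : 0 <= `|z|^-1 by rewrite invr_ge0.
have e1 : `|F b * G b| <= C0 * b * `|z|^-1.
  by rewrite normrM; apply: ler_pM => //; apply: bF; rewrite lexx ltW.
have e2 : `|F a * G a| <= C0 * b * `|z|^-1.
  by rewrite normrM; apply: ler_pM => //; apply: bF; rewrite lexx ltW.
have e3 : `|Rintegral mu `[a, b] (fun x => f x * G x)| <= C1 * `|z|^-1 * b.
  apply: le_trans (@normr_Rintegral_itv_le (fun x => f x * G x) a b (C1 * `|z|^-1) (ltW ab) _ _) _.
  - by move=> x xab; apply: continuousM; [exact: cf|exact: cG].
  - by move=> x xab; rewrite normrM; apply: ler_pM => //; exact: bf.
  - by rewrite ler_wpM2l ?mulr_ge0 ?osc_var_ge0// lerBlDr lerDl ltW.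
apply: le_trans (ler_normB _ _) _; apply: le_trans (lerD (ler_normB _ _) (lexx _)) _.
apply: le_trans (lerD (lerD e1 e2) e3) _.
by rewrite le_eqVlt; apply/orP; left; apply/eqP; ring.
Qed.

(** Absolute values would give log(b/c). Inserting (u/|z|)^d >= 1, valid for u >= |z|, replaces 1/u
    by u^(d-1), whose integral is at most b^d / d. *)
Lemma osc_log (d c b z : R) : 0 < d -> 0 < c -> c <= b -> b <= 2^-1 -> z != 0 -> `|z| <= c ->
  `|Rintegral mu `[c, b] (k z)| <= C0 / d * (`|z| / b) `^ (- d).
Proof.
move=> d0 c0; rewrite le_eqVlt => /predU1P[<- ch z0 zc|cb bh z0 zc].
  apply: le_trans (@normr_Rintegral_itv_le (k z) c c `|k z c| (lexx _) _ _) _.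
  - move=> x /andP[ax xa]; apply: kernel_continuous; apply/andP; split; lra.
  - by move=> x xa; rewrite (_ : x = c)//; apply/le_anti; rewrite andbC.
  by rewrite subrr mulr0 mulr_ge0 ?powR_ge0// divr_ge0 ?osc_sup_ge0// ltW.
have nz : 0 < `|z| by rewrite normr_gt0.
have b0 : 0 < b by exact: lt_trans cb.
pose h (u : R) : R := C0 * `|z| `^ (- d) * u `^ (d - 1).
pose H (u : R) : R := C0 * `|z| `^ (- d) / d * u `^ d.
have dH x : c <= x <= b -> is_derive x 1 H (h x).
  move=> /andP[cx xb]; have x0 : 0 < x by exact: lt_le_trans cx.
  have := @is_deriveM R _ (cst (C0 * `|z| `^ (- d) / d)) (fun u : R => u `^ d) x 1 _ _ (is_derive_cst _ _ _) (is_derive_powR d x0).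
  move=> e; apply: (@is_derive_eq _ _ _ _ _ _ _ _ e).
  by rewrite /GRing.scale/= /h mulr0 addr0 mulrA mulfVK// gt_eqF.
have ch x : c <= x <= b -> {for x, continuous h}.
  move=> /andP[cx xb]; have x0 : 0 < x by exact: lt_le_trans cx.
  exact: (is_derive_for_continuous (@is_deriveM R _ (cst (C0 * `|z| `^ (- d))) (fun u : R => u `^ (d - 1)) x 1 _ _ (is_derive_cst _ _ _) (is_derive_powR _ x0))).
have [dH1 dH2] := derivable_itv cb dH.
apply: le_trans (@le_normr_Rintegral_itv (k z) h c b _ ch _) _.
- by move=> x /andP[cx xb]; apply: kernel_continuous; apply/andP; split; lra.
- move=> x /andP[cx xb]; have x0 : 0 < x by exact: lt_le_trans cx.
  rewrite /osc_ker normrM (le_trans (ler_piMl _ (T1 _)))// normrM (ger0_norm (powR_ge0 _ _)).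
  rewrite gtr0_norm ?invr_gt0// /h -mulrA; apply: ler_pM => //; rewrite ?powR_ge0 ?invr_ge0 ?(ltW x0)//.
    by apply: powR_half_bound; apply/andP; split; lra.
  rewrite powRB ?(gt_eqF x0) ?implybT// powRr1 ?(ltW x0)// mulrA ler_peMl ?invr_ge0 ?(ltW x0)//.
  rewrite powRN mulrC ler_pdivlMr ?powR_gt0// mul1r.
  by rewrite ge0_ler_powR ?nnegrE ?(ltW d0) ?(ltW x0)// (le_trans zc).
rewrite /Rintegral (continuous_FTC2 cb (within_itv_continuous ch) dH1 dH2) -EFinB/=.
rewrite (@le_trans _ _ (H b))//; first by rewrite lerBlDr lerDl /H mulr_ge0 ?powR_ge0// divr_ge0 ?mulr_ge0 ?osc_sup_ge0 ?powR_ge0// ltW.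
rewrite /H powRM ?invr_ge0 ?(ltW b0)// -(powR_inv1 (ltW b0)) -powRrM mulrNN mul1r.
by rewrite le_eqVlt; apply/orP; left; apply/eqP; ring.
Qed.

(** Split at u = |z|: below, the phase z/u exceeds 1 and oscillation is exploited; above, the
    absolute bound suffices. Nothing depends on the lower endpoint a. *)
Lemma osc_pw (d a b z : R) : 0 < d -> 0 < a -> a <= b -> b <= 2^-1 -> z != 0 ->
  `|Rintegral mu `[a, b] (k z)| <= (2 * C0 + C1 + C0 / d) * pw (- d) (-1) (z / b).
Proof.
move=> d0 a0 ab bh z0.
have nz : 0 < `|z| by rewrite normr_gt0.
have b0 : 0 < b by exact: lt_le_trans ab.
have K0 : 0 <= 2 * C0 + C1 by rewrite addr_ge0 ?mulr_ge0 ?osc_sup_ge0 ?osc_var_ge0.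
have L0 : 0 <= C0 / d by rewrite divr_ge0 ?osc_sup_ge0// ltW.
have nzb : `|z / b| = `|z| / b by rewrite normrM (gtr0_norm (_ : 0 < b^-1)) ?invr_gt0.
have [zb|zb] := ltP `|z| b; last first.
  rewrite /pw nzb divr_gt0//= ltr_pdivrMr// mul1r ltNge zb/= ler_pdivlMr// mul1r zb.
  rewrite powR_inv1 ?divr_ge0 ?(ltW b0)// invf_div.
  apply: le_trans (osc_ibp a0 ab bh z0) _.
  by rewrite ler_wpM2r ?divr_ge0 ?(ltW b0)// lerDl.
have -> : pw (- d) (-1) (z / b) = (`|z| / b) `^ (- d).
  by rewrite /pw nzb divr_gt0//= ltr_pdivrMr// mul1r zb.
(* This lets the constant from integration by parts be absorbed into the power. *)
have ge1 : 1 <= (`|z| / b) `^ (- d).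
  rewrite powRN invf_ge1 ?powR_gt0 ?divr_gt0//.
  have e1 : 1 `^ d = 1 :> R by rewrite powR1.
  rewrite -[leRHS]e1 ge0_ler_powR ?nnegrE ?(ltW d0) ?divr_ge0 ?(ltW b0)//.
  by rewrite ler_pdivrMr// mul1r ltW.
(* If |z| <= a, the oscillating range is empty. *)
have [az|za] := ltP a `|z|; last first.
  apply: le_trans (osc_log d0 a0 ab bh z0 za) _.
  by rewrite ler_wpM2r ?powR_ge0// lerDr.
have ck : mu.-integrable `[a, b] (EFin \o k z).
  apply: itv_continuous_integrable => x /andP[ax xb]; apply: kernel_continuous.
  by apply/andP; split; lra.
have ckz : mu.-integrable `[`|z|, b] (EFin \o k z).
  apply: itv_continuous_integrable => x /andP[ax xb]; apply: kernel_continuous.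
  by apply/andP; split; lra.
have := @Rintegral_itvB R (k z) (BLeft a) (BRight b) `|z| ck.
rewrite !bnd_simp => /(_ (ltW az) (ltW zb)) /eqP; rewrite subr_eq => /eqP ->.
rewrite Rintegral_itv_obnd_cbnd//; last first.
  by apply: integrableS ckz => //=; apply: subset_itv; rewrite bnd_simp.
apply: le_trans (ler_normD _ _) _; rewrite addrC mulrDl; apply: lerD.
- apply: le_trans (osc_ibp a0 (ltW az) _ z0) _; first by rewrite (le_trans (ltW zb)).
  by rewrite divff ?gt_eqF// ler_wpM2l.
- by apply: osc_log => //; exact: ltW.
Qed.

End osc.

End oscillatory_integrals.

(** * Uniform bound for the dilations below kappa *)

Section small_dilations.
Variable R : realType.
Local Notation mu := (@lebesgue_measure R).
Implicit Types (f g : R -> R[i]).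

(** The weight is cut rather than the domain of integration, so that the general lemmas on averages
    apply to each piece. *)
Definition below (V : R -> R) (kap u : R) : R := if u <= kap then V u else 0.
Definition above (V : R -> R) (kap u : R) : R := if u <= kap then 0 else V u.

Lemma below_above V kap u : V u = below V kap u + above V kap u.
Proof. by rewrite /below /above; case: ifPn => _; rewrite ?addr0 ?add0r. Qed.

Section cut.
Variables (V : R -> R) (kap : R).
Hypotheses (mV : measurable_fun setT V) (V0 : forall u, 0 <= V u).

Lemma below_ge0 u : 0 <= below V kap u. Proof. by rewrite /below; case: ifP. Qed.
Lemma above_ge0 u : 0 <= above V kap u. Proof. by rewrite /above; case: ifP. Qed.

Lemma below_le u : below V kap u <= V u. Proof. by rewrite /below; case: ifP. Qed.
Lemma above_le u : above V kap u <= V u. Proof. by rewrite /above; case: ifP. Qed.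

Lemma measurable_below : measurable_fun setT (below V kap).
Proof. by apply: measurable_fun_ifT => //; exact: measurable_fun_ler. Qed.

Lemma measurable_above : measurable_fun setT (above V kap).
Proof. by apply: measurable_fun_ifT => //; exact: measurable_fun_ler. Qed.
End cut.

Lemma integral_mul_le_lty (V V' h : R -> R) :
  measurable_fun setT V -> measurable_fun setT V' -> measurable_fun setT h ->
  (forall u, 0 <= V' u <= V u) -> (forall u, 0 <= h u) ->
  (\int[mu]_u (V u * h u)%:E < +oo)%E -> (\int[mu]_u (V' u * h u)%:E < +oo)%E.
Proof.
move=> mV mV' mh VV h0; apply: le_lt_trans; apply: ge0_le_lintegral.
- by apply/measurable_EFinP; exact: measurable_funM.
- by apply/measurable_EFinP; exact: measurable_funM.
- by move=> u; rewrite lee_fin mulr_ge0//; case/andP: (VV u).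
- by move=> u; rewrite lee_fin ler_wpM2r//; case/andP: (VV u).
Qed.

Section low.
Variables (beta : R) (p : R) (f : R -> R[i]).
Hypotheses (b0 : 0 < beta) (p1 : 1 < p) (p2 : p <= 2) (mf : cmfun f) (Lf : (Lpow p f < +oo)%E).
Local Notation q := (conj_exp p).
Local Notation W := (cesW beta).
Local Notation th := (@cesth R).
Local Notation delta := ((p - 1) / 4).
Local Notation C := (2 * osc_sup (beta - 1) + osc_var beta + osc_sup (beta - 1) / delta).

Let mW : measurable_fun setT W. Proof. exact: measurable_cesW. Qed.
Let mth : measurable_fun setT th. Proof. exact: measurable_cesth. Qed.
Let W0 u : 0 <= W u. Proof. exact: cesW_ge0. Qed.
Let th0 u : 0 < th u. Proof. exact: cesth_gt0. Qed.
Let q1 : 1 < q. Proof. exact: conj_exp_gt1. Qed.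
Let q0 : 0 < q. Proof. exact: lt_trans q1. Qed.
Let d0 : 0 < delta. Proof. by rewrite divr_gt0// subr_gt0. Qed.
Let C0 : 0 <= C.
Proof. by rewrite !addr_ge0 ?mulr_ge0 ?osc_sup_ge0 ?osc_var_ge0// invr_ge0 ltW. Qed.

Definition lowpart (kap r t : R) : R[i] :=
  cintegral setT (fun u => (below W kap u / th u)%:C * fourier_trunc f (r * th u) (t / th u)).

Section fixed.
Variables (kap r : R).
Hypotheses (k0 : 0 < kap) (k2 : kap <= 2^-1) (r0 : 0 < r).
Local Notation B := (below W kap).

Let mI : measurable_fun setT (\1_(symI r) : R -> R).
Proof. by apply: measurable_indic; exact: measurable_symI. Qed.
Let mB : measurable_fun setT B. Proof. exact: measurable_below. Qed.
Let B0 u : 0 <= B u. Proof. exact: below_ge0. Qed.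

(** For 0 < u <= kap the cutoff |y/u| <= r reads u >= |y|/r, so r enters only through the lower
    endpoint of the interval. *)
Lemma below_kernelE (T : R -> R) (y t u : R) : y != 0 ->
  B u / th u * \1_(symI r) (y / th u) * T (- (y * (t / th u))) =
  ((fun u => beta * osc_ker beta T (- (y * t)) u) \_ `[`|y| / r, kap]) u.
Proof.
move=> y0; have ny : 0 < `|y| by rewrite normr_gt0.
rewrite patchE /below /cesW /cesth /osc_ker mem_setE in_itv/=.
case: (leP u kap) => uk; last by rewrite andbF !mul0r.
rewrite andbT; case: (ltP 0 u) => u0/=; last first.
  rewrite !mul0r ifF//; apply/negbTE; rewrite -ltNge (le_lt_trans u0)// divr_gt0//.
have u1 : u < 1 by rewrite (le_lt_trans uk)// (le_lt_trans k2)// invf_lt1// ltr1n.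
rewrite u1 indicE; have -> : (y / u \in symI r) = (`|y| / r <= u).
  rewrite ler_pdivrMr// (mulrC u) -ler_pdivrMr//.
  have -> : `|y| / u = `|y / u| by rewrite normrM (gtr0_norm (_ : 0 < u^-1)) ?invr_gt0.
  rewrite ler_norml; apply/idP/idP; rewrite inE//.
case: ifPn => _; last by rewrite mulr0 mul0r.
have -> : - (y * t) / u = - (y * (t / u)) by rewrite mulNr mulrA.
by rewrite mulr1; ring.
Qed.

(** The bound of [osc_pw] ignores the lower endpoint, hence is uniform in r; for |y| > r kap the
    interval is empty and the integral is 0. *)
Lemma below_kernel_le (S T T' : R -> R) (y t : R) :
  (forall x : R, is_derive x 1 S (T x)) -> (forall x : R, is_derive x 1 T (T' x)) ->
  (forall x, `|S x| <= 1) -> (forall x, `|T x| <= 1) -> y != 0 -> t != 0 ->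
  `|Rintegral mu setT (fun u => B u / th u * \1_(symI r) (y / th u) * T (- (y * (t / th u))))|
  <= beta * C * pw (- delta) (-1) (y * (t / kap)).
Proof.
move=> dS dT S1 T1 y0 t0; have ny : 0 < `|y| by rewrite normr_gt0.
have pos : 0 <= beta * C * pw (- delta) (-1) (y * (t / kap)).
  by rewrite mulr_ge0 ?pw_ge0// mulr_ge0// ltW.
under eq_Rintegral do rewrite below_kernelE//.
rewrite -Rintegral_mkcond.
have [yk|ky] := leP (`|y| / r) kap; last first.
  by rewrite set_itv_ge ?Rintegral_set0 ?normr0// bnd_simp -ltNge.
have a0 : 0 < `|y| / r by rewrite divr_gt0.
rewrite RintegralZl//; last first.
  apply: itv_continuous_integrable => x /andP[ax xk]; apply: (kernel_continuous dT).
  by apply/andP; split; [exact: lt_le_trans ax|have K2 := k2; lra].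
rewrite normrM (gtr0_norm b0) -mulrA ler_wpM2l ?(ltW b0)//.
have zt : - (y * t) != 0 by rewrite oppr_eq0 mulf_neq0.
apply: le_trans (osc_pw beta dS dT S1 T1 d0 a0 yk k2 zt) _.
by rewrite mulNr pwN -mulrA.
Qed.

Definition lowker (y t : R) : R[i] := cintegral setT (fun u =>
  (B u / th u * \1_(symI r) (y / th u))%:C * expi (- (y * (t / th u)))).

Lemma cnorm_lowker_le (y t : R) : y != 0 -> t != 0 ->
  cnorm (lowker y t) <= 2 * beta * C * pw (- delta) (-1) (y * (t / kap)).
Proof.
move=> y0 t0; apply: le_trans (cnorm_le_ReIm _) _.
have -> : 2 * beta * C * pw (- delta) (-1) (y * (t / kap)) =
  beta * C * pw (- delta) (-1) (y * (t / kap)) + beta * C * pw (- delta) (-1) (y * (t / kap)) by ring.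
rewrite /lowker /cintegral; apply: lerD => /=.
- under eq_Rintegral do rewrite mul0r subr0.
  apply: (@below_kernel_le sin cos (fun x => - sin x)) => //.
  + by move=> x; exact: sin_max.
  + by move=> x; exact: cos_max.
- under eq_Rintegral do rewrite mul0r addr0.
  apply: (@below_kernel_le (fun x => - cos x) sin cos) => //.
  + move=> x; have d := @is_deriveN R _ _ cos x 1 _ (is_derive_cos x).
    by apply: (@is_derive_eq _ _ _ _ _ _ _ _ d); rewrite opprK.
  + by move=> x; rewrite normrN; exact: cos_max.
  + by move=> x; exact: sin_max.
Qed.

(** The exchange of u and y must precede any estimate: the cancellation lies in the u-integral, and
    is lost once absolute values are taken under it. *)
Lemma lowpartE (t : R) : lowpart kap r t = cintegral setT (fun y => f y * lowker y t).
Proof.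
pose F (z : R * R) : R[i] := (B z.1 / th z.1)%:C *
  ((\1_(symI r) (z.2 / th z.1))%:C * (expi (- (z.2 * (t / th z.1))) * f z.2)).
have mth1 : measurable_fun setT (fun z : R * R => (th z.1)^-1).
  by apply: (measurableT_comp (measurable_thd mth)).
have mc : cmfun (fun z : R * R => (B z.1 / th z.1 * \1_(symI r) (z.2 / th z.1))%:C).
  apply: cmfun_real; apply: measurable_funM; first exact: (measurableT_comp (measurable_Vd mB mth)).
  by apply: (measurableT_comp mI); exact: measurable_div_fst.
have me : cmfun (fun z : R * R => expi (- (z.2 * (t / th z.1)))).
  by apply: cmfun_expi; apply: measurableT_comp => //; apply: measurable_funM => //; exact: measurable_funM.
have FE (z : R * R) : F z = f z.2 * ((B z.1 / th z.1 * \1_(symI r) (z.2 / th z.1))%:C * expi (- (z.2 * (t / th z.1)))).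
  by rewrite /F rmorphM/=; ring.
have mF : cmfun F.
  rewrite (_ : F = fun z => f z.2 * ((B z.1 / th z.1 * \1_(symI r) (z.2 / th z.1))%:C * expi (- (z.2 * (t / th z.1))))); last exact/funext.
  apply: cmfunM; first exact: (cmfun_comp _ mf).
  exact: cmfunM.
transitivity (cintegral setT (fun u => cintegral setT (fun y => F (u, y)))).
  rewrite /lowpart; congr (cintegral setT _); apply/funext => u.
  rewrite (fourier_truncE _ _ _ (th0 u)) -cintZr//.
  apply: cmfunM; first by apply: cmfun_real; apply: (measurableT_comp mI); exact: measurable_funM.
  apply: cmfunM => //; apply: cmfun_expi; apply: measurableT_comp => //; exact: measurable_funM.
have mp : measurable_fun setT (fun u => th u `^ (- p^-1)).
  exact: (measurableT_comp (measurable_powR _) mth).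
have Kb : (\int[mu]_u (B u * th u `^ (- p^-1))%:E < +oo)%E.
  apply: (integral_mul_le_lty mW mB mp _ _ (integral_ces b0 p1)).
  - by move=> u; apply/andP; split; [exact: B0|exact: below_le].
  - by move=> u; exact: powR_ge0.
rewrite cint_fubini//; last first.
  have := @ahausdorff_loc R B th mB mth B0 th0 p r f (ltW p1) mf Kb Lf.
  rewrite -integral_dilate_hausdorff//; apply: le_lt_trans.
  rewrite le_eqVlt; apply/orP; left; apply/eqP; apply: eq_integral => u _.
  apply: eq_integral => y _; congr EFin; rewrite /F/= !cnormM !cnormR cnorm_expi mul1r.
  by rewrite !ger0_norm ?divr_ge0 ?(ltW (th0 u)).
apply: cint_ae.
- by apply: (@cmfun_cint R _ _ (fun w : R * R => F (w.2, w.1))); apply: (cmfun_comp _ mF); exact: measurable_swap.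
- apply: cmfunM => //.
  apply: (@cmfun_cint R _ _ (fun w : R * R => (B w.2 / th w.2 * \1_(symI r) (w.1 / th w.2))%:C * expi (- (w.1 * (t / th w.2))))).
  by apply: (cmfun_comp (@measurable_swap _ _ _ _) (cmfunM mc me)).
apply: (ae_imp (ae_neq 0)) => y y0; have ny : 0 < `|y| by rewrite normr_gt0.
have mu1 : measurable_fun setT (fun u : R => (u, y)) by exact: measurable_pair2.
rewrite /lowker -cintZ.
- by congr (cintegral setT _); apply/funext => u; rewrite FE.
- exact: (cmfun_comp mu1 (cmfunM mc me)).
have := @integral_cesW_powR R beta b0 1 ltr01; rewrite subrr => Wfin.
(* On the support of the cutoff 1/th(u) <= r/|y|, so for fixed y != 0 the kernel is dominated by a
   multiple of W. *)
rewrite /cL1; apply: (@le_lt_trans _ _ (\int[mu]_u ((r / `|y|)%:E * (W u)%:E))%E); last first.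
  rewrite ge0_integralZl//=; last 3 first.
  - exact/measurable_EFinP.
  - by move=> u _; rewrite lee_fin.
  - by rewrite lee_fin divr_ge0// ltW.
  rewrite lte_mul_pinfty ?lee_fin ?divr_ge0 ?(ltW r0)//.
  by move: Wfin; under eq_integral do rewrite powRr0 mulr1.
apply: ge0_le_lintegral.
- exact: (measurable_cnormE (cmfun_comp mu1 (cmfunM mc me))).
- by apply: measurable_funeM; exact/measurable_EFinP.
- by move=> u; rewrite lee_fin cnorm_ge0.
- move=> u; rewrite lee_fin cnormM cnormR cnorm_expi mulr1.
  rewrite ger0_norm ?mulr_ge0 ?invr_ge0 ?(ltW (th0 u))// indicE.
  case: (boolP (_ \in _)); last by rewrite mulr0 mulr_ge0 ?divr_ge0 ?(ltW r0).
  rewrite inE /symI/= -ler_norml normrM (gtr0_norm (_ : 0 < (th u)^-1)) ?invr_gt0// mulr1 => h.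
  rewrite mulrC; apply: ler_pM => //; first by rewrite invr_ge0 ltW.
    by rewrite ler_pdivlMr// mulrC.
  exact: below_le.
Qed.

End fixed.

(** Pointwise the low part is at most c times [pwtrans] at t / kap; the dilation then contributes
    the factor kap, with K independent of kap and r. *)
Lemma lowpart_Lpow : exists2 K : R, 0 <= K & forall kap r : R, 0 < kap -> kap <= 2^-1 -> 0 < r ->
  (Lpow q (lowpart kap r) <= (K * kap)%:E)%E.
Proof.
have Lq := pwtrans_Lq p1 p2 mf Lf; have mpt := measurable_pwtrans p mf.
set I := (\int[mu]_t (pwtrans p f t `^ q))%E in Lq.
have I0 : (0 <= I)%E by apply: integral_ge0 => t _; exact: poweR_ge0.
(* One 2 comes from [le_cnorm_cint], the other from the real and imaginary parts of the kernel. *)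
pose c := 2 * (2 * beta * C); have c0 : 0 <= c by rewrite !mulr_ge0// ltW.
have mptq : measurable_fun setT (fun t => pwtrans p f t `^ q)%E.
  exact: (measurableT_comp (measurable_poweR q) mpt).
exists (c `^ q * fine I); first by rewrite mulr_ge0 ?powR_ge0 ?fine_ge0.
move=> kap r k0 k2 r0.
have mptk : measurable_fun setT (fun t : R => pwtrans p f (t * kap^-1)%R `^ q)%E.
  by apply: (measurableT_comp mptq); exact: measurable_funM.
have mB := @measurable_below W kap mW.
have mL : cmfun (lowpart kap r).
  apply: (@cmfun_cint R _ _ (fun w : R * R => (below W kap w.2 / th w.2)%:C * fourier_trunc f (r * th w.2) (w.1 / th w.2))).
  apply: cmfunM; first by apply: cmfun_real; exact: (measurableT_comp (measurable_Vd mB mth)).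
  exact: (cmfun_comp (@measurable_swap _ _ _ _) (cmfun_trunc_dilate mth th0 r mf)).
apply: (@le_trans _ _ (\int[mu]_t ((c `^ q)%:E * (pwtrans p f (t * kap^-1)%R `^ q)))%E).
  apply: ae_ge0_le_integral => //.
  - by move=> t _; rewrite lee_fin powR_ge0.
  - exact: measurable_cnorm_powR.
  - by move=> t _; rewrite mule_ge0 ?lee_fin ?powR_ge0// poweR_ge0.
  - exact: measurable_funeM.
  apply: (ae_imp (ae_neq 0)) => t t0 _.
  rewrite -poweR_EFin -[X in (X * _)%E]poweR_EFin -poweRM ?lee_fin ?pwtrans_ge0//.
  apply: le_poweR; rewrite ?(ltW q0) ?lee_fin ?cnorm_ge0//.
  have mk : cmfun (fun y => lowker kap r y t).
    apply: (@cmfun_cint R _ _ (fun w : R * R => (below W kap w.2 / th w.2 * \1_(symI r) (w.1 / th w.2))%:C * expi (- (w.1 * (t / th w.2))))).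
    have mth2 : measurable_fun setT (fun z : R * R => (th z.2)^-1).
      by apply: (measurableT_comp (measurable_thd mth)).
    have mI : measurable_fun setT (\1_(symI r) : R -> R).
      by apply: measurable_indic; exact: measurable_symI.
    apply: cmfunM.
      apply: cmfun_real; apply: measurable_funM; first exact: (measurableT_comp (measurable_Vd mB mth)).
      by apply: (measurableT_comp mI); exact: measurable_funM.
    by apply: cmfun_expi; apply: measurableT_comp => //; apply: measurable_funM => //; exact: measurable_funM.
  rewrite lowpartE//; apply: le_trans (le_cnorm_cint (cmfunM mf mk)) _.
  rewrite /c EFinM -muleA lee_wpmul2l ?lee_fin// /pwtrans -ge0_integralZl//=; last 3 first.
  - apply/measurable_EFinP; apply: measurable_funM; first exact: measurable_cnorm.
    by apply: (measurableT_comp (measurable_pw _ _)); exact: measurable_funM.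
  - by move=> y _; rewrite lee_fin mulr_ge0 ?cnorm_ge0 ?pw_ge0.
  - by rewrite lee_fin !mulr_ge0// ltW.
  apply: ae_ge0_le_integral => //.
  - by move=> y _; rewrite lee_fin cnorm_ge0.
  - exact: (measurable_cnormE (cmfunM mf mk)).
  - by move=> y _; rewrite lee_fin !mulr_ge0 ?cnorm_ge0 ?pw_ge0// ltW.
  - apply: measurable_funeM; apply/measurable_EFinP; apply: measurable_funM; first exact: measurable_cnorm.
    by apply: (measurableT_comp (measurable_pw _ _)); exact: measurable_funM.
  apply: (ae_imp (ae_neq 0)) => y y0 _; rewrite -EFinM lee_fin cnormM mulrCA ler_wpM2l ?cnorm_ge0//.
  exact: cnorm_lowker_le.
rewrite ge0_integralZl//=; last 2 first.
- by move=> t _; exact: poweR_ge0.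
- by rewrite lee_fin powR_ge0.
have ki : kap^-1 != 0 by rewrite invr_neq0// gt_eqF.
rewrite (ge0_integral_dilate ki mptq (fun x => poweR_ge0 _ _)).
rewrite -/I gtr0_norm ?invr_gt0// invrK -(@fineK _ I) ?ge0_fin_numE// -!EFinM lee_fin.
by rewrite mulrAC mulrA.
Qed.

End low.

End small_dilations.

(** * The theorem *)

Section cesaro_fourier.
Variable R : realType.
Local Notation mu := (@lebesgue_measure R).
Implicit Types (f g : R -> R[i]).

Lemma cL1_le f (h : R -> R) : cmfun f -> measurable_fun setT h ->
  (forall x, cnorm (f x) <= h x) -> (\int[mu]_x (h x)%:E < +oo)%E -> cL1 f.
Proof.
move=> mf mh fh; apply: le_lt_trans; apply: ge0_le_lintegral.
- exact: measurable_cnormE.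
- exact/measurable_EFinP.
- by move=> x; rewrite lee_fin cnorm_ge0.
- by move=> x; rewrite lee_fin.
Qed.

Lemma cL1B f g : cmfun f -> cmfun g -> cL1 f -> cL1 g -> cL1 (fun x => f x - g x).
Proof.
move=> mf mg If Ig.
apply: (@cL1_le _ (fun x => cnorm (f x) + cnorm (g x))).
- exact: cmfunB.
- by apply: measurable_funD; exact: measurable_cnorm.
- by move=> x; exact: cnormB.
under eq_integral do rewrite EFinD.
rewrite ge0_integralD//=; last 4 first.
- by move=> x _; rewrite lee_fin cnorm_ge0.
- exact: measurable_cnormE.
- by move=> x _; rewrite lee_fin cnorm_ge0.
- exact: measurable_cnormE.
by rewrite lte_add_pinfty.
Qed.

Lemma powR_add_le (q x y : R) : 0 <= q -> 0 <= x -> 0 <= y ->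
  (x + y) `^ q <= 2 `^ q * (x `^ q + y `^ q).
Proof.
move=> q0; wlog xy : x y / x <= y.
  move=> H x0 y0; have [xy|yx] := leP x y; first exact: H.
  by rewrite addrC [X in _ * X]addrC; apply: H => //; exact: ltW.
move=> x0 y0; apply: (@le_trans _ _ ((2 * y) `^ q)).
  by rewrite ge0_ler_powR ?nnegrE ?addr_ge0 ?mulr_ge0// mulr2n mulrDl mul1r lerD2r.
by rewrite powRM// ler_wpM2l ?powR_ge0// lerDr powR_ge0.
Qed.

Lemma Lpow_sub_le (q : R) f g : 0 <= q -> cmfun f -> cmfun g ->
  (Lpow q (fun x => f x - g x)%R <= (2 `^ q)%:E * (Lpow q f + Lpow q g))%E.
Proof.
move=> q0 mf mg; rewrite /Lpow -ge0_integralD//=; last 4 first.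
- by move=> x _; rewrite lee_fin powR_ge0.
- exact: measurable_cnorm_powR.
- by move=> x _; rewrite lee_fin powR_ge0.
- exact: measurable_cnorm_powR.
rewrite -ge0_integralZl//=; last 2 first.
- by apply: emeasurable_funD; exact: measurable_cnorm_powR.
- by move=> x _; rewrite adde_ge0 ?lee_fin ?powR_ge0.
apply: ge0_le_lintegral.
- by apply: measurable_cnorm_powR; exact: cmfunB.
- by apply: measurable_funeM; apply: emeasurable_funD; exact: measurable_cnorm_powR.
- by move=> x; rewrite lee_fin powR_ge0.
- move=> x; rewrite -EFinD -EFinM lee_fin; apply: le_trans (powR_add_le _ _ _); rewrite ?cnorm_ge0//.
  by rewrite ge0_ler_powR ?nnegrE ?addr_ge0 ?cnorm_ge0//; exact: cnormB.
Qed.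

(** * The three pieces of the difference for the Cesaro operator *)

Section cesaro.
Variables (beta : R) (p : R) (f g : R -> R[i]).
Hypotheses (b0 : 0 < beta) (p1 : 1 < p) (p2 : p <= 2).
Local Notation q := (conj_exp p).
Hypotheses (mf : cmfun f) (Lf : (Lpow p f < +oo)%E) (mg : cmfun g) (Lg : (Lpow q g < +oo)%E).
Local Notation W := (cesW beta).
Local Notation th := (@cesth R).

Let mW : measurable_fun setT W. Proof. exact: measurable_cesW. Qed.
Let mth : measurable_fun setT th. Proof. exact: measurable_cesth. Qed.
Let W0 u : 0 <= W u. Proof. exact: cesW_ge0. Qed.
Let th0 u : 0 < th u. Proof. exact: cesth_gt0. Qed.
Let q1 : 1 < q. Proof. exact: conj_exp_gt1. Qed.
Let q0 : 0 < q. Proof. exact: lt_trans q1. Qed.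
Let mthp c : measurable_fun setT (fun u => (th u)^-1 `^ c).
Proof. exact: (measurableT_comp (measurable_powR _) (measurable_thd mth)). Qed.
Let div0 (x u : R) : 0 <= x -> 0 <= x / th u.
Proof. by move=> x0; rewrite divr_ge0// ltW. Qed.

(** With u^(2s) split in two, one u^s is at most kap^s and the other keeps the singularity u^(s-1)
    integrable. *)
Lemma below_dual_integral (kap s : R) : 0 < kap -> 0 < s ->
  (\int[mu]_u (below W kap u / th u * (th u)^-1 `^ (- (s + s)))%:E <=
   (kap `^ s)%:E * \int[mu]_u (W u * th u `^ (s - 1))%:E)%E.
Proof.
move=> k0 s0; have mB := @measurable_below R W kap mW.
have ms : measurable_fun setT (fun u => W u * th u `^ (s - 1)).
  by apply: measurable_funM => //; exact: (measurableT_comp (measurable_powR _) mth).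
rewrite -ge0_integralZl//=; last 3 first.
- exact/measurable_EFinP.
- by move=> u _; rewrite lee_fin mulr_ge0 ?powR_ge0.
- by rewrite lee_fin powR_ge0.
apply: ge0_le_lintegral.
- by apply/measurable_EFinP; apply: measurable_funM; [exact: (measurable_Vd mB mth)|exact: mthp].
- by apply: measurable_funeM; exact/measurable_EFinP.
- by move=> u; rewrite lee_fin mulr_ge0 ?powR_ge0// div0// below_ge0.
move=> u; rewrite -EFinM lee_fin; have tu := th0 u.
rewrite -(powR_inv1 (ltW tu)) -[X in _ * X]powRrM mulrNN mul1r -mulrA -powRD; last by rewrite (gt_eqF tu) implybT.
rewrite (_ : -1 + (s + s) = s + (s - 1)); last by ring.
rewrite powRD; last by rewrite (gt_eqF tu) implybT.
rewrite [leRHS]mulrCA /below /cesW /cesth.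
case: (leP u kap) => uk; last first.
  by rewrite mul0r !mulr_ge0 ?powR_ge0//; case: ifPn => // _; rewrite mulr_ge0 ?powR_ge0// ltW.
case: ifPn => [/andP[u0 u1]|_]; last by rewrite !mul0r.
rewrite ler_wpM2l ?mulr_ge0 ?powR_ge0 ?(ltW b0)// ler_wpM2r ?powR_ge0//.
by rewrite ge0_ler_powR ?nnegrE ?(ltW s0) ?(ltW u0) ?(ltW k0).
Qed.

Lemma lowdual_Lpow : exists2 K : R, 0 <= K & forall kap : R, 0 < kap ->
  (Lpow q (fun t => cintegral setT (fun u => (below W kap u / th u)%:C * g (t / th u))%R)
   <= (K * kap `^ 2^-1)%:E)%E.
Proof.
(* Half of the available exponent 1/q; the q-th power of kap^s is then kap^(1/2). *)
pose s := (2 * q)^-1; have s0 : 0 < s by rewrite invr_gt0 mulr_gt0.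
have ss : s + s = q^-1 by rewrite /s; field; rewrite gt_eqF.
have sq : s * q = 2^-1 by rewrite /s; field; rewrite gt_eqF.
have K1fin := integral_cesW_powR b0 s0; set K1 := (\int[mu]_u _)%E in K1fin.
have K10 : (0 <= K1)%E by apply: integral_ge0 => u _; rewrite lee_fin mulr_ge0 ?powR_ge0.
exists (2 `^ q * (fine K1 `^ q * fine (Lpow q g))).
  by rewrite !mulr_ge0 ?powR_ge0// fine_ge0// Lpow_ge0.
move=> kap k0; have mB := @measurable_below R W kap mW.
have IB := below_dual_integral k0 s0; rewrite -/K1 ss in IB.
have KF : (K1 = (fine K1)%:E)%E by rewrite fineK// ge0_fin_numE.
have LF : (Lpow q g = (fine (Lpow q g))%:E)%E by rewrite fineK// ge0_fin_numE// Lpow_ge0.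
set I := (\int[mu]_u (below W kap u / th u * (th u)^-1 `^ (- q^-1))%:E)%E in IB.
have I0 : (0 <= I)%E.
  by apply: integral_ge0 => u _; rewrite lee_fin mulr_ge0 ?powR_ge0// div0// below_ge0.
have Ifin : (I < +oo)%E by apply: le_lt_trans IB _; rewrite KF -EFinM ltry.
have L := @Lpow_cint_le R q (fun u => below W kap u / th u) (fun u => (th u)^-1 `^ (- q^-1))
  (fun w : R * R => g (w.2 / th w.1)) (Lpow q g) (ltW q1) (measurable_Vd mB mth) (mthp _).
apply: le_trans (L _ _ _ _ _ Ifin) _.
- by apply: (cmfun_comp _ mg); exact: measurable_div_fst.
- by move=> u; apply: div0; exact: below_ge0.
- by move=> u; rewrite powR_gt0// invr_gt0.
- exact: Lpow_ge0.
- move=> u _; rewrite [X in (X <= _)%E](Lpow_dilate q (th0 u) mg).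
  rewrite -powRrM mulNr mulVf ?gt_eqF// powR_inv1 ?invr_ge0 ?(ltW (th0 u))// invrK muleC.
  exact: lexx.
rewrite -/I EFinM EFinM.
apply: (@le_trans _ _ ((2 `^ q)%:E * ((kap `^ s * fine K1)%:E `^ q * Lpow q g)))%E.
  rewrite lee_wpmul2l ?lee_fin ?powR_ge0// lee_wpmul2r ?Lpow_ge0//.
  by apply: le_poweR; [exact: ltW|exact: I0|rewrite EFinM -KF; exact: IB].
rewrite LF poweR_EFin -!EFinM lee_fin powRM ?powR_ge0 ?fine_ge0// -powRrM sq.
by rewrite le_eqVlt; apply/orP; left; apply/eqP; ring.
Qed.

(** Above kap one has r th(u) >= r kap >= r0, so all dilated differences are small. K is built from
    the full weight and so does not depend on kap. *)
Lemma highpart_Lpow : exists2 K : R, 0 <= K & forall kap r0 r e : R, 0 < kap -> 0 < r0 -> 0 <= e ->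
  (forall r', r0 <= r' -> (Lpow q (fun t => fourier_trunc f r' t - g t)%R <= e%:E)%E) ->
  r0 <= r * kap ->
  (Lpow q (fun t => cintegral setT (fun u => (above W kap u / th u)%:C * diff_dilate th f g r t u)%R)
   <= (K * e)%:E)%E.
Proof.
have Kfin := integral_cesdual b0 q0; set K1 := (\int[mu]_u _)%E in Kfin.
have K10 : (0 <= K1)%E by apply: integral_ge0 => u _; rewrite lee_fin mulr_ge0 ?powR_ge0// div0.
have KF : (K1 = (fine K1)%:E)%E by rewrite fineK// ge0_fin_numE.
exists (2 `^ q * fine K1 `^ q); first by rewrite mulr_ge0 ?powR_ge0.
move=> kap r0 r e k0 r00 e0 He rk; have mA := @measurable_above R W kap mW.
have rr : 0 < r by rewrite -(pmulr_lgt0 _ k0) (lt_le_trans r00).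
have IA : (\int[mu]_u (above W kap u / th u * (th u)^-1 `^ (- q^-1))%:E <= K1)%E.
  apply: ge0_le_lintegral.
  - by apply/measurable_EFinP; apply: measurable_funM; [exact: (measurable_Vd mA mth)|exact: mthp].
  - by apply/measurable_EFinP; apply: measurable_funM; [exact: (measurable_Vd mW mth)|exact: mthp].
  - by move=> u; rewrite lee_fin mulr_ge0 ?powR_ge0// div0// above_ge0.
  - move=> u; rewrite lee_fin ler_wpM2r ?powR_ge0// ler_wpM2r ?invr_ge0 ?(ltW (th0 u))//.
    exact: above_le.
have I0 : (0 <= \int[mu]_u (above W kap u / th u * (th u)^-1 `^ (- q^-1))%:E)%E.
  by apply: integral_ge0 => u _; rewrite lee_fin mulr_ge0 ?powR_ge0// div0// above_ge0.
have Ifin := le_lt_trans IA Kfin.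
have L := @Lpow_cint_le R q (fun u => above W kap u / th u) (fun u => (th u)^-1 `^ (- q^-1))
  (fun w : R * R => diff_dilate th f g r w.2 w.1) e%:E (ltW q1) (measurable_Vd mA mth) (mthp _).
apply: le_trans (L _ _ _ _ _ Ifin) _.
- exact: cmfun_diff_dilate.
- by move=> u; apply: div0; exact: above_ge0.
- by move=> u; rewrite powR_gt0// invr_gt0.
- by rewrite lee_fin.
- move=> u Vu.
  have ku : r0 <= r * th u.
    apply: le_trans rk _; rewrite ler_pM2l//.
    move: Vu; rewrite /above /cesW /cesth; case: (leP u kap) => uk; first by rewrite mul0r eqxx.
    by case: ifPn => _; [move=> _; exact: ltW|rewrite mul0r eqxx].
  have D := @Lpow_dilate R q (th u) (fun t => fourier_trunc f (r * th u) t - g t) (th0 u) (cmfunB (cmfun_trunc _ mf) mg).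
  rewrite [X in (X <= _)%E]D -powRrM mulNr mulVf ?gt_eqF// powR_inv1 ?invr_ge0 ?(ltW (th0 u))// invrK muleC.
  by rewrite lee_wpmul2r ?lee_fin ?(ltW (th0 u))//; exact: He.
apply: (@le_trans _ _ ((2 `^ q)%:E * (K1 `^ q * e%:E))%E).
  rewrite lee_wpmul2l ?lee_fin ?powR_ge0// lee_wpmul2r ?lee_fin//.
  by apply: le_poweR; [exact: ltW|exact: I0|exact: IA].
by rewrite KF poweR_EFin -!EFinM lee_fin mulrA.
Qed.

(** Below kap the transform and g are separated; above it their difference is kept. The form P - (B
    - C) uses subtraction only, matching [cintB] and [Lpow_sub_le]. *)
Lemma diff_dilate_split (kap r t : R) :
  (ahausdorff (fun u => W u / th u)%R (fun u => (th u)^-1)%R g t < +oo)%E ->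
  cintegral setT (fun u => (W u / th u)%:C * diff_dilate th f g r t u) =
  lowpart beta f kap r t -
  (cintegral setT (fun u => (below W kap u / th u)%:C * g (t / th u)) -
   cintegral setT (fun u => (above W kap u / th u)%:C * diff_dilate th f g r t u)).
Proof.
move=> gt; have mB := @measurable_below R W kap mW; have mA := @measurable_above R W kap mW.
have B0 := @below_ge0 R W kap W0; have A0 := @above_ge0 R W kap W0.
have mgt : cmfun (fun u => g (t / th u)).
  by apply: (cmfun_comp _ mg); exact: (measurable_funM (measurable_cst t) (measurable_thd mth)).
have mF : cmfun (fun u => fourier_trunc f (r * th u) (t / th u)).
  apply: (@cmfun_comp R _ _ _ _ (fun u : R => (u, t)) _ _ (cmfun_trunc_dilate mth th0 r mf)).
  exact: measurable_pair2.
have mp : measurable_fun setT (fun u => th u `^ (- p^-1)).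
  exact: (measurableT_comp (measurable_powR _) mth).
have mVr (V : R -> R) : measurable_fun setT V -> cmfun (fun u => (V u / th u)%:C).
  by move=> mV; apply: cmfun_real; exact: measurable_Vd.
have LV (V : R -> R) : measurable_fun setT V -> (forall u, 0 <= V u <= W u) ->
    cL1 (fun u => (V u / th u)%:C * fourier_trunc f (r * th u) (t / th u)) /\
    cL1 (fun u => (V u / th u)%:C * g (t / th u)).
  move=> mV VW; have V0 u : 0 <= V u by case/andP: (VW u).
  split.
    apply: trunc_dilate_L1 => //.
    apply: (@ahausdorff_loc R V th mV mth V0 th0 p r f (ltW p1) mf _ Lf).
    by apply: (integral_mul_le_lty mW mV mp VW _ (integral_ces b0 p1)) => u; exact: powR_ge0.
  apply: (@cL1_le _ (fun u => W u / th u * cnorm (g (t / th u)))) => //.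
  - by apply: cmfunM => //; exact: mVr.
  - by apply: measurable_funM; [exact: measurable_Vd|exact: measurable_cnorm].
  - move=> u; rewrite cnormM cnormR ger0_norm ?div0// ler_wpM2r ?cnorm_ge0//.
    by rewrite ler_wpM2r ?invr_ge0 ?(ltW (th0 u))//; case/andP: (VW u).
have [LB1 LB2] := LV _ mB (fun u => introT andP (conj (B0 u) (below_le kap W0 u))).
have [LA1 LA2] := LV _ mA (fun u => introT andP (conj (A0 u) (above_le kap W0 u))).
have mBF := cmfunM (mVr _ mB) mF; have mBg := cmfunM (mVr _ mB) mgt.
have mAF := cmfunM (mVr _ mA) mF; have mAg := cmfunM (mVr _ mA) mgt.
have LA : cL1 (fun u => (above W kap u / th u)%:C * diff_dilate th f g r t u).
  have := cL1B mAF mAg LA1 LA2.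
  by congr (cL1 _); apply/funext => u; rewrite /diff_dilate mulrBr.
have mAD : cmfun (fun u => (above W kap u / th u)%:C * diff_dilate th f g r t u).
  by apply: cmfunM; [exact: mVr|exact: cmfunB].
rewrite -cintB// /lowpart -cintB//.
- congr (cintegral setT _); apply/funext => u.
  by rewrite {1}(below_above W kap u) mulrDl rmorphD/= /diff_dilate; ring.
- exact: cmfunB.
- exact: cL1B.
Qed.

Lemma diff_dilate_cesaro_cvg0 :
  (forall e, 0 < e -> exists2 r0, 0 < r0 & forall r, r0 <= r ->
    (Lpow q (fun t => fourier_trunc f r t - g t)%R <= e%:E)%E) ->
  forall e, 0 < e -> exists2 r0, 0 < r0 & forall r, r0 <= r ->
    (Lpow q (fun t => cintegral setT (fun u => (W u / th u)%:C * diff_dilate th f g r t u)%R)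
       <= e%:E)%E.
Proof.
move=> Hc e e0.
have [KP KP0 HP] := lowpart_Lpow b0 p1 p2 mf Lf.
have [KB KB0 HB] := lowdual_Lpow; have [KC KC0 HC] := highpart_Lpow.
pose c : R := 2 `^ q; have c0 : 0 <= c by exact: powR_ge0.
(* Collects the constants of two successive uses of [Lpow_sub_le]; the 1 makes it positive. *)
pose A := c * (KP + c * (KB + KC)) + 1.
have A0 : 0 < A by rewrite ltr_wpDl// mulr_ge0// addr_ge0// mulr_ge0// addr_ge0.
pose h := e / A; have h0 : 0 < h by rewrite divr_gt0.
have [r0 r00 Hr] := Hc h h0.
(* Respectively: the range required by the kernel bound, smallness of the term linear in kap, and
   smallness of the term in kap^(1/2). *)
pose kap := Num.min 2^-1 (Num.min h (h ^+ 2)).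
have k0 : 0 < kap by rewrite !lt_min invr_gt0 ltr0n h0 exprn_gt0.
have k2 : kap <= 2^-1 by rewrite /kap ge_min lexx.
have kh : kap <= h by rewrite /kap !ge_min lexx orbT.
have kh2 : kap <= h ^+ 2 by rewrite /kap !ge_min lexx !orbT.
have ks : kap `^ 2^-1 <= h.
  have -> : h = (h ^+ 2) `^ 2^-1 by rewrite powR12_sqrt ?sqr_ge0// sqrtr_sqr gtr0_norm.
  by rewrite ge0_ler_powR ?nnegrE ?(ltW k0) ?sqr_ge0.
(* With kap already fixed, this threshold gives r kap >= r0. *)
exists (r0 / kap) => [|r]; first exact: divr_gt0.
rewrite ler_pdivrMr// => rk; have rr : 0 < r by rewrite -(pmulr_lgt0 _ k0) (lt_le_trans r00).
have mB := @measurable_below R W kap mW; have mA := @measurable_above R W kap mW.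
have mVr (V : R -> R) : measurable_fun setT V -> cmfun (fun w : R * R => (V w.2 / th w.2)%:C).
  by move=> mV; apply: cmfun_real; exact: (measurableT_comp (measurable_Vd mV mth)).
have mD : cmfun (fun w : R * R => diff_dilate th f g r w.1 w.2).
  exact: (cmfun_comp (@measurable_swap _ _ _ _) (cmfun_diff_dilate mth th0 r mf mg)).
set P := lowpart beta f kap r in (HP).
pose B t := cintegral setT (fun u => (below W kap u / th u)%:C * g (t / th u)).
pose C t := cintegral setT (fun u => (above W kap u / th u)%:C * diff_dilate th f g r t u).
have mP : cmfun (lowpart beta f kap r).
  apply: (@cmfun_cint R _ _ (fun w : R * R => (below W kap w.2 / th w.2)%:C * fourier_trunc f (r * th w.2) (w.1 / th w.2))).
  apply: (cmfunM (mVr _ mB)).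
  exact: (cmfun_comp (@measurable_swap _ _ _ _) (cmfun_trunc_dilate mth th0 r mf)).
have mBt : cmfun B.
  apply: (@cmfun_cint R _ _ (fun w : R * R => (below W kap w.2 / th w.2)%:C * g (w.1 / th w.2))).
  apply: (cmfunM (mVr _ mB)).
  exact: (cmfun_comp (@measurable_swap _ _ _ _) (cmfun_comp (measurable_div_fst mth) mg)).
have mC : cmfun C.
  apply: (@cmfun_cint R _ _ (fun w : R * R => (above W kap w.2 / th w.2)%:C * diff_dilate th f g r w.1 w.2)).
  exact: (cmfunM (mVr _ mA)).
rewrite (@Lpow_ae R q _ (fun t => lowpart beta f kap r t - (B t - C t))); last first.
- have Kd := integral_cesdual b0 q0.
  have Vd0 u : 0 <= W u / th u by exact: div0.
  have td0 u : 0 < (th u)^-1 by rewrite invr_gt0.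
  apply: (ae_imp (ae_ahausdorff_fin (measurable_Vd mW mth) (measurable_thd mth) Vd0 td0 (ltW q1) mg Kd Lg)) => t gt.
  exact: diff_dilate_split.
- by apply: (cmfunB mP); exact: cmfunB.
- apply: (@cmfun_cint R _ _ (fun w : R * R => (W w.2 / th w.2)%:C * diff_dilate th f g r w.1 w.2)).
  exact: (cmfunM (mVr _ mW)).
apply: le_trans (Lpow_sub_le (ltW q0) mP (cmfunB mBt mC)) _.
have LB := HB kap k0; have LP := HP kap r k0 k2 rr.
have LC := HC kap r0 r h k0 r00 (ltW h0) Hr rk.
have LBC : (Lpow q (fun t => B t - C t)%R <= (c * (KB * kap `^ 2^-1 + KC * h))%:E)%E.
  apply: le_trans (Lpow_sub_le (ltW q0) mBt mC) _.
  rewrite EFinM EFinD lee_wpmul2l ?lee_fin//; exact: leeD.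
apply: (@le_trans _ _ (c * (KP * kap + c * (KB * kap `^ 2^-1 + KC * h)))%:E).
  by rewrite EFinM EFinD lee_wpmul2l ?lee_fin//; exact: leeD.
rewrite lee_fin; apply: (@le_trans _ _ (c * (KP * h + c * (KB * h + KC * h)))).
  by rewrite ler_wpM2l// lerD ?ler_wpM2l// lerD2r ler_wpM2l.
have -> : e = A * h by rewrite /h mulrC mulfVK// gt_eqF.
rewrite /A; rewrite mulrDl mul1r.
have -> : c * (KP * h + c * (KB * h + KC * h)) = c * (KP + c * (KB + KC)) * h by ring.
by rewrite lerDl ltW.
Qed.

End cesaro.

Lemma fourier_Ces (beta p : R) f g : 0 < beta -> 1 < p -> p <= 2 -> is_fourier p f g ->
  is_fourier p (Ces beta f) (hausdorff (fun u => cesW beta u / cesth u) (fun u => (cesth u)^-1) g).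
Proof.
move=> b0 p1 p2 fg; have p0 : 0 < p by exact: lt_trans p1.
have q1 := conj_exp_gt1 p1; have q0 : 0 < conj_exp p by exact: lt_trans q1.
have mW := @measurable_cesW R beta; have mth := @measurable_cesth R.
have [Lpf] := fg; rewrite gt_eqF// => -[Lqg Hc].
have [mf Lf] := (in_LpE f p0).1 Lpf; have [mg Lg] := (in_LpE g q0).1 Lqg.
have -> : Ces beta f = hausdorff (cesW beta) (@cesth R) f by apply/funext => t; exact: CesE.
apply: (is_fourier_hausdorff mW mth (cesW_ge0 b0) (@cesth_gt0 R) p1 fg (integral_ces b0 p1) (integral_cesdual b0 q0)).
apply: diff_dilate_cesaro_cvg0 => //.
exact: (Lpow_cvg0 (fun r t => fourier_trunc f r t - g t) q0).1.
Qed.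

End cesaro_fourier.

Theorem theorem6p4 (R : realType) (beta : R) (hbeta : 0 < beta) :
  (* (i) *)
  (forall (p : R) (f g : R -> R[i]),
      1 < p <= 2 -> in_Lp p f -> is_fourier p f g ->
      exists h : R -> R[i], is_fourier p (Ces beta f) h /\
        {ae @lebesgue_measure R, forall t, h t = Cesdual beta g t}) /\
  (* (ii) *)
  (forall (p : R) (f g : R -> R[i]),
      1 <= p <= 2 -> in_Lp p f -> is_fourier p f g ->
      exists h : R -> R[i], is_fourier p (Cesdual beta f) h /\
        {ae @lebesgue_measure R, forall t, h t = Ces beta g t}).
Proof.
split=> p f g /andP[p1 p2] _ fg.
  (* This average can differ from the dual operator only at t = 0, where the latter is 0 by
     convention. *)
  exists (hausdorff (fun u => cesW beta u / cesth u) (fun u => (cesth u)^-1) g).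
  apply: (conj (fourier_Ces hbeta p1 p2 fg)).
  have q0 : 0 < conj_exp p by exact: lt_trans (conj_exp_gt1 p1).
  have [_] := fg; rewrite gt_eqF// => -[Lqg _].
  have [mg _] := (in_LpE g q0).1 Lqg.
  by apply: (ae_imp (ae_neq (0 : R))) => t t0; rewrite CesdualE.
(* No exceptional point arises here, since the Cesaro operator equals its average at every t. *)
exists (Ces beta g); apply: conj; last exact: aeW.
move: p1 fg; rewrite le_eqVlt => /predU1P[<-|p1] fg; first exact: fourier_Cesdual_1.
exact: fourier_Cesdual_gt1.
Qed.
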